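(* Let $(\eta_e,\psi_e)$ be a $2\pi/\alpha$-periodic steady wave without stagnation. The linearized water-wave problem around $(\eta_e,\psi_e)$ has the following invariants, i.e. for any solution $(\eta,\psi)$ of the linearized problem each of these quantities is independent of time. The energy $$\mathcal E(\eta,\psi)=\iint_{\mathcal D_e}\tfrac12|\nabla\psi|^2dydx-\iint_{\mathcal D_e}\tfrac12\gamma'(\psi_e)^{-1}|\omega|^2dydx+\int_{\mathcal S_e}\tfrac12\big(\partial_y(\tfrac12|\nabla\psi_e|^2)+g\big)|\eta|^2dx+\mathrm{Re}\int_{\mathcal S_e}\psi_{ey}\,\partial_n\psi\,\eta^*dx$$ when $\gamma$ is monotone (either $\gamma'<0$ or $\gamma'>0$ on $[0,|p_0|]$), and $$\mathcal E(\eta,\psi)=\iint_{\mathcal D_e}\tfrac12|\nabla\psi|^2dydx+\int_{\mathcal S_e}\tfrac12\big(\partial_y(\tfrac12|\nabla\psi_e|^2)+g\big)|\eta|^2dx+\mathrm{Re}\int_{\mathcal S_e}\psi_{ey}\,\partial_n\psi\,\eta^*dx$$ when $\gamma\equiv0$ (irrotational). In addition, the linearized problem has the invariants $$\mathcal M(\eta,\psi)=\int_{\mathcal S_e}(\psi+\psi_{ey}\eta)\,dx,\qquad m(\eta,\psi)=\int_{\mathcal S_e}\eta\,dx,\qquad\mathcal F(\eta,\psi)=\iint_{\mathcal D_e}\omega\,\xi\,dydx$$ for any $\xi\in\ker(\psi_{ey}\partial_x-\psi_{ex}\partial_y)\subset L^2(\mathcal D_e)$.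
   Context: Let $g>0$, $\alpha>0$. Steady wave: for $p_0<0$, $\gamma\in C^{1+\beta}([0,|p_0|])$, $\beta\in(0,1)$, and $B\in\mathbb R$, $(\eta_e,\psi_e)$ is $2\pi/\alpha$-periodic in $x$, $\psi_{ey}<0$ in the fluid region (no stagnation), and $-\Delta\psi_e=\gamma(\psi_e)$ in $0<y<\eta_e(x)$; $\psi_e=0$ and $|\nabla\psi_e|^2+2gy=B$ on $y=\eta_e(x)$; $\psi_e=-p_0$ on $y=0$. The steady pressure $P_e$, constant on $y=\eta_e(x)$, satisfies $\psi_{ey}\psi_{exy}-\psi_{ex}\psi_{eyy}=-P_{ex}$, $-\psi_{ey}\psi_{exx}+\psi_{ex}\psi_{exy}=-P_{ey}-g$. $\mathcal D_e=\{0<x<2\pi/\alpha,\,0<y<\eta_e(x)\}$, $\mathcal S_e=\{(x,\eta_e(x)):0<x<2\pi/\alpha\}$. On $\mathcal S_e$: $\partial_\tau f=\partial_xf+\eta_{ex}\partial_yf$, $\partial_nf=\partial_yf-\eta_{ex}\partial_xf$ (not normalized), and $\int_{\mathcal S_e}f\,dx=\int_0^{2\pi/\alpha}f(x,\eta_e(x))\,dx$. $\Omega=\gamma(0)$ is the constant steady vorticity on $\mathcal S_e$; $^*$ is complex conjugation (solutions may be complex-valued). Linearized water-wave problem for $\eta(t;x)$, $\psi(t;x,y)$, $2\pi/\alpha$-periodic in $x$, with $\omega=-\Delta\psi$: $$\partial_t\omega+(\psi_{ey}\partial_x\omega-\psi_{ex}\partial_y\omega)=\gamma'(\psi_e)(\psi_{ey}\partial_x\psi-\psi_{ex}\partial_y\psi)\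 \text{in }\mathcal D_e,$$ $$\partial_t\eta+\partial_\tau(\psi_{ey}\eta)+\partial_\tau\psi=0,\quad P+P_{ey}\eta=0,\quad\partial_t\partial_n\psi+\partial_\tau(\psi_{ey}\partial_n\psi)+\Omega\partial_\tau\psi+\partial_\tau P=0\ \text{on }\mathcal S_e,$$ $$\partial_x\psi=0\ \text{on }y=0.$$ Here $\psi$ is the stream function of the velocity deviation $(u,v)=(\psi_y,-\psi_x)$ and $P$ is the pressure deviation (with which $(u,v)$ satisfies the Euler equations linearized about the steady flow in $\mathcal D_e$).
   Formalization: Invariance of M is asserted only when ψ on the bed y=0 is independent of t (ψ+c(t) is again a solution and shifts M); the energy for γ≡0 is asserted only for irrotational perturbations (ω=0 in D_e), since otherwise it is not conserved. *)

(* Defs.v *)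
From HB Require Import structures.
From mathcomp Require Import all_boot all_order all_algebra.
From mathcomp Require Import complex.
From mathcomp Require Import all_classical all_reals all_analysis.

Set Implicit Arguments.
Unset Strict Implicit.
Unset Printing Implicit Defensive.

Import Order.TTheory GRing.Theory Num.Theory.
Import numFieldNormedType.Exports.

Local Open Scope classical_set_scope.
Local Open Scope ring_scope.
Local Open Scope complex_scope.

Definition period {R : realType} (alpha : R) : R := 2 * pi / alpha.

Definition rdx {R : realType} (f : R -> R -> R) (x y : R) : R :=
  derive1 (fun s => f s y) x.
Definition rdy {R : realType} (f : R -> R -> R) (x y : R) : R :=
  derive1 (fun s => f x s) y.

(* R[i] is not a normed module over R in the library, so complex-valued
   functions of real variables are differentiated (and, below, integrated)
   through their real and imaginary parts. *)
Definition cderive {R : realType} (f : R -> R[i]) (s : R) : R[i] :=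
  derive1 (fun r => complex.Re (f r)) s +i*
  derive1 (fun r => complex.Im (f r)) s.

Definition cdx {R : realType} (f : R -> R -> R[i]) (x y : R) : R[i] :=
  cderive (fun s => f s y) x.
Definition cdy {R : realType} (f : R -> R -> R[i]) (x y : R) : R[i] :=
  cderive (fun s => f x s) y.

Definition abs2 {R : realType} (z : R[i]) : R :=
  complex.Re z ^+ 2 + complex.Im z ^+ 2.

Definition gradsq {R : realType} (f : R -> R -> R[i]) (x y : R) : R :=
  abs2 (cdx f x y) + abs2 (cdy f x y).

Definition half_gradsq_steady {R : realType} (psie : R -> R -> R)
    (x y : R) : R :=
  2^-1 * (rdx psie x y ^+ 2 + rdy psie x y ^+ 2).

(* A function is C^k on a closed region K when it is (the restriction of) a
   function that is C^k on some open neighbourhood of K; derivatives at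
   boundary points are then ordinary derivatives.  For the regions used here
   this agrees with C^k in the interior with derivatives extending
   continuously to the boundary (Whitney extension). *)

Definition C1_on {R : realType} (f : R -> R -> R) (K : set (R * R)) : Prop :=
  forall p, K p -> \forall q \near p,
    [/\ derivable (fun s => f s q.2) q.1 1,
        derivable (fun s => f q.1 s) q.2 1,
        {for q, continuous (fun z : R * R => rdx f z.1 z.2)} &
        {for q, continuous (fun z : R * R => rdy f z.1 z.2)}].

Definition C2_on {R : realType} (f : R -> R -> R) (K : set (R * R)) : Prop :=
  [/\ C1_on f K, C1_on (rdx f) K & C1_on (rdy f) K].

Definition C1_txy {R : realType} (f : R -> R -> R -> R)
    (K : set (R * (R * R))) : Prop :=
  forall p, K p -> \forall q \near p,
    [/\ derivable (fun s => f s q.2.1 q.2.2) q.1 1,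
        derivable (fun s => f q.1 s q.2.2) q.2.1 1 &
        derivable (fun s => f q.1 q.2.1 s) q.2.2 1] /\
    [/\ {for q, continuous (fun z : R * (R * R) =>
          derive1 (fun s => f s z.2.1 z.2.2) z.1)},
        {for q, continuous (fun z : R * (R * R) => rdx (f z.1) z.2.1 z.2.2)} &
        {for q, continuous (fun z : R * (R * R) => rdy (f z.1) z.2.1 z.2.2)}].

(* C^1 in (x, y), the function and its space derivatives being jointly
   continuous in (t, x, y); no differentiability in t. *)
Definition C1_xy {R : realType} (f : R -> R -> R -> R)
    (K : set (R * (R * R))) : Prop :=
  forall p, K p -> \forall q \near p,
    [/\ derivable (fun s => f q.1 s q.2.2) q.2.1 1 &
        derivable (fun s => f q.1 q.2.1 s) q.2.2 1] /\
    [/\ {for q, continuous (fun z : R * (R * R) => f z.1 z.2.1 z.2.2)},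
        {for q, continuous (fun z : R * (R * R) => rdx (f z.1) z.2.1 z.2.2)} &
        {for q, continuous (fun z : R * (R * R) => rdy (f z.1) z.2.1 z.2.2)}].

Definition cC1_on {R : realType} (f : R -> R -> R[i]) (K : set (R * R)) :
    Prop :=
  C1_on (fun x y => complex.Re (f x y)) K /\
  C1_on (fun x y => complex.Im (f x y)) K.

Definition cC1_txy {R : realType} (f : R -> R -> R -> R[i])
    (K : set (R * (R * R))) : Prop :=
  C1_txy (fun t x y => complex.Re (f t x y)) K /\
  C1_txy (fun t x y => complex.Im (f t x y)) K.

Definition cC1_xy {R : realType} (f : R -> R -> R -> R[i])
    (K : set (R * (R * R))) : Prop :=
  C1_xy (fun t x y => complex.Re (f t x y)) K /\
  C1_xy (fun t x y => complex.Im (f t x y)) K.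

(* gamma in C^{1+beta}([a, b]), with the same convention at the end points. *)
Definition C1_holder {R : realType} (beta a b : R) (gamma : R -> R) : Prop :=
  (forall s, s \in `[a, b] -> derivable gamma s 1) /\
  exists K : R, forall s r, s \in `[a, b] -> r \in `[a, b] ->
    `|derive1 gamma s - derive1 gamma r| <= K * (`|s - r| `^ beta).

Definition open_fluid {R : realType} (etae : R -> R) : set (R * R) :=
  [set p | 0 < p.2 /\ p.2 < etae p.1].

Definition closed_fluid {R : realType} (etae : R -> R) : set (R * R) :=
  [set p | 0 <= p.2 /\ p.2 <= etae p.1].

Definition cell {R : realType} (L : R) (etae : R -> R) : set (R * R) :=
  [set p | 0 < p.1 /\ p.1 < L /\ open_fluid etae p].

Definition leb2 {R : realType} :=
  ((@lebesgue_measure R) \x (@lebesgue_measure R))%E.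

Definition area_int {R : realType} (D : set (R * R)) (f : R -> R -> R) : R :=
  \int[leb2]_(p in D) f p.1 p.2.

Definition carea_int {R : realType} (D : set (R * R)) (f : R -> R -> R[i]) :
    R[i] :=
  area_int D (fun x y => complex.Re (f x y)) +i*
  area_int D (fun x y => complex.Im (f x y)).

(* int_{S_e} f dx: the measure is dx, not arc length. *)
Definition surf_int {R : realType} (L : R) (etae : R -> R)
    (f : R -> R -> R) : R :=
  \int[lebesgue_measure]_(x in `]0, L[) f x (etae x).

Definition csurf_int {R : realType} (L : R) (etae : R -> R)
    (f : R -> R -> R[i]) : R[i] :=
  surf_int L etae (fun x y => complex.Re (f x y)) +i*
  surf_int L etae (fun x y => complex.Im (f x y)).

(* Tangential and normal derivatives along S_e, not normalized; they are
   evaluated at y = etae x.  A quantity given on S_e only, such as eta, is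
   extended to be constant in y. *)
Definition dtau {R : realType} (etae : R -> R) (f : R -> R -> R[i])
    (x y : R) : R[i] :=
  cdx f x y + (derive1 etae x)%:C * cdy f x y.

Definition dn {R : realType} (etae : R -> R) (f : R -> R -> R[i])
    (x y : R) : R[i] :=
  cdy f x y - (derive1 etae x)%:C * cdx f x y.

Record steady_wave {R : realType} (g alpha p0 beta B : R) (gamma : R -> R)
    (etae : R -> R) (psie : R -> R -> R) : Prop := SteadyWave {
  sw_g : 0 < g;
  sw_alpha : 0 < alpha;
  sw_p0 : p0 < 0;
  sw_beta : 0 < beta < 1;
  sw_gamma : C1_holder beta 0 `|p0| gamma;
  sw_eta_pos : forall x, 0 < etae x;
  sw_eta_reg : (forall x, derivable etae x 1) /\
    (forall x, derivable (derive1 etae) x 1) /\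
    continuous (derive1 (derive1 etae));
  sw_psi_reg : C2_on psie (closed_fluid etae);
  sw_eta_per : forall x, etae (x + period alpha) = etae x;
  sw_psi_per : forall x y, psie (x + period alpha) y = psie x y;
  sw_no_stagnation : forall x y, open_fluid etae (x, y) -> rdy psie x y < 0;
  sw_vorticity : forall x y, open_fluid etae (x, y) ->
    - (rdx (rdx psie) x y + rdy (rdy psie) x y) = gamma (psie x y);
  sw_surface : forall x, psie x (etae x) = 0;
  sw_bernoulli : forall x,
    rdx psie x (etae x) ^+ 2 + rdy psie x (etae x) ^+ 2 + 2 * g * etae x = B;
  sw_bed : forall x, psie x 0 = - p0
}.

Record steady_pressure {R : realType} (g : R) (etae : R -> R)
    (psie Pe : R -> R -> R) : Prop := SteadyPressure {
  sp_reg : C1_on Pe (closed_fluid etae);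
  sp_x : forall x y, open_fluid etae (x, y) ->
    rdy psie x y * rdy (rdx psie) x y - rdx psie x y * rdy (rdy psie) x y
    = - rdx Pe x y;
  sp_y : forall x y, open_fluid etae (x, y) ->
    - (rdy psie x y * rdx (rdx psie) x y) + rdx psie x y * rdy (rdx psie) x y
    = - rdy Pe x y - g;
  sp_surface : forall x x', Pe x (etae x) = Pe x' (etae x')
}.

Definition transport {R : realType} (psie : R -> R -> R)
    (f : R -> R -> R[i]) (x y : R) : R[i] :=
  (rdy psie x y)%:C * cdx f x y - (rdx psie x y)%:C * cdy f x y.

Definition rtransport {R : realType} (psie : R -> R -> R)
    (f : R -> R -> R) (x y : R) : R :=
  rdy psie x y * rdx f x y - rdx psie x y * rdy f x y.

(* Classical solutions on a time interval I: the derivatives occurring in the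
   equations exist and are continuous up to the boundary.  The vorticity omega is carried
   along as a function of its own, equal to - Delta psi in the fluid: its
   extension across the boundary need not be - Delta of that of psi. *)
Record linearized_solution {R : realType} (L : R) (gamma : R -> R)
    (etae : R -> R) (psie Pe : R -> R -> R) (I : set R)
    (eta : R -> R -> R[i]) (psi omega P : R -> R -> R -> R[i]) : Prop :=
  LinearizedSolution {
  ls_eta_reg : cC1_on eta (I `*` [set: R]);
  ls_psi_reg : cC1_xy psi (I `*` closed_fluid etae);
  ls_psix_reg :
    cC1_txy (fun t x y => cdx (psi t) x y) (I `*` closed_fluid etae);
  ls_psiy_reg :
    cC1_txy (fun t x y => cdy (psi t) x y) (I `*` closed_fluid etae);
  ls_omega_reg : cC1_txy omega (I `*` closed_fluid etae);
  ls_P_reg : cC1_xy P (I `*` closed_fluid etae);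
  ls_eta_per : forall t x, I t -> eta t (x + L) = eta t x;
  ls_psi_per : forall t x y, I t -> psi t (x + L) y = psi t x y;
  ls_omega_per : forall t x y, I t -> omega t (x + L) y = omega t x y;
  ls_P_per : forall t x y, I t -> P t (x + L) y = P t x y;
  ls_omega : forall t x y, I t -> open_fluid etae (x, y) ->
    omega t x y = - (cdx (cdx (psi t)) x y + cdy (cdy (psi t)) x y);
  ls_vorticity : forall t x y, I t -> cell L etae (x, y) ->
    cderive (fun s => omega s x y) t + transport psie (omega t) x y
    = (derive1 gamma (psie x y))%:C * transport psie (psi t) x y;
  (* linearized Euler equations for (u, v) = (psi_y, - psi_x) *)
  ls_euler_x : forall t x y, I t -> cell L etae (x, y) ->
    cderive (fun s => cdy (psi s) x y) t
    + transport psie (cdy (psi t)) x y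
    + (rdy (rdx psie) x y)%:C * cdy (psi t) x y
    - (rdy (rdy psie) x y)%:C * cdx (psi t) x y
    = - cdx (P t) x y;
  ls_euler_y : forall t x y, I t -> cell L etae (x, y) ->
    - cderive (fun s => cdx (psi s) x y) t
    - transport psie (cdx (psi t)) x y
    - (rdx (rdx psie) x y)%:C * cdy (psi t) x y
    + (rdy (rdx psie) x y)%:C * cdx (psi t) x y
    = - cdy (P t) x y;
  ls_kinematic : forall t x, I t -> 0 < x < L ->
    cderive (fun s => eta s x) t
    + dtau etae (fun a b => (rdy psie a b)%:C * eta t a) x (etae x)
    + dtau etae (psi t) x (etae x) = 0;
  ls_dynamic : forall t x, I t -> 0 < x < L ->
    P t x (etae x) + (rdy Pe x (etae x))%:C * eta t x = 0;
  ls_tangential : forall t x, I t -> 0 < x < L ->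
    cderive (fun s => dn etae (psi s) x (etae x)) t
    + dtau etae (fun a b => (rdy psie a b)%:C * dn etae (psi t) a b)
        x (etae x)
    + (gamma 0)%:C * dtau etae (psi t) x (etae x)
    + dtau etae (P t) x (etae x) = 0;
  ls_bed : forall t x, I t -> cdx (psi t) x 0 = 0
}.

Definition surface_energy {R : realType} (g L : R) (etae : R -> R)
    (psie : R -> R -> R) (eta : R -> R[i]) (psi : R -> R -> R[i]) : R :=
  surf_int L etae (fun x y =>
    2^-1 * (rdy (half_gradsq_steady psie) x y + g) * abs2 (eta x))
  + complex.Re (csurf_int L etae (fun x y =>
      (rdy psie x y)%:C * dn etae psi x y * conjc (eta x))).

Definition energy_monotone {R : realType} (g L : R) (gamma : R -> R)
    (etae : R -> R) (psie : R -> R -> R)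
    (eta : R -> R[i]) (psi omega : R -> R -> R[i]) : R :=
  area_int (cell L etae) (fun x y => 2^-1 * gradsq psi x y)
  - area_int (cell L etae) (fun x y =>
      2^-1 * (derive1 gamma (psie x y))^-1 * abs2 (omega x y))
  + surface_energy g L etae psie eta psi.

Definition energy_irrotational {R : realType} (g L : R)
    (etae : R -> R) (psie : R -> R -> R)
    (eta : R -> R[i]) (psi : R -> R -> R[i]) : R :=
  area_int (cell L etae) (fun x y => 2^-1 * gradsq psi x y)
  + surface_energy g L etae psie eta psi.

Definition momentum {R : realType} (L : R) (etae : R -> R)
    (psie : R -> R -> R) (eta : R -> R[i]) (psi : R -> R -> R[i]) : R[i] :=
  csurf_int L etae (fun x y => psi x y + (rdy psie x y)%:C * eta x).

Definition mass {R : realType} (L : R) (etae : R -> R) (eta : R -> R[i]) :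
    R[i] :=
  csurf_int L etae (fun x _ => eta x).

Definition casimir {R : realType} (L : R) (etae : R -> R)
    (xi omega : R -> R -> R[i]) : R[i] :=
  carea_int (cell L etae) (fun x y => omega x y * xi x y).

(* The stream function of a given velocity field is determined up to a
   function of t, and the linearized problem does not see that function; its
   value on the bed (constant in x) is normalized to be independent of t. *)
Definition bed_normalized {R : realType} (I : set R)
    (psi : R -> R -> R -> R[i]) : Prop :=
  forall s t x, I s -> I t -> psi s x 0 = psi t x 0.

(* For gamma = 0 the vorticity of a perturbation is merely transported; without
   omega = 0 the irrotational energy need not be conserved. *)
Definition irrotational {R : realType} (L : R) (etae : R -> R) (I : set R)
    (omega : R -> R -> R -> R[i]) : Prop :=
  forall t x y, I t -> cell L etae (x, y) -> omega t x y = 0.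

Definition square_integrable {R : realType} (D : set (R * R))
    (f : R -> R -> R) : Prop :=
  measurable_fun D (fun p : R * R => f p.1 p.2) /\
  (leb2.-integrable D (fun p : R * R => (f p.1 p.2 ^+ 2)%:E)).

Definition test_function {R : realType} (D : set (R * R))
    (phi : R -> R -> R) : Prop :=
  C1_on phi setT /\
  exists K : set (R * R), [/\ compact K, K `<=` D &
    forall x y, ~ K (x, y) -> phi x y = 0].

(* xi in ker (psi_ey d_x - psi_ex d_y), as an operator in L^2 of the cell: the
   derivative is in the sense of distributions, and the coefficient field is
   divergence free, so that the formal adjoint is minus the operator. *)
Definition transport_kernel {R : realType} (L : R) (etae : R -> R)
    (psie : R -> R -> R) (xi : R -> R -> R[i]) : Prop :=
  [/\ square_integrable (cell L etae) (fun x y => complex.Re (xi x y)),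
      square_integrable (cell L etae) (fun x y => complex.Im (xi x y)) &
      forall phi, test_function (cell L etae) phi ->
        carea_int (cell L etae)
          (fun x y => xi x y * (rtransport psie phi x y)%:C) = 0].

Definition time_invariant {R : realType} {T : Type} (I : set R)
    (F : R -> T) : Prop :=
  forall s t, I s -> I t -> F s = F t.

(* Main.v *)
(* Every quantity splits into contributions of the real and imaginary parts of
   the perturbation, which are themselves real solutions; for these one shows
   that the time derivative vanishes.

   Mass: by the kinematic condition, d(eta)/dt is the x-derivative of minus the
   periodic function psi + psi_ey eta on the surface.  Momentum: by the
   divergence theorem in the cell and the linearized Euler equation.

   Energy: Green's formula turns the rate of the kinetic energy into the
   integral of psi omega_t over the cell plus that of psi (d_n psi)_t over the
   surface; the bed term vanishes because the circulation along the bed is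
   conserved.  By the boundary conditions the surface term and the rate of the
   surface energy add up to the integral of an x-derivative.  By the vorticity
   equation psi omega_t differs from the rate of
   omega^2 / (2 gamma'(psi_e)) by transport terms G(psi_e) (psi_ey d_x - psi_ex d_y) h,
   which have mean zero.

   Casimirs: the same transport terms integrate to zero against any xi in the
   weak kernel.  Test functions must have compact support in the cell, whereas
   h is merely periodic.  Since the operator annihilates functions of psi_e,
   one may subtract from h its boundary value at x = 0, continued along the
   streamlines; the difference vanishes on both vertical sides, and cutting it
   off there and near the streamlines psi_e = 0 and psi_e = -p0 costs nothing
   in the limit. *)

Require Import Defs.
From HB Require Import structures.
From mathcomp Require Import all_boot all_order all_algebra.
From mathcomp Require Import complex ring lra.
From mathcomp Require Import all_classical all_reals all_analysis.
From mathcomp Require Import measurable_realfun.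

Set Implicit Arguments.
Unset Strict Implicit.
Unset Printing Implicit Defensive.

Import Order.TTheory GRing.Theory Num.Theory.
Import numFieldNormedType.Exports.

Local Open Scope classical_set_scope.
Local Open Scope ring_scope.

(** * Calculus in the plane *)

(** Two gaps in regularity shape the argument. First, [psi] is not assumed differentiable in time,
    and the time derivatives of its gradient are only continuous in space. Hence the rate of the
    kinetic energy comes from differentiating Green's formula in time, not from applying that
    formula to the rate of [psi]; likewise momentum is followed through [psi_y]. Second, [gamma'] is
    only Hoelder continuous, so the weights [G(psie)] in the energy and Casimir arguments are merely
    continuous. They are reached from $C^1$ weights supported away from the bed and surface values
    of [psie]: only between these values can streamlines be parametrized differentiably by their
    height, because [psi_ey < 0] is known in the open fluid alone.

    Energy and Casimirs share one statement: the mean-zero transport terms of the energy are its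
    case [xi = 1], where the constant is a kernel element because the transport field is divergence
    free. Equations posed in the open cell are combined with boundary conditions by passing to the
    limit at the surface and the bed. *)

Section Calculus.
Context {R : realType}.
Implicit Types (f g : R -> R -> R) (K : set (R * R)).

Lemma nbhsI (T : topologicalType) (p : T) (P Q : T -> Prop) :
  nbhs p P -> nbhs p Q -> nbhs p (fun q => P q /\ Q q).
Proof. exact: filterI. Qed.

Lemma nbhsS (T : topologicalType) (p : T) (P Q : T -> Prop) :
  (forall q, P q -> Q q) -> nbhs p P -> nbhs p Q.
Proof. exact: filterS. Qed.

Lemma nbhs_forall (T : topologicalType) (p : T) (P : T -> Prop) :
  (forall q, P q) -> nbhs p P.
Proof. exact: filterE. Qed.

Lemma nbhs_near (T : topologicalType) (p : T) (P : T -> Prop) :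
  nbhs p P -> nbhs p (fun q => nbhs q P).
Proof. by move=> Pp; have := nbhs_interior Pp. Qed.

Lemma nbhs_cts (T U : topologicalType) (f : T -> U) (p : T) (P : U -> Prop) :
  {for p, continuous f} -> nbhs (f p) P -> nbhs p (fun q => P (f q)).
Proof. by move=> cf; exact: cf. Qed.

Lemma is_derive_derive1 (u : R -> R) (x : R) :
  derivable u x 1 -> is_derive x 1 u (derive1 u x).
Proof. by move=> du; apply: DeriveDef => //; rewrite derive1E. Qed.

Lemma is_derive_derive1E (u : R -> R) (x d : R) :
  is_derive x 1 u d -> derive1 u x = d.
Proof. by move=> du; rewrite derive1E derive_val. Qed.

Lemma is_derive_continuous (u : R -> R) (x d : R) :
  is_derive x 1 u d -> {for x, continuous u}.
Proof.
by move=> du; apply: differentiable_continuous; apply/derivable1_diffP.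
Qed.

Lemma MVT_closed (u du : R -> R) (a b : R) : a < b ->
  (forall x, x \in `[a, b] -> is_derive x 1 u (du x)) ->
  exists2 c, c \in `[a, b] & u b - u a = du c * (b - a).
Proof.
move=> ab H.
have H1 x : x \in `]a, b[ -> is_derive x 1 u (du x).
  by move=> xi; apply: H; apply: subset_itv_oo_cc xi.
have cu : {within `[a, b], continuous u}.
  apply: continuous_in_subspaceT => x; rewrite inE => xi.
  exact: is_derive_continuous (H x xi).
have [c ci E] := MVT ab H1 cu.
by exists c => //; apply: subset_itv_oo_cc ci.
Qed.

(** The mean value theorem makes each difference quotient a value of the derivative at a nearby
    point, so joint continuity of this one partial derivative controls [Phi] in all variables at
    once. The factorization takes the place of Frechet differentiability in the continuity and
    chain-rule arguments below. *)
Lemma slope_cvg (U : topologicalType) (F : U -> R -> R) (p0 : U) (b : R) :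
  (\forall q \near (p0, b) , derivable (F q.1) q.2 1) ->
  {for (p0, b), continuous (fun q : U * R => derive1 (F q.1) q.2)} ->
  exists2 Phi : U * R -> R, Phi q @[q --> (p0, b)] --> derive1 (F p0) b &
    forall q : U * R, F q.1 q.2 - F q.1 b = Phi q * (q.2 - b).
Proof.
move=> dF cF.
pose Phi (q : U * R) : R := if q.2 == b then derive1 (F q.1) b
  else (F q.1 q.2 - F q.1 b) / (q.2 - b).
exists Phi; last first.
  move=> q; rewrite /Phi; case: eqP => [->|/eqP qb]; first by rewrite !subrr mulr0.
  by rewrite divfK// subr_eq0.
apply/cvgrPdist_lt => e e0.
move/cvgrPdist_lt/(_ e e0) : cF => cF.
have [[A B] [nA nB] sub] := filterI dF cF.
move: nB => /= /nbhs_ballP[d /= d0 dB].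
exists (A, ball b d) => /=; first by split => //; exact: nbhsx_ballx.
move=> [p y] [/= Ap yd].
have key z : ball b d z -> derivable (F p) z 1 /\ `|derive1 (F p0) b - derive1 (F p) z| < e.
  by move=> bz; have := sub (p, z) (conj Ap (dB _ bz)).
rewrite /Phi /=; case: eqP => [_|/eqP yb]; first by case: (key b (ballxx _ d0)).
have inb z0 : z0 \in `[Num.min b y, Num.max b y] -> ball b d z0.
  move: yd; rewrite /ball/= in_itv/= ge_min le_max => yd.
  rewrite !ltr_norml in yd *; move/andP: yd => [y1 y2].
  by case/andP=> /orP[] ? /orP[] ?; apply/andP; split; lra.
have lt : Num.min b y < Num.max b y.
  by case: (ltgtP b y) yb => // ->; rewrite eqxx.
have dFp z : z \in `[Num.min b y, Num.max b y] -> is_derive z 1 (F p) (derive1 (F p) z).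
  by move=> zi; apply: is_derive_derive1; apply: (key z _).1; exact: inb.
have [c ci E] := MVT_closed lt dFp.
have -> : (F p y - F p b) / (y - b) = derive1 (F p) c.
  have yb0 : y - b != 0 by rewrite subr_eq0.
  move: E lt yb; case: (ltgtP b y) => [by_ E _ _|by_ E _ _|//].
    by rewrite E mulfK.
  apply: (mulIf yb0); rewrite divfK//.
  by rewrite -[LHS]opprB E; ring.
apply: (key c _).2; exact: inb.
Qed.

(* C1_on f K is forall p, K p -> C1_at f p, by conversion. *)
Definition C1_at f (p : R * R) : Prop := \forall q \near p,
    [/\ derivable (fun s => f s q.2) q.1 1,
        derivable (fun s => f q.1 s) q.2 1,
        {for q, continuous (fun z : R * R => rdx f z.1 z.2)} &
        {for q, continuous (fun z : R * R => rdy f z.1 z.2)}].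

Definition cts2 f (p : R * R) : Prop := {for p, continuous (fun z : R * R => f z.1 z.2)}.

Lemma C1_at_near f p : C1_at f p -> \forall q \near p, C1_at f q.
Proof. exact: nbhs_near. Qed.

Lemma C1_atP f p : C1_at f p ->
    [/\ derivable (fun s => f s p.2) p.1 1,
        derivable (fun s => f p.1 s) p.2 1, cts2 (rdx f) p & cts2 (rdy f) p].
Proof. exact: nbhs_singleton. Qed.

Lemma C1_at_dx f x y : C1_at f (x, y) ->
  is_derive x 1 (fun s => f s y) (rdx f x y).
Proof. by case/C1_atP => /= d _ _ _; exact: is_derive_derive1. Qed.

Lemma C1_at_dy f x y : C1_at f (x, y) ->
  is_derive y 1 (fun s => f x s) (rdy f x y).
Proof. by case/C1_atP => /= _ d _ _; exact: is_derive_derive1. Qed.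

Lemma C1_at_slope f a b : C1_at f (a, b) ->
  exists2 Phi : R * R -> R, Phi q @[q --> (a, b)] --> rdy f a b &
    forall q, f q.1 q.2 = f q.1 b + Phi q * (q.2 - b).
Proof.
move=> fC; have [_ _ _ cy] := C1_atP fC.
have [|Phi P1 P2] := @slope_cvg R f a b _ cy.
  rewrite /C1_at in fC.
  refine (filterS _ fC).
  move=> q.
  case=> _ dy _ _.
  exact: dy.
by exists Phi => // q; rewrite -P2; ring.
Qed.

(** In [f x b + Phi * (y - b)] the first term depends on one variable only, and the second tends to
    0 because [Phi] has a limit. *)
Lemma C1_at_cts f p : C1_at f p -> cts2 f p.
Proof.
case: p => a b fC; have [Phi P1 P2] := C1_at_slope fC.
rewrite /cts2 (_ : (fun z : R * R => f z.1 z.2) =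
   (fun z => f z.1 b + Phi z * (z.2 - b))); last by apply/funext => z.
have ca : {for a, continuous (fun s => f s b)}.
  exact: is_derive_continuous (C1_at_dx fC).
rewrite /prop_for /continuous_at /= subrr mulr0 addr0.
rewrite -[X in _ --> X]addr0 -[X in _ --> _ + X](mulr0 (rdy f a b)).
apply: cvgD.
  apply: (@cvg_comp _ _ _ fst (fun s => f s b)); [exact: cvg_fst|exact: ca].
apply: cvgM => //; rewrite -[X in _ --> X](subrr b).
by apply: cvgB; [exact: cvg_snd|exact: cvg_cst].
Qed.

(** The increment splits at the corner [(h + a, c a)]: a horizontal difference quotient, plus the
    difference quotient of [c] times the slope [Phi]. The joint limit of [Phi] allows its arguments
    to move together along the curve. *)
Lemma is_derive_curve f (c : R -> R) (a d : R) :
  C1_at f (a, c a) -> is_derive a 1 c d ->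
  is_derive a 1 (fun x => f x (c x)) (rdx f a (c a) + d * rdy f a (c a)).
Proof.
move=> fC dc; have [Phi P1 P2] := C1_at_slope fC.
have cc : c x @[x --> a] --> c a by exact: is_derive_continuous dc.
have dfx := C1_at_dx fC.
have sh : (h + a) @[h --> 0^'] --> a.
  rewrite -[X in _ --> X]add0r; apply: cvgD; last exact: cvg_cst.
  exact: cvg_within.
have Pc : Phi (h + a, c (h + a)) @[h --> 0^'] --> rdy f a (c a).
  apply: (cvg_comp _ _ _ P1).
  exact: cvg_pair sh (cvg_comp _ _ sh cc).
have main : (fun h => h^-1 *: (f (h + a) (c (h + a)) - f a (c a))) @ 0^' -->
   rdx f a (c a) + d * rdy f a (c a).
  rewrite (_ : (fun h => _) = (fun h => h^-1 *: (f (h + a) (c a) - f a (c a)) +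
     (h^-1 *: (c (h + a) - c a)) * Phi (h + a, c (h + a)))); last first.
    by apply/funext => h; rewrite (P2 (h + a, c (h+a))) /= /GRing.scale /=; ring.
  apply: cvgD.
    have [/cvg_ex[l /= L] e] := dfx.
    move: L; under eq_fun do rewrite scaler1.
    move=> L; suff -> : rdx f a (c a) = l by [].
    rewrite -e; apply/cvg_lim => //.
    by under eq_fun do rewrite scaler1.
  apply: cvgM => //.
  have [/cvg_ex[l /= L] e] := dc.
  move: L; under eq_fun do rewrite scaler1.
  move=> L; suff -> : d = l by [].
  rewrite -e; apply/cvg_lim => //.
  by under eq_fun do rewrite scaler1.
apply: DeriveDef.
  by apply/cvg_ex; eexists; under eq_fun do rewrite scaler1; exact: main.
by apply/cvg_lim => //; under eq_fun do rewrite scaler1.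
Qed.

Lemma is_deriveM' (u v : R -> R) (x du dv : R) : is_derive x 1 u du ->
  is_derive x 1 v dv -> is_derive x 1 (fun s => u s * v s) (du * v x + u x * dv).
Proof.
move=> Du Dv; apply: is_derive_eq; rewrite /GRing.scale/=; ring.
Qed.

Lemma is_deriveD' (u v : R -> R) (x du dv : R) : is_derive x 1 u du ->
  is_derive x 1 v dv -> is_derive x 1 (fun s => u s + v s) (du + dv).
Proof. by move=> Du Dv; apply: is_deriveD. Qed.

Lemma is_deriveB' (u v : R -> R) (x du dv : R) : is_derive x 1 u du ->
  is_derive x 1 v dv -> is_derive x 1 (fun s => u s - v s) (du - dv).
Proof. by move=> Du Dv; apply: is_deriveB. Qed.

Lemma is_deriveN' (u : R -> R) (x du : R) : is_derive x 1 u du ->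
  is_derive x 1 (fun s => - u s) (- du).
Proof. by move=> Du; apply: is_deriveN. Qed.

Lemma is_derive_comp' (u v : R -> R) (x du dv : R) : is_derive x 1 v dv ->
  is_derive (v x) 1 u du -> is_derive x 1 (fun s => u (v s)) (du * dv).
Proof. by move=> Dv Du; apply: is_derive1_comp. Qed.

Lemma cvg_pairR (T : Type) (F : set_system T) {FF : Filter F} (u v : T -> R)
    (a b : R) : u t @[t --> F] --> a -> v t @[t --> F] --> b ->
  (u t, v t) @[t --> F] --> (a, b).
Proof. by move=> ua vb; exact: cvg_pair ua vb. Qed.

Lemma cts2D f g p : cts2 f p -> cts2 g p -> cts2 (fun x y => f x y + g x y) p.
Proof. by move=> cf cg; apply: continuousD. Qed.

Lemma cts2N f p : cts2 f p -> cts2 (fun x y => - f x y) p.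
Proof. by move=> cf; apply: continuousN. Qed.

Lemma cts2B f g p : cts2 f p -> cts2 g p -> cts2 (fun x y => f x y - g x y) p.
Proof. by move=> cf cg; apply: continuousB. Qed.

Lemma cts2M f g p : cts2 f p -> cts2 g p -> cts2 (fun x y => f x y * g x y) p.
Proof. by move=> cf cg; apply: continuousM. Qed.

Lemma cts2_cst (c : R) p : cts2 (fun _ _ => c) p.
Proof. exact: cvg_cst. Qed.

Lemma cts2_comp (u : R -> R) f p : {for f p.1 p.2, continuous u} -> cts2 f p ->
  cts2 (fun x y => u (f x y)) p.
Proof. by move=> cu cf; exact: (cvg_comp _ _ cf cu). Qed.

Lemma cts2_fst (u : R -> R) p : {for p.1, continuous u} ->
  cts2 (fun x _ => u x) p.
Proof. case: p => x y /= cu.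
have c1 : (fst : R * R -> R) @ (x, y) --> x by exact: cvg_fst.
exact: (cvg_comp _ _ c1 cu). Qed.

Lemma cts2_near f g (p : R * R) : (\forall q \near p, f q.1 q.2 = g q.1 q.2) ->
  cts2 f p -> cts2 g p.
Proof.
move=> fg cf; rewrite /cts2 /prop_for /continuous_at -(nbhs_singleton fg).
apply: cvg_trans cf.
exact: near_eq_cvg fg.
Qed.

Lemma cts2_slice f (a b : R) : cts2 f (a, b) -> {for b, continuous (f a)}.
Proof.
move=> cf; 
exact: (cvg_comp _ _ (cvg_pairR (cvg_cst a) cvg_id) cf).
Qed.

Lemma cts2_curve f (c : R -> R) (a : R) : cts2 f (a, c a) ->
  {for a, continuous c} -> {for a, continuous (fun x => f x (c x))}.
Proof.
move=> cf cc; 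
exact: (cvg_comp _ _ (cvg_pairR cvg_id cc) cf).
Qed.

(** [rdx f] is a limit of quotients, so its continuity can be read off from the formula [fx] only
    where the two agree on a whole neighbourhood; this is why the hypothesis is iterated through
    [nbhs_near]. *)
Lemma C1_atI f (fx fy : R -> R -> R) (p : R * R) :
  nbhs p (fun q : R * R =>
    [/\ is_derive q.1 1 (fun s => f s q.2) (fx q.1 q.2),
        is_derive q.2 1 (fun s => f q.1 s) (fy q.1 q.2),
        cts2 fx q & cts2 fy q]) ->
  C1_at f p.
Proof.
move=> H; have H2 := nbhs_near H.
have := nbhsI H H2; apply: nbhsS => q [[dx dy cx cy] Hq].
split; [by case: dx|by case: dy|..].
- apply: cts2_near cx; move: Hq; apply: nbhsS => r [d _ _ _].
  by apply/esym; exact: is_derive_derive1E.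
- apply: cts2_near cy; move: Hq; apply: nbhsS => r [_ d _ _].
  by apply/esym; exact: is_derive_derive1E.
Qed.

Lemma C1_at_eq f g (p : R * R) : (\forall q \near p, f q.1 q.2 = g q.1 q.2) ->
  C1_at f p -> C1_at g p.
Proof.
move=> fg fC; apply: (@C1_atI g (rdx f) (rdy f)).
have fg2 := nbhs_near fg.
have := nbhsI fC (nbhsI fg2 (C1_at_near fC)).
apply: nbhsS => -[x y] [[dx dy cx cy] [E Cq]]; split; [ | |exact: cx|exact: cy].
- have n1 : \forall s \near x, f s y = g s y.
    have c1 : (fun s : R => (s, y)) @ x --> (x, y).
      exact: (cvg_pairR cvg_id (cvg_cst y)).
    exact: (c1 _ E).
  exact: (near_eq_is_derive n1 (C1_at_dx Cq)).
- have n1 : \forall s \near y, f x s = g x s.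
    have c1 : (fun s : R => (x, s)) @ y --> (x, y).
      exact: (cvg_pairR (cvg_cst x) cvg_id).
    exact: (c1 _ E).
  exact: (near_eq_is_derive n1 (C1_at_dy Cq)).
Qed.

Lemma C1_atM f g p : C1_at f p -> C1_at g p ->
  C1_at (fun x y => f x y * g x y) p.
Proof.
move=> /C1_at_near fC /C1_at_near gC.
apply: (@C1_atI _ (fun x y => rdx f x y * g x y + f x y * rdx g x y)
                  (fun x y => rdy f x y * g x y + f x y * rdy g x y)).
have := nbhsI fC gC; apply: nbhsS => -[x y] [{}fC {}gC].
have cf := C1_at_cts fC; have cg := C1_at_cts gC.
have [_ _ fx fy] := C1_atP fC; have [_ _ gx gy] := C1_atP gC.
split.
- exact: is_deriveM' (C1_at_dx fC) (C1_at_dx gC).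
- exact: is_deriveM' (C1_at_dy fC) (C1_at_dy gC).
- exact: cts2D (cts2M fx cg) (cts2M cf gx).
- exact: cts2D (cts2M fy cg) (cts2M cf gy).
Qed.

Lemma C1_atD f g p : C1_at f p -> C1_at g p ->
  C1_at (fun x y => f x y + g x y) p.
Proof.
move=> /C1_at_near fC /C1_at_near gC.
apply: (@C1_atI _ (fun x y => rdx f x y + rdx g x y)
                  (fun x y => rdy f x y + rdy g x y)).
have := nbhsI fC gC; apply: nbhsS => -[x y] [{}fC {}gC].
have [_ _ fx fy] := C1_atP fC; have [_ _ gx gy] := C1_atP gC.
split.
- exact: is_deriveD' (C1_at_dx fC) (C1_at_dx gC).
- exact: is_deriveD' (C1_at_dy fC) (C1_at_dy gC).
- exact: cts2D fx gx.
- exact: cts2D fy gy.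
Qed.

Lemma C1_at_cst (c : R) p : C1_at (fun _ _ => c) p.
Proof.
apply: (@C1_atI _ (fun _ _ => 0) (fun _ _ => 0)); apply: nbhs_forall => q.
by split; [exact: is_derive_cst|exact: is_derive_cst|exact: cts2_cst|exact: cts2_cst].
Qed.

Lemma C1_atN f p : C1_at f p -> C1_at (fun x y => - f x y) p.
Proof.
move=> fC; have := C1_atM (C1_at_cst (-1) p) fC.
by apply: C1_at_eq; apply: nbhs_forall => q; rewrite mulN1r.
Qed.

Lemma C1_atB f g p : C1_at f p -> C1_at g p ->
  C1_at (fun x y => f x y - g x y) p.
Proof. by move=> fC gC; exact: C1_atD fC (C1_atN gC). Qed.

Lemma nbhs_box (a b : R) (P : set (R * R)) : nbhs (a, b) P ->
  exists2 d : R, 0 < d & forall x y, `|x - a| < d -> `|y - b| < d -> P (x, y).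
Proof.
move=> /nbhs_ballP[d /= d0 dP]; exists d => // x y xa yb.
by apply: dP; split; rewrite /= /ball /= distrC.
Qed.

(** The mean value theorem is used twice: in [x] for the difference of the values on the two
    horizontal edges, then in [y] for its derivative. *)
Lemma rectangle_increment f (a b h : R) : 0 < h ->
  (forall x y, x \in `[a, a + h] -> y \in `[b, b + h] ->
     derivable (fun s => f s y) x 1 /\ derivable (rdx f x) y 1) ->
  exists x y, [/\ x \in `[a, a + h], y \in `[b, b + h] &
    f (a + h) (b + h) - f (a + h) b - f a (b + h) + f a b
     = h * (h * rdy (rdx f) x y)].
Proof.
move=> h0 H.
have ia : b \in `[b, b + h] by rewrite in_itv/=; apply/andP; split; lra.
have ib : b + h \in `[b, b + h] by rewrite in_itv/=; apply/andP; split; lra.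
have lt1 : a < a + h by lra.
have lt2 : b < b + h by lra.
have d1 x : x \in `[a, a + h] ->
   is_derive x 1 (fun s => f s (b + h) - f s b) (rdx f x (b + h) - rdx f x b).
  move=> xi; apply: is_deriveB'; apply: is_derive_derive1.
    exact: (H _ _ xi ib).1.
  exact: (H _ _ xi ia).1.
have [x xi' E1] := MVT_closed lt1 d1.
have d2 y : y \in `[b, b + h] -> is_derive y 1 (rdx f x) (rdy (rdx f) x y).
  by move=> yi; apply: is_derive_derive1; exact: (H _ _ xi' yi).2.
have [y yi E2] := MVT_closed lt2 d2.
exists x, y; split=> //.
move: E1; rewrite E2 => E1.
rewrite (_ : _ - _ - _ + _ = f (a + h) (b + h) - f (a + h) b - (f a (b + h) - f a b)); last by ring.
by rewrite E1; ring.
Qed.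

Lemma dist_split (A B C e : R) : `|B - C| < e / 2 -> `|A - C| < e / 2 ->
  `|A - B| <= e.
Proof.
rewrite !ltr_norml ler_norml => /andP[? ?] /andP[? ?].
by apply/andP; split; lra.
Qed.

(** The second increment over a square is symmetric in the two variables. Read in both orders,
    [rectangle_increment] equates a value of one mixed derivative with a value of the other, at two
    points that may differ but both lie in a square as small as desired. *)
Lemma mixed_partials f p : C1_at f p -> C1_at (rdx f) p -> C1_at (rdy f) p ->
  rdx (rdy f) p.1 p.2 = rdy (rdx f) p.1 p.2.
Proof.
case: p => a b fC fxC fyC /=.
have [_ _ _ /cvgrPdist_lt cxy] := C1_atP fxC.
have [_ _ /cvgrPdist_lt cyx _] := C1_atP fyC.
apply/eqP; rewrite -subr_eq0 -normr_eq0; apply/eqP.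
apply/le_anti; rewrite normr_ge0 andbT; apply/ler_addgt0Pl => e e0; rewrite addr0.
have e2 : 0 < e / 2 by rewrite divr_gt0.
have /nbhs_box[d d0 H] := nbhsI fyC (nbhsI fxC (nbhsI fC (nbhsI (cxy _ e2) (cyx _ e2)))).
pose h := d / 2.
have h0 : 0 < h by rewrite divr_gt0.
have hd : h < d by rewrite /h; lra.
have box x y : x \in `[a, a + h] -> y \in `[b, b + h] -> `|x - a| < d /\ `|y - b| < d.
  rewrite !in_itv/= => /andP[x1 x2] /andP[y1 y2].
  by split; rewrite ltr_norml; apply/andP; split; lra.
have [|x [y [xi yi E1]]] := @rectangle_increment f a b h h0.
  move=> x y xi yi; have [xd yd] := box _ _ xi yi.
  have [_ [[_ d2 _ _] [[d1 _ _ _] _]]] := H x y xd yd.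
  by split; [exact: d1|exact: d2].
have [|y' [x' [yi' xi' E2]]] := @rectangle_increment (fun s r => f r s) b a h h0.
  move=> y' x' yi' xi'; have [xd yd] := box _ _ xi' yi'.
  have [[d2 _ _ _] [_ [[_ d1 _ _] _]]] := H x' y' xd yd.
  by split; [exact: d1|exact: d2].
have EE : rdy (rdx f) x y = rdx (rdy f) x' y'.
  have h1 : h != 0 by rewrite gt_eqF.
    have E3 : f (a + h) (b + h) - f a (b + h) - f (a + h) b + f a b =
    h * (h * rdx (rdy f) x' y') := E2.
  have E4 : h * (h * rdy (rdx f) x y) = h * (h * rdx (rdy f) x' y').
    apply: etrans (esym E1) (etrans _ E3).
    by ring.
  exact: (mulfI h1 (mulfI h1 E4)).
have [xd yd] := box _ _ xi yi; have [xd' yd'] := box _ _ xi' yi'.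
have [_ [_ [_ [/= n1 _]]]] := H x y xd yd.
have [_ [_ [_ [_ /= n2]]]] := H x' y' xd' yd'.
rewrite EE in n1.
exact: dist_split n1 n2.
Qed.

(** [C1_txy] unfolds to this predicate at every point of [K], so its hypotheses can be used here by
    conversion. *)
Definition C1t_at (f : R -> R -> R -> R) (p : R * (R * R)) : Prop :=
  nbhs p (fun q : R * (R * R) =>
    [/\ derivable (fun s => f s q.2.1 q.2.2) q.1 1,
        derivable (fun s => f q.1 s q.2.2) q.2.1 1 &
        derivable (fun s => f q.1 q.2.1 s) q.2.2 1] /\
    [/\ {for q, continuous (fun z : R * (R * R) =>
          derive1 (fun s => f s z.2.1 z.2.2) z.1)},
        {for q, continuous (fun z : R * (R * R) => rdx (f z.1) z.2.1 z.2.2)} &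
        {for q, continuous (fun z : R * (R * R) => rdy (f z.1) z.2.1 z.2.2)}]).

Definition cts3 (f : R -> R -> R -> R) (p : R * (R * R)) : Prop :=
  {for p, continuous (fun z : R * (R * R) => f z.1 z.2.1 z.2.2)}.

Lemma slice_cvg (t : R) (p : R * R) :
  {for p, continuous (fun q : R * R => (t, q))}.
Proof. exact: cvg_pair (cvg_cst t) cvg_id. Qed.

Lemma cts3_slice (f : R -> R -> R -> R) (t : R) (p : R * R) :
  cts3 f (t, p) -> cts2 (f t) p.
Proof. by move=> cf; exact: (cvg_comp _ _ (@slice_cvg t p) cf). Qed.

Lemma C1t_at_slice (f : R -> R -> R -> R) (t : R) (p : R * R) :
  C1t_at f (t, p) -> C1_at (f t) p.
Proof.
move=> fC; have := nbhs_cts (@slice_cvg t p) fC.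
apply: nbhsS => q [[_ dx dy] [_ cx cy]]; split.
- exact: dx.
- exact: dy.
- exact: (@cts3_slice (fun t => rdx (f t)) t q cx).
- exact: (@cts3_slice (fun t => rdy (f t)) t q cy).
Qed.

Lemma C1t_at_dt (f : R -> R -> R -> R) (t x y : R) :
  C1t_at f (t, (x, y)) ->
  is_derive t 1 (fun s => f s x y) (derive1 (fun s => f s x y) t) /\
  cts3 (fun t x y => derive1 (fun s => f s x y) t) (t, (x, y)).
Proof.
by move=> /nbhs_singleton [[dt _ _] [ct _ _]]; split; [exact: is_derive_derive1 dt|exact: ct].
Qed.

(** The slope argument again, with time as the variable of the increment and the space point as
    parameter; on the slice [t = t0] continuity comes from [C1_at_cts]. The pairs are swapped
    because [slope_cvg] expects the differentiated variable in second place. *)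
Lemma C1t_at_cts (f : R -> R -> R -> R) (p : R * (R * R)) :
  C1t_at f p -> cts3 f p.
Proof.
case: p => t0 p0 fC.
pose sw (q : (R * R) * R) : R * (R * R) := (q.2, q.1).
have csw q : {for q, continuous sw}.
  by case: q => q s; exact: cvg_pair cvg_snd cvg_fst.
have csw' (q : R * (R * R)) : {for q, continuous (fun q : R * (R * R) => (q.2, q.1))}.
  by case: q => s q; exact: cvg_pair cvg_snd cvg_fst.
pose F (q : R * R) (s : R) := f s q.1 q.2.
have dF : nbhs (p0, t0) (fun q : (R * R) * R => derivable (F q.1) q.2 1).
  have := nbhs_cts (csw (p0, t0)) fC.
  by apply: nbhsS => q [[dt _ _] _]; exact: dt.
have cF : {for (p0, t0), continuous (fun q : (R * R) * R => derive1 (F q.1) q.2)}.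
  have [_ [ct _ _]] := nbhs_singleton fC.
  exact: (cvg_comp _ _ (csw (p0, t0)) ct).
have [Phi P1 P2] := slope_cvg dF cF.
have C2 := C1_at_cts (C1t_at_slice fC).
rewrite /cts3 (_ : (fun z : R * (R * R) => f z.1 z.2.1 z.2.2) =
   (fun q => f t0 q.2.1 q.2.2 + Phi (q.2, q.1) * (q.1 - t0))); last first.
  apply/funext => q; have := P2 (q.2, q.1); rewrite /F /= => <-; ring.
rewrite /prop_for /continuous_at /= subrr mulr0 addr0.
rewrite -[X in _ --> X]addr0 -[X in _ --> _ + X](mulr0 (derive1 (F p0) t0)).
apply: cvgD.
  have c2 : {for (t0, p0), continuous (snd : R * (R * R) -> R * R)} by exact: cvg_snd.
  exact: (cvg_comp _ _ c2 C2).
apply: cvgM.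
  exact: (cvg_comp _ _ (csw' (t0, p0)) P1).
rewrite -[X in _ --> X](subrr t0).
by apply: cvgB; [exact: cvg_fst|exact: cvg_cst].
Qed.

End Calculus.
Arguments cts2_cst {R} c p _ _.

(** * Integration over the cell *)

Section Integration.
Context {R : realType}.
Notation mR := (measurableTypeR R).
Notation mu := (@lebesgue_measure R).

Lemma measurable_ballR (a r : R) : measurable (ball a r : set mR).
Proof. by rewrite ball_itv; exact: measurable_itv. Qed.

(** Measurability refers to the product sigma-algebra, so [U] is written as the union of the
    countably many rational boxes that it contains. *)
Lemma open_measurable_prod (U : set (R * R)) :
  open U -> measurable (U : set (mR * mR)).
Proof.
move=> oU.
pose B (q : rat * rat * rat) : set (mR * mR) :=
  ball (ratr q.1.1 : R) (ratr q.2) `*` ball (ratr q.1.2 : R) (ratr q.2).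
pose C q : set (mR * mR) := if `[< B q `<=` U >] then B q else set0.
have -> : U = \bigcup_q C q.
  apply/seteqP; split => [[x y] Uxy|p [q _]]; last first.
    by rewrite /C; case: asboolP => // BU Bp; exact: BU.
  have /nbhs_box[d d0 dU] : nbhs (x, y) U by exact: open_nbhs_nbhs.
  (* A box of radius [r] whose centre is within [r] of [(x, y)] stays within [2 r < d] of that
     point. *)
  have [r] := rat_in_itvoo (divr_gt0 d0 (ltr0Sn R 1) : 0 < d / 2).
  rewrite in_itv/= => /andP[r0 rd].
  have near_rat (z : R) : exists s : rat, `|ratr s - z| < ratr r.
    have zr : z - ratr r < z + ratr r by lra.
    have [s] := rat_in_itvoo zr.
    rewrite in_itv/= => /andP[s1 s2]; exists s.
    by rewrite ltr_norml; apply/andP; split; lra.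
  have [s sx] := near_rat x; have [t ty] := near_rat y.
  exists (s, t, r) => //; rewrite /C.
  case: asboolP => [_|]; first by split; rewrite /ball/=.
  case=> -[x' y'] [/=]; rewrite /ball/= => x'r y'r; apply: dU.
    move: x'r sx; rewrite !ltr_norml => /andP[? ?] /andP[? ?].
    by apply/andP; split; lra.
  move: y'r ty; rewrite !ltr_norml => /andP[? ?] /andP[? ?].
  by apply/andP; split; lra.
apply: countable_bigcupT_measurable => [|q]; first exact: countableP.
rewrite /C; case: asboolP => // _.
by apply: measurableX; exact: measurable_ballR.
Qed.

Lemma cts2_measurable (D : set (R * R)) (f : R -> R -> R) : open D ->
  (forall p, D p -> cts2 f p) ->
  measurable_fun (D : set (mR * mR)) (fun p => f p.1 p.2).
Proof.
move=> oD cf; apply: (measurability _ (RGenOpens.measurableE R)).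
move=> _ [_ [a [b ->] <-]]; apply: open_measurable_prod.
rewrite openE => p [Dp fp]; apply: filterI; first exact: open_nbhs_nbhs.
have : nbhs (f p.1 p.2) `]a, b[%classic.
  by apply: open_nbhs_nbhs; split => //; exact: interval_open.
exact: (cf p Dp).
Qed.

(** [F t0] is bounded by [N] on [K]; by continuity [N + 1] still works near each [(t0, p)], and
    compactness of [K] leaves a common time neighbourhood. The constant later dominates time
    derivatives under the integral. *)
Lemma compact_tube_bound (U : topologicalType) (K : set U) (F : R -> U -> R)
    (t0 : R) : compact K ->
  (forall p, K p -> {for (t0, p), continuous (fun q : R * U => F q.1 q.2)}) ->
  exists2 M : R, 0 < M & \forall t \near t0, forall p, K p -> `|F t p| <= M.
Proof.
move=> cK cF.
have cF0 : {within K, continuous (F t0)}.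
  apply: continuous_in_subspaceT => p; rewrite inE => Kp.
  have c1 : {for p, continuous (fun q : U => (t0, q))}.
    by exact: cvg_pair (cvg_cst t0) cvg_id.
  exact: (cvg_comp _ _ c1 (cF p Kp)).
have [M [_ HM]] := compact_bounded (continuous_compact cF0 cK).
pose N := `|M| + 1.
have N0 : 0 < N by rewrite ltr_wpDl.
have bN p : K p -> `|F t0 p| <= N.
  move=> Kp; have MN : M < N by rewrite (le_lt_trans (ler_norm M))// ltrDl.
  exact: (HM N MN (F t0 p) (ex_intro2 _ _ p Kp erefl)).
exists (N + 1); first by rewrite addr_gt0.
have /compact_near_coveringP cov := cK.
apply: (cov R (nbhs t0) (fun t p => `|F t p| <= N + 1)) => p Kp.
have /cvgrPdist_lt/(_ 1 ltr01) := cF p Kp.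
case=> -[A B] /= [nA nB] sub.
exists (B, A) => //= -[q t] [/= Bq At].
have /= := sub (t, q) (conj At Bq).
have := bN p Kp.
rewrite !ler_norml ltr_norml => /andP[? ?] /andP[? ?].
by apply/andP; split; lra.
Qed.

Lemma compact_bound (U : topologicalType) (K : set U) (f : U -> R) :
  compact K -> (forall p, K p -> {for p, continuous f}) ->
  exists2 M : R, 0 < M & forall p, K p -> `|f p| <= M.
Proof.
move=> cK cf.
have [|M M0 /nbhs_singleton HM] := @compact_tube_bound U K (fun _ => f) 0 cK.
  move=> p Kp.
  have c1 : {for (0 : R, p), continuous (snd : R * U -> U)} by exact: cvg_snd.
  exact: (cvg_comp _ _ c1 (cf p Kp)).
by exists M.
Qed.

Lemma Rintegral_derivable d (T : measurableType d)
    (m : {measure set T -> \bar R}) (B : set T) (f ft : R -> T -> R)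
    (G : T -> R) (a : R) : measurable B ->
  nbhs a (fun t : R => m.-integrable B (EFin \o f t)) ->
  nbhs a (fun t : R => forall p, B p ->
     is_derive t 1 (fun s => f s p) (ft t p) /\ `|ft t p| <= G p) ->
  m.-integrable B (EFin \o G) -> (forall p, 0 <= G p) ->
  is_derive a 1 (fun t => \int[m]_(p in B) f t p) (\int[m]_(p in B) ft a p).
Proof.
move=> mB intf df intG G0.
have /nbhs_ballP[e /= e0 He] := nbhsI intf df.
have Ia : `](a - e), (a + e)[%classic a.
  by rewrite /= in_itv/=; apply/andP; split; lra.
have inball t : `](a - e), (a + e)[%classic t -> ball a e t.
  rewrite /= in_itv/= /ball/= => /andP[? ?].
  by rewrite ltr_norml; apply/andP; split; lra.
have h1 t : `](a - e), (a + e)[%classic t -> m.-integrable B (EFin \o f t).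
  by move=> /inball /He[].
have h2 t p : `](a - e), (a + e)[%classic t -> B p -> derivable (f ^~ p) t 1.
  by move=> /inball /He[_ /(_ p) H] /H[[]].
have E t p : `](a - e), (a + e)[%classic t -> B p -> partial1of2 f t p = ft t p.
  move=> /inball /He[_ /(_ p) H] /H[D _].
  exact: (is_derive_derive1E D).
have h3 t p : `](a - e), (a + e)[%classic t -> B p -> `|partial1of2 f t p| <= G p.
  by move=> It Bp; rewrite E//; case: (He t (inball t It)) => _ /(_ p Bp)[].
have -> : \int[m]_(p in B) ft a p = \int[m]_(p in B) (partial1of2 f ^~ p) a.
  by apply: eq_Rintegral => p; rewrite inE => Bp; rewrite E.
apply: DeriveDef.
  exact: (@derivable_under_integral _ _ _ _ f B mB a _ _ Ia h1 h2 G G0 intG h3).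
rewrite -derive1E.
exact: (@differentiation_under_integral _ _ _ _ f B mB a _ _ Ia h1 h2 G G0 intG h3).
Qed.

Lemma area_int_iterated (D : set (R * R)) (A : set R) (S : R -> set R)
    (f : R -> R -> R) :
  measurable (D : set (mR * mR)) -> measurable (A : set mR) ->
  (forall x, measurable (S x : set mR)) ->
  (forall x y, D (x, y) <-> A x /\ S x y) ->
  leb2.-integrable D (fun p : R * R => (f p.1 p.2)%:E) ->
  (forall x, A x -> mu.-integrable (S x) (EFin \o f x)) ->
  area_int D f = \int[mu]_(x in A) \int[mu]_(y in S x) f x y.
Proof.
move=> mD mA mS DE iD iS.
rewrite /area_int /Rintegral integral_mkcond /leb2; congr fine.
rewrite -integral12_prod_meas1; last exact/(integrable_mkcond _ mD).
rewrite [RHS]integral_mkcond; apply: eq_integral => x _.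
rewrite /fubini_F [RHS]patchE; case: ifPn => [|] xA.
  rewrite inE in xA.
  rewrite fineK; last by apply: integrable_fin_num => //; exact: iS.
  rewrite [RHS]integral_mkcond; apply: eq_integral => y _.
  rewrite !patchE /=.
  have -> // : ((x, y) \in D) = (y \in S x).
  by apply/idP/idP; rewrite !inE DE => // -[].
rewrite integral0_eq// => y _; rewrite patchE; case: ifPn => //.
by rewrite inE DE => -[/mem_set Ax]; rewrite Ax in xA.
Qed.

Lemma area_int_iterated_swap (D : set (R * R)) (A : set R) (S : R -> set R)
    (f : R -> R -> R) :
  measurable (D : set (mR * mR)) -> measurable (A : set mR) ->
  (forall x, measurable (S x : set mR)) ->
  (forall x y, D (x, y) <-> A y /\ S y x) ->
  leb2.-integrable D (fun p : R * R => (f p.1 p.2)%:E) ->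
  (forall y, A y -> mu.-integrable (S y) (EFin \o f ^~ y)) ->
  area_int D f = \int[mu]_(y in A) \int[mu]_(x in S y) f x y.
Proof.
move=> mD mA mS DE iD iS.
rewrite /area_int /Rintegral integral_mkcond /leb2; congr fine.
rewrite -integral21_prod_meas1; last exact/(integrable_mkcond _ mD).
rewrite [RHS]integral_mkcond; apply: eq_integral => x _.
rewrite /fubini_G [RHS]patchE; case: ifPn => [|] xA.
  rewrite inE in xA.
  rewrite fineK; last by apply: integrable_fin_num => //; exact: iS.
  rewrite [RHS]integral_mkcond; apply: eq_integral => y _.
  rewrite !patchE /=.
  have -> // : ((y, x) \in D) = (y \in S x).
  by apply/idP/idP; rewrite !inE DE => // -[].
rewrite integral0_eq// => y _; rewrite patchE; case: ifPn => //.
by rewrite inE DE => -[/mem_set Ax]; rewrite Ax in xA.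
Qed.

Definition line_int (a b : R) (u : R -> R) : R := \int[mu]_(x in `]a, b[) u x.

(** Continuity at the end points is two-sided. The integrands come from functions that are regular
    on a neighbourhood of the closed region, so one-sided limits can be avoided. *)
Definition ctsI (a b : R) (u : R -> R) : Prop :=
  forall x, a <= x <= b -> {for x, continuous u}.

Lemma ctsI_within a b u : ctsI a b u -> {within `[a, b], continuous u}.
Proof.
move=> cu; apply: continuous_in_subspaceT => x; rewrite inE/= in_itv/=.
exact: cu.
Qed.

Lemma ctsI_integrable_closed a b u : ctsI a b u ->
  mu.-integrable `[a, b] (EFin \o u).
Proof.
move=> cu; apply: continuous_compact_integrable; first exact: segment_compact.
exact: ctsI_within.
Qed.

Lemma ctsI_integrable a b u : ctsI a b u -> mu.-integrable `]a, b[ (EFin \o u).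
Proof.
move=> cu; apply: integrableS (ctsI_integrable_closed cu) => //.
exact: subset_itv_oo_cc.
Qed.

Lemma line_int_closed a b u : ctsI a b u ->
  line_int a b u = \int[mu]_(x in `[a, b]) u x.
Proof.
move=> cu; have iu := ctsI_integrable_closed cu.
rewrite /line_int Rintegral_itv_obnd_cbnd ?Rintegral_itv_bndo_bndc//.
  by apply: integrableS iu => //; exact: subset_itv_co_cc.
exact: ctsI_integrable.
Qed.

Lemma line_int_FTC (a b : R) (u du : R -> R) : a < b ->
  (forall x, a <= x <= b -> is_derive x 1 u (du x)) -> ctsI a b du ->
  line_int a b du = u b - u a.
Proof.
move=> ab Du cdu; rewrite line_int_closed// /Rintegral.
have cu x : a <= x <= b -> {for x, continuous u}.
  by move=> /Du; exact: is_derive_continuous.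
rewrite (@continuous_FTC2 R du u a b ab).
- by [].
- exact: ctsI_within.
- split.
  + move=> x; rewrite in_itv/= => /andP[ax xb].
    by have [] : is_derive x 1 u (du x) by apply: Du; rewrite !ltW.
  + by apply: cvg_at_right_filter; apply: cu; rewrite lexx ltW.
  + by apply: cvg_at_left_filter; apply: cu; rewrite lexx ltW.
- move=> x; rewrite in_itv/= => /andP[ax xb].
  by apply: is_derive_derive1E; apply: Du; rewrite !ltW.
Qed.

Lemma line_intD a b u v : ctsI a b u -> ctsI a b v ->
  line_int a b (fun x => u x + v x) = line_int a b u + line_int a b v.
Proof.
by move=> cu cv; rewrite /line_int RintegralD//; exact: ctsI_integrable.
Qed.

Lemma line_intB a b u v : ctsI a b u -> ctsI a b v ->
  line_int a b (fun x => u x - v x) = line_int a b u - line_int a b v.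
Proof.
by move=> cu cv; rewrite /line_int RintegralB//; exact: ctsI_integrable.
Qed.

Lemma line_intZ a b c u : ctsI a b u ->
  line_int a b (fun x => c * u x) = c * line_int a b u.
Proof.
by move=> cu; rewrite /line_int RintegralZl//; exact: ctsI_integrable.
Qed.

Lemma eq_line_int a b u v : (forall x, a < x < b -> u x = v x) ->
  line_int a b u = line_int a b v.
Proof.
move=> uv; apply: eq_Rintegral => x; rewrite inE/= in_itv/=; exact: uv.
Qed.

Lemma line_int_scale (c : R) (u : R -> R) : 0 < c -> ctsI 0 c u ->
  line_int 0 c u = line_int 0 1 (fun z => c * u (c * z)).
Proof.
move=> c0 cu; rewrite !line_int_closed//; last first.
  move=> z /andP[z0 z1]; apply: continuousM; first exact: cvg_cst.
  have cz : {for z, continuous (fun z : R => c * z)}.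
    by apply: continuousM; [exact: cvg_cst|exact: cvg_id].
  apply: (cvg_comp _ _ cz (cu _ _)).
  by rewrite mulr_ge0 ?(ltW c0)//= ger_pMr.
have D (z : R) : is_derive z 1 (fun z : R => c * z) c.
  have := is_deriveM' (is_derive_cst c z 1) (is_derive_id z 1).
  by rewrite mul0r add0r mulr1.
have E : derive1 (fun z : R => c * z) = cst c.
  by apply/funext => z; apply: is_derive_derive1E; exact: D.
have cz (z : R) : {for z, continuous (fun z : R => c * z)}.
  exact: is_derive_continuous (D z).
rewrite /Rintegral; congr fine.
have -> : (\int[mu]_(x in `[0%R, c]) (u x)%:E =
    \int[mu]_(x in `[(c * 0)%R, (c * 1)%R]) (u x)%:E)%E.
  by rewrite mulr0 mulr1.
rewrite (@integration_by_substitution_increasing R (fun z => c * z) u 0 1)//.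
- by apply: eq_integral => z _ /=; rewrite E /= mulrC.
- by move=> x y _ _ xy; rewrite ltr_pM2l.
- by rewrite E => z _; exact: cvg_cst.
- by rewrite E; apply: is_cvg_cst.
- by rewrite E; apply: is_cvg_cst.
- split.
  + by move=> z _; case: (D z).
  + by apply: cvg_at_right_filter; exact: cz.
  + by apply: cvg_at_left_filter; exact: cz.
- by rewrite mulr0 mulr1; exact: ctsI_within.
Qed.

(** * The cell: topology, bounds, and linearity of the area integral *)

Section Cell.
Variables (L : R) (e : R -> R).
Hypothesis L0 : 0 < L.
Hypothesis ce : forall x, {for x, continuous e}.

Definition closed_cell : set (R * R) :=
  [set p | 0 <= p.1 <= L /\ 0 <= p.2 <= e p.1].

Definition ctsC (f : R -> R -> R) : Prop :=
  forall p, closed_cell p -> cts2 f p.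

Lemma cell_sub : cell L e `<=` closed_cell.
Proof.
move=> [x y] /= [x0 [xL [/= y0 yx]]].
by split => /=; rewrite !ltW.
Qed.

Lemma cellP x y : cell L e (x, y) <->
  `]0, L[%classic x /\ `]0, e x[%classic y.
Proof.
rewrite /= !in_itv /cell /open_fluid /=; split.
  by case=> [x0 [xL [y0 yx]]]; rewrite x0 xL y0 yx.
by case=> /andP[x0 xL] /andP[y0 yx].
Qed.

Lemma open_gt0 (f : R -> R -> R) : (forall p, cts2 f p) ->
  open [set p : R * R | 0 < f p.1 p.2].
Proof.
move=> cf; have := @open_comp _ _ (fun p : R * R => f p.1 p.2) [set x | 0 < x].
by apply; [move=> p _; exact: cf|exact: open_gt].
Qed.

Lemma closed_ge0 (f : R -> R -> R) : (forall p, cts2 f p) ->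
  closed [set p : R * R | 0 <= f p.1 p.2].
Proof.
move=> cf; have := @preimage_closed _ _ (fun p : R * R => f p.1 p.2) [set x | 0 <= x].
by apply; [move=> p _; exact: cf|exact: closed_ge].
Qed.

Lemma fst_cts p : cts2 (fun x _ : R => x) p.
Proof. by case: p => x y; exact: cvg_fst. Qed.

Lemma snd_cts p : cts2 (fun _ y : R => y) p.
Proof. by case: p => x y; exact: cvg_snd. Qed.

Arguments fst_cts p _ _ : clear implicits.
Arguments snd_cts p _ _ : clear implicits.

Lemma cstB_cts (p : R * R) : cts2 (fun x _ : R => L - x) p.
Proof. exact: cts2B (cts2_cst L p) (fst_cts p).
Qed.

Lemma etaB_cts (p : R * R) : cts2 (fun x y : R => e x - y) p.
Proof. exact: cts2B (cts2_fst (@ce p.1)) (snd_cts p). Qed.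

Lemma cell_open : open (cell L e).
Proof.
have -> : cell L e = [set p | 0 < p.1] `&` ([set p | 0 < L - p.1] `&`
   ([set p | 0 < p.2] `&` [set p | 0 < e p.1 - p.2])).
  by apply/seteqP; split => -[x y]; rewrite /cell /open_fluid /= !subr_gt0.
apply: openI; first exact: (open_gt0 fst_cts).
apply: openI; first exact: (open_gt0 cstB_cts).
apply: openI; first exact: (open_gt0 snd_cts).
exact: (open_gt0 etaB_cts).
Qed.

Lemma measurable_cell : measurable (cell L e : set (mR * mR)).
Proof. exact: open_measurable_prod cell_open. Qed.

Lemma eta_bound : exists2 M, 0 < M & forall x, 0 <= x <= L -> e x <= M.
Proof.
have [|M M0 HM] := @compact_bound R `[0, L] e (@segment_compact R 0 L).
  by move=> x _; exact: ce.
exists M => // x xi; apply: le_trans (HM x _); first exact: ler_norm.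
by rewrite /= in_itv.
Qed.

Lemma closed_cell_compact : compact closed_cell.
Proof.
have [M M0 HM] := eta_bound.
have cc : compact (`[0, L]%classic `*` `[0, M]%classic : set (R * R)).
  by apply: compact_setX; exact: segment_compact.
apply: subclosed_compact cc _; last first.
  move=> [x y] [/= xi /andP[y0 ye]]; split; rewrite /= in_itv//= y0/=.
  exact: le_trans ye (HM x xi).
have -> : closed_cell = [set p | 0 <= p.1] `&` ([set p | 0 <= L - p.1] `&`
   ([set p | 0 <= p.2] `&` [set p | 0 <= e p.1 - p.2])).
  apply/seteqP; split => -[x y]; rewrite /closed_cell /= !subr_ge0.
    by move=> [/andP[-> ->] /andP[-> ->]].
  by move=> [-> [-> [-> ->]]].
apply: closedI; first exact: (closed_ge0 fst_cts).
apply: closedI; first exact: (closed_ge0 cstB_cts).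
apply: closedI; first exact: (closed_ge0 snd_cts).
exact: (closed_ge0 etaB_cts).
Qed.

Lemma ctsC_bound f : ctsC f ->
  exists2 M, 0 < M & forall x y, closed_cell (x, y) -> `|f x y| <= M.
Proof.
move=> cf; have [M M0 HM] := compact_bound closed_cell_compact cf.
by exists M => // x y; exact: (HM (x, y)).
Qed.

Lemma ctsC_measurable f : ctsC f ->
  measurable_fun (cell L e : set (mR * mR)) (fun p => f p.1 p.2).
Proof.
move=> cf; apply: cts2_measurable cell_open _ => p cp.
by apply: cf; exact: cell_sub.
Qed.

Lemma cell_finite : (leb2 (cell L e) < +oo)%E.
Proof.
have [M M0 HM] := eta_bound.
have sub : cell L e `<=` `[0, L]%classic `*` `[0, M]%classic.
  move=> p /cell_sub; case: p => x y [/= xi /andP[y0 ye]].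
  by split; rewrite /= in_itv//= y0/=; exact: le_trans ye (HM x xi).
apply: (@le_lt_trans _ _ (leb2 (`[0, L]%classic `*` `[0, M]%classic : set (mR * mR)))).
  apply: le_measure => //; rewrite inE; first exact: measurable_cell.
  by apply: measurableX; exact: measurable_itv.
rewrite /leb2 product_measure1E//= !lebesgue_measure_itv/= !lte_fin L0 M0.
by rewrite -!EFinD -EFinM ltry.
Qed.

Lemma ctsC_integrable f : ctsC f ->
  leb2.-integrable (cell L e) (fun p : R * R => (f p.1 p.2)%:E).
Proof.
move=> cf; apply: (@measurable_bounded_integrable _ _ _ leb2 (fun p : mR * mR => f p.1 p.2)).
- exact: measurable_cell.
- exact: cell_finite.
- exact: ctsC_measurable.
- have [M M0 HM] := ctsC_bound cf.
  exists M; split; first exact: num_real.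
  move=> N MN [x y] /cell_sub xy; exact: le_trans (HM x y xy) (ltW MN).
Qed.

Lemma area_intD f g : ctsC f -> ctsC g ->
  area_int (cell L e) (fun x y => f x y + g x y) =
  area_int (cell L e) f + area_int (cell L e) g.
Proof.
move=> cf cg; rewrite /area_int RintegralD//; try exact: ctsC_integrable.
exact: measurable_cell.
Qed.

Lemma area_intB f g : ctsC f -> ctsC g ->
  area_int (cell L e) (fun x y => f x y - g x y) =
  area_int (cell L e) f - area_int (cell L e) g.
Proof.
move=> cf cg; rewrite /area_int RintegralB//; try exact: ctsC_integrable.
exact: measurable_cell.
Qed.

Lemma area_intZ (c : R) f : ctsC f ->
  area_int (cell L e) (fun x y => c * f x y) = c * area_int (cell L e) f.
Proof.
move=> cf; rewrite /area_int RintegralZl//; first exact: measurable_cell.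
exact: ctsC_integrable.
Qed.

Lemma eq_area_int f g : (forall x y, cell L e (x, y) -> f x y = g x y) ->
  area_int (cell L e) f = area_int (cell L e) g.
Proof.
by move=> fg; apply: eq_Rintegral => -[x y]; rewrite inE; exact: fg.
Qed.

Lemma area_int_lines f : ctsC f ->
  area_int (cell L e) f = line_int 0 L (fun x => line_int 0 (e x) (f x)).
Proof.
move=> cf; rewrite /line_int.
apply: (@area_int_iterated (cell L e) `]0, L[ (fun x => `]0, e x[%classic) f).
- exact: measurable_cell.
- exact: measurable_itv.
- by move=> x; exact: measurable_itv.
- exact: cellP.
- exact: ctsC_integrable.
- move=> x /=; rewrite in_itv/= => /andP[x0 xL].
  apply: ctsI_integrable => y yi; apply: (@cts2_slice _ f x y); apply: cf.
  by split => //=; rewrite !ltW.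
Qed.

End Cell.
Arguments fst_cts p _ _ : clear implicits.
Arguments snd_cts p _ _ : clear implicits.

(** * The divergence theorem in the cell *)

Section Green.
Variables (L : R) (e de : R -> R).
Hypothesis L0 : 0 < L.
Hypothesis e0 : forall x, 0 < e x.
Hypothesis De : forall x : R, is_derive x 1 e (de x).
Hypothesis cde : forall x, {for x, continuous de}.

Let ce x : {for x, continuous e}.
Proof. exact: is_derive_continuous (De x). Qed.

Let c1 (x : R) : {for x, continuous (fun _ : R => 1 : R)}.
Proof. exact: cvg_cst. Qed.

Lemma closed_cell_flat x z : closed_cell L (fun _ => 1) (x, z) ->
  closed_cell L e (x, e x * z).
Proof.
move=> [/= xi /andP[z_ge0 z1]]; split => //=.
by rewrite mulr_ge0 ?(ltW (e0 x))//= ger_pMr.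
Qed.

Lemma ctsC_flat f : ctsC L e f -> ctsC L (fun _ => 1) (fun x z => f x (e x * z)).
Proof.
move=> cf [x z] /closed_cell_flat /cf cfxz.
have cez : cts2 (fun x z => e x * z) (x, z).
  exact: cts2M (@cts2_fst _ e (x, z) (@ce x)) (snd_cts (x, z)).
exact: (cvg_comp _ _ (cvg_pairR (fst_cts (x, z)) cez) cfxz).
Qed.

Lemma ctsC_fst (u : R -> R) h : (forall x, {for x, continuous u}) ->
  ctsC L h (fun x _ => u x).
Proof. by move=> cu p _; apply: cts2_fst; exact: cu. Qed.

Lemma ctsCM h f g : ctsC L h f -> ctsC L h g -> ctsC L h (fun x y => f x y * g x y).
Proof. by move=> cf cg p hp; exact: cts2M (cf p hp) (cg p hp). Qed.

Lemma ctsCD h f g : ctsC L h f -> ctsC L h g -> ctsC L h (fun x y => f x y + g x y).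
Proof. by move=> cf cg p hp; exact: cts2D (cf p hp) (cg p hp). Qed.

Lemma ctsCB h f g : ctsC L h f -> ctsC L h g -> ctsC L h (fun x y => f x y - g x y).
Proof. by move=> cf cg p hp; exact: cts2B (cf p hp) (cg p hp). Qed.

(** Each vertical fibre is rescaled to length one, which produces the factor [e x]. On the resulting
    rectangle the order of integration can be exchanged without describing the horizontal sections
    of the cell, which may be disconnected. *)
Lemma area_int_flat f : ctsC L e f ->
  area_int (cell L e) f =
  area_int (cell L (fun _ => 1)) (fun x z => e x * f x (e x * z)).
Proof.
move=> cf; have cF := ctsCM (ctsC_fst ce) (ctsC_flat cf).
rewrite (area_int_lines L0 ce cf) (area_int_lines L0 c1 cF).
apply: eq_line_int => x /andP[x0 xL].
apply: line_int_scale => // y yi; apply: (@cts2_slice _ f x y); apply: cf.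
by split => //=; rewrite !ltW.
Qed.

Lemma area_int_square_lines f : ctsC L (fun _ => 1) f ->
  area_int (cell L (fun _ => 1)) f =
  line_int 0 1 (fun z => line_int 0 L (fun x => f x z)).
Proof.
move=> cf; rewrite /line_int.
apply: (@area_int_iterated_swap _ `]0, 1[ (fun _ => `]0, L[%classic) f).
- exact: measurable_cell.
- exact: measurable_itv.
- by move=> x; exact: measurable_itv.
- by move=> x y; rewrite cellP; split => -[].
- exact: ctsC_integrable.
- move=> z /=; rewrite in_itv/= => /andP[z0 z1].
  apply: ctsI_integrable => x xi.
  have cfx : cts2 f (x, z) by apply: cf; split => //=; rewrite !ltW.
  exact: (cvg_comp _ _ (cvg_pairR cvg_id (cvg_cst z)) cfx).
Qed.

(* The substitution y = e(x) z straightens the free surface. *)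
Lemma cell_divergence F1 F2 :
  (forall p, closed_cell L e p -> C1_at F1 p) ->
  (forall p, closed_cell L e p -> C1_at F2 p) ->
  e L = e 0 -> (forall y, 0 <= y <= e 0 -> F1 L y = F1 0 y) ->
  area_int (cell L e) (fun x y => rdx F1 x y + rdy F2 x y) =
  line_int 0 L (fun x => F2 x (e x) - de x * F1 x (e x) - F2 x 0).
Proof.
move=> C1 C2 eL F1L.
have cF1 : ctsC L e F1 by move=> p /C1; exact: C1_at_cts.
have cF1x : ctsC L e (rdx F1) by move=> p /C1 /C1_atP[].
have cF1y : ctsC L e (rdy F1) by move=> p /C1 /C1_atP[].
have cF2 : ctsC L e F2 by move=> p /C2; exact: C1_at_cts.
have cF2y : ctsC L e (rdy F2) by move=> p /C2 /C1_atP[].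
(* [A] is the [x]-derivative of [e x * F1 x (e x * z)] and [B] the [z]-derivative of [F2 x (e x * z)
   - de x * (z * F1 x (e x * z))]; together they give [e x] times the divergence. Integrated in [x],
   [A] contributes nothing by periodicity; integrated in [z], [B] leaves the surface and bed
   terms. *)
pose A x z := de x * F1 x (e x * z) +
  e x * (rdx F1 x (e x * z) + de x * z * rdy F1 x (e x * z)).
pose B x z := e x * rdy F2 x (e x * z) -
  de x * (F1 x (e x * z) + z * (e x * rdy F1 x (e x * z))).
have cz : ctsC L (fun _ => 1) (fun _ z => z) by move=> p _; exact: snd_cts.
have cA : ctsC L (fun _ => 1) A.
  apply: ctsCD (ctsCM (ctsC_fst cde) (ctsC_flat cF1)) _.
  apply: ctsCM (ctsC_fst ce) (ctsCD (ctsC_flat cF1x) _).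
  exact: ctsCM (ctsCM (ctsC_fst cde) cz) (ctsC_flat cF1y).
have cB : ctsC L (fun _ => 1) B.
  apply: ctsCB (ctsCM (ctsC_fst ce) (ctsC_flat cF2y)) _.
  apply: ctsCM (ctsC_fst cde) (ctsCD (ctsC_flat cF1) _).
  exact: ctsCM cz (ctsCM (ctsC_fst ce) (ctsC_flat cF1y)).
rewrite (area_int_flat (ctsCD cF1x cF2y)).
rewrite (@eq_area_int _ _ _ (fun x z => A x z + B x z)); last first.
  by move=> x z _; rewrite /A /B; ring.
rewrite (area_intD L0 c1 cA cB).
rewrite (area_int_square_lines cA) (area_int_lines L0 c1 cB).
have Dez (x z : R) : is_derive x 1 (fun x => e x * z) (de x * z).
  by have := is_deriveM' (De x) (is_derive_cst z x 1); rewrite mulr0 addr0.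
have Dzz (x z : R) : is_derive z 1 (fun z => e x * z) (e x).
  have := is_deriveM' (is_derive_cst (e x) z 1) (is_derive_id z 1).
  by rewrite mul0r add0r mulr1.
have -> : line_int 0 1 (fun z => line_int 0 L (fun x => A x z)) = 0.
  rewrite (@eq_line_int _ _ _ (fun _ => 0)); last first.
    move=> z /andP[z0 z1].
    have inC x : 0 <= x <= L -> closed_cell L (fun _ => 1) (x, z).
      by move=> xi; split => //=; rewrite !ltW.
    transitivity (e L * F1 L (e L * z) - e 0 * F1 0 (e 0 * z)); last first.
      rewrite eL F1L ?subrr//; have ez := e0 0.
      by rewrite (mulr_ge0 (ltW ez) (ltW z0))/= ger_pMr// ltW.
    apply: (@line_int_FTC 0 L (fun x => e x * F1 x (e x * z)) (A^~ z) L0).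
    - move=> x /inC /closed_cell_flat /C1 C1x.
      apply: is_deriveM' (De x) _.
      exact: (@is_derive_curve _ F1 (fun x => e x * z) x _ C1x (Dez x z)).
    - move=> x /inC /cA cAx.
      exact: (cvg_comp _ _ (cvg_pairR cvg_id (cvg_cst z)) cAx).
  by rewrite /line_int /Rintegral integral0.
rewrite add0r; apply: eq_line_int => x /andP[x0 xL].
have inC z : 0 <= z <= 1 -> closed_cell L (fun _ => 1) (x, z).
  by move=> zi; split => //=; rewrite !ltW.
transitivity (F2 x (e x * 1) - de x * (1 * F1 x (e x * 1)) -
   (F2 x (e x * 0) - de x * (0 * F1 x (e x * 0)))); last first.
  by rewrite !mulr1 !mulr0 !mul0r mul1r mulr0; ring.
apply: (@line_int_FTC 0 1 (fun z => F2 x (e x * z) - de x * (z * F1 x (e x * z))) (B x) ltr01).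
- move=> z /inC /closed_cell_flat K; have C1x := C1 _ K; have C2x := C2 _ K.
  have D1 := is_derive_comp' (Dzz x z) (C1_at_dy C1x).
  have D2 := is_derive_comp' (Dzz x z) (C1_at_dy C2x).
  have D3 := is_deriveM' (is_derive_cst (de x) z 1) (is_deriveM' (is_derive_id z 1) D1).
  apply: is_derive_eq (is_deriveB' D2 D3) _.
  by rewrite /B /=; ring.
- by move=> z /inC /cB; exact: cts2_slice.
Qed.

End Green.

(** * Differentiation in time under line and area integrals *)

Section TimeDerivative.
Variable I : set R.
Hypothesis oI : open I.

(** The space [U] is kept general so that the cell, the surface and the bed are handled alike, the
    last two through [tC1_comp]. Continuity is joint in time and position, which is what gives
    bounds uniform near a given time. *)
Definition tC1 (U : topologicalType) (K : set U) (f ft : R -> U -> R) : Prop :=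
  forall (t : R) (p : U), I t -> K p ->
    [/\ is_derive t 1 (fun s => f s p) (ft t p),
        {for (t, p), continuous (fun q : R * U => f q.1 q.2)} &
        {for (t, p), continuous (fun q : R * U => ft q.1 q.2)}].

Lemma tC1M (U : topologicalType) (K : set U) (f ft g gt : R -> U -> R) :
  tC1 K f ft -> tC1 K g gt ->
  tC1 K (fun t p => f t p * g t p) (fun t p => ft t p * g t p + f t p * gt t p).
Proof.
move=> Hf Hg t p It Kp; have [df cf cft] := Hf t p It Kp.
have [dg cg cgt] := Hg t p It Kp; split.
- exact: is_deriveM' df dg.
- exact: continuousM cf cg.
- exact: continuousD (continuousM cft cg) (continuousM cf cgt).
Qed.

Lemma tC1D (U : topologicalType) (K : set U) (f ft g gt : R -> U -> R) :
  tC1 K f ft -> tC1 K g gt ->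
  tC1 K (fun t p => f t p + g t p) (fun t p => ft t p + gt t p).
Proof.
move=> Hf Hg t p It Kp; have [df cf cft] := Hf t p It Kp.
have [dg cg cgt] := Hg t p It Kp; split.
- exact: is_deriveD' df dg.
- exact: continuousD cf cg.
- exact: continuousD cft cgt.
Qed.

Lemma tC1_cst (U : topologicalType) (K : set U) (c : U -> R) :
  (forall p, K p -> {for p, continuous c}) ->
  tC1 K (fun _ p => c p) (fun _ _ => 0).
Proof.
move=> cc t p It Kp; split; first exact: is_derive_cst.
- have c2 : {for (t, p), continuous (snd : R * U -> U)} by exact: cvg_snd.
  exact: (cvg_comp _ _ c2 (cc p Kp)).
- exact: cvg_cst.
Qed.

Lemma tC1Z (U : topologicalType) (K : set U) (c : U -> R) (f ft : R -> U -> R) :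
  (forall p, K p -> {for p, continuous c}) -> tC1 K f ft ->
  tC1 K (fun t p => c p * f t p) (fun t p => c p * ft t p).
Proof.
move=> cc Hf t p It Kp.
have [d c1 c2] := tC1M (tC1_cst cc) Hf It Kp; have [_ _ c2'] := Hf t p It Kp.
have [_ cc' _] := tC1_cst cc It Kp.
split => //; last exact: continuousM cc' c2'.
by move: d; rewrite mul0r add0r.
Qed.

Lemma tC1_comp (U V : topologicalType) (K : set U) (K' : set V) (c : V -> U)
    (f ft : R -> U -> R) :
  (forall q, K' q -> K (c q)) -> (forall q, K' q -> {for q, continuous c}) ->
  tC1 K f ft -> tC1 K' (fun t q => f t (c q)) (fun t q => ft t (c q)).
Proof.
move=> KK cc Hf t p It Kp; have [d c1 c2] := Hf t (c p) It (KK p Kp).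
have cp : {for (t, p), continuous (fun q : R * V => (q.1, c q.2))}.
  have c3 : {for (t, p), continuous (snd : R * V -> V)} by exact: cvg_snd.
  exact: cvg_pair cvg_fst (cvg_comp _ _ c3 (cc p Kp)).
by split => //; [exact: (cvg_comp _ _ cp c1)|exact: (cvg_comp _ _ cp c2)].
Qed.

Lemma tC1_slice (U : topologicalType) (K : set U) (f ft : R -> U -> R) t p :
  tC1 K f ft -> I t -> K p -> {for p, continuous (f t)} /\ {for p, continuous (ft t)}.
Proof.
move=> Hf It Kp; have [_ c1 c2] := Hf t p It Kp.
have cp : {for p, continuous (fun q : U => (t, q))}.
  exact: cvg_pair (cvg_cst t) cvg_id.
by split; [exact: (cvg_comp _ _ cp c1)|exact: (cvg_comp _ _ cp c2)].
Qed.

Lemma tC1_bound (U : topologicalType) (K : set U) (f ft : R -> U -> R) (t0 : R) :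
  compact K -> tC1 K f ft -> I t0 ->
  exists2 M : R, 0 < M & nbhs t0 (fun t : R => forall p, K p ->
     is_derive t 1 (fun s => f s p) (ft t p) /\ `|ft t p| <= M).
Proof.
move=> cK Hf It0.
have [p Kp|M M0 HM] := @compact_tube_bound U K ft t0 cK.
  by have [] := Hf t0 p It0 Kp.
exists M => //; have nI : nbhs t0 I by exact: open_nbhs_nbhs.
apply: nbhsS (nbhsI nI HM) => t [It Ht] p Kp; split; last exact: Ht.
by have [] := Hf t p It Kp.
Qed.

Lemma line_int_tC1 (L : R) (f ft : R -> R -> R) (t0 : R) :
  tC1 [set x | 0 <= x <= L] f ft -> I t0 ->
  is_derive t0 1 (fun t => line_int 0 L (f t)) (line_int 0 L (ft t0)).
Proof.
move=> Hf It0.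
have cK : compact [set x : R | 0 <= x <= L].
  suff -> : [set x : R | 0 <= x <= L] = `[0, L]%classic by exact: segment_compact.
  by apply/seteqP; split => x /=; rewrite in_itv.
have [M M0 HM] := tC1_bound cK Hf It0.
apply: (@Rintegral_derivable _ _ mu `]0, L[ f ft (fun _ => M) t0).
- exact: measurable_itv.
- have nI : nbhs t0 I by exact: open_nbhs_nbhs.
  apply: nbhsS nI => t It; apply: ctsI_integrable => x xi.
  exact: (tC1_slice Hf It xi).1.
- apply: nbhsS HM => t Ht x /=; rewrite in_itv/= => /andP[x0 xL].
  by apply: Ht; rewrite /= !ltW.
- by apply: ctsI_integrable => x _; exact: cvg_cst.
- by move=> _; exact: ltW.
Qed.

Lemma integrable_bounded_mul (D : set (R * R)) (f xi : R * R -> R) (M : R) :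
  measurable (D : set (mR * mR)) -> measurable_fun (D : set (mR * mR)) f ->
  leb2.-integrable D (EFin \o xi) -> (forall p, D p -> `|f p| <= M) ->
  leb2.-integrable D (EFin \o (fun p => f p * xi p)).
Proof.
move=> mD mf ixi bf.
have := @integrableZl _ _ _ leb2 D mD M (EFin \o xi) ixi.
apply: le_integrable => //.
  apply/measurable_EFinP; apply: measurable_funM => //.
  by apply/measurable_EFinP; exact: (measurable_int leb2).
move=> p Dp; rewrite /= lee_fin !normrM ler_wpM2r//.
exact: le_trans (bf p Dp) (ler_norm M).
Qed.

(** The weight [xi] is only integrable, so the dominating function is a constant times its absolute
    value. A kernel element as weight gives the rate of a Casimir, the constant 1 the rate of an
    energy. *)
Lemma area_int_tC1 (L : R) (e : R -> R) (f ft : R -> R * R -> R) (xi : R -> R -> R)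
    (t0 : R) : (forall x, {for x, continuous e}) ->
  tC1 (closed_cell L e) f ft -> I t0 ->
  leb2.-integrable (cell L e) (fun p : R * R => (xi p.1 p.2)%:E) ->
  is_derive t0 1 (fun t => area_int (cell L e) (fun x y => f t (x, y) * xi x y))
    (area_int (cell L e) (fun x y => ft t0 (x, y) * xi x y)).
Proof.
move=> ce Hf It0 ixi.
have cK : compact (closed_cell L e) by exact: closed_cell_compact.
have mD := @measurable_cell L e ce.
have [M M0 HM] := tC1_bound cK Hf It0.
rewrite /area_int.
have pE (g : R * R -> R) : (fun p : R * R => g (p.1, p.2) * xi p.1 p.2) =
   (fun p => g p * xi p.1 p.2) by apply/funext => -[x y].
rewrite pE; under eq_fun do rewrite pE.
apply: (@Rintegral_derivable _ _ leb2 (cell L e) (fun t p => f t p * xi p.1 p.2)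
   (fun t p => ft t p * xi p.1 p.2) (fun p => M * `|xi p.1 p.2|) t0).
- exact: mD.
- have nI : nbhs t0 I by exact: open_nbhs_nbhs.
  apply: nbhsS nI => t It.
  have cft p : closed_cell L e p -> {for p, continuous (f t)}.
    by move=> Kp; exact: (tC1_slice Hf It Kp).1.
  have [N N0 HN] := compact_bound cK cft.
  apply: (@integrable_bounded_mul _ (f t) (fun p => xi p.1 p.2) N mD) => //.
    have cu : ctsC L e (fun x y => f t (x, y)).
      move=> p Kp; rewrite /cts2 (_ : (fun z => _) = f t); first exact: cft.
      by apply/funext => -[].
    have := ctsC_measurable ce cu.
    by congr (measurable_fun _ _); apply/funext => -[].
  by move=> p /cell_sub; exact: HN.
- apply: nbhsS HM => t Ht p /cell_sub Kp; have [d b] := Ht p Kp; split.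
    have := is_deriveM' d (is_derive_cst (xi p.1 p.2) t 1).
    by rewrite mulr0 addr0.
  by rewrite normrM ler_wpM2r.
- have h := @integrableZl _ _ _ leb2 _ mD M _ (integrable_abse ixi).
  exact: h.
- by move=> p; rewrite mulr_ge0// ltW.
Qed.

End TimeDerivative.
End Integration.
Arguments fst_cts {R} p _ _.
Arguments snd_cts {R} p _ _.

(** * The kernel of the transport operator *)

Section Cutoff.
Context {R : realType}.

Definition ramp (u : R) : R := Num.max 0 u.

Lemma ramp_cts (u : R) : {for u, continuous ramp}.
Proof.
have c0 : {for u, continuous (fun _ : R => 0 : R)} by exact: cvg_cst.
exact: (continuous_max c0 (cvg_id : {for u, continuous (fun x : R => x)})).
Qed.

Lemma ramp_le0 u : u <= 0 -> ramp u = 0.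
Proof. by move=> u0; rewrite /ramp max_l. Qed.

Lemma ramp_ge u : 0 <= u -> ramp u = u.
Proof. by move=> u0; rewrite /ramp max_r. Qed.

(** [ramp u * u] is the square of the positive part. Only [u = 0] is delicate: there the difference
    quotient is [ramp h], which tends to 0. *)
Lemma is_derive_ramp_sqr (u : R) :
  is_derive u 1 (fun u => ramp u * u) (2 * ramp u).
Proof.
have idD := is_derive_id u (1 : R).
case: (ltgtP u 0) => u0.
- rewrite ramp_le0 ?ltW// mulr0.
  apply: near_eq_is_derive (is_derive_cst (0 : R) u 1).
  have : nbhs u (fun v => v < 0) by exact: lt_nbhsl.
  by apply: nbhsS => v v0; rewrite ramp_le0 ?ltW// mul0r.
- rewrite ramp_ge ?ltW//.
  have D := is_deriveM' idD idD.
  have := near_eq_is_derive _ D.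
  rewrite (_ : 1 * u + u * 1 = 2 * u); last by ring.
  apply; have : nbhs u (fun v => 0 < v) by exact: lt_nbhsr.
  by apply: nbhsS => v v0; rewrite ramp_ge ?ltW.
- rewrite u0 ramp_le0// mulr0.
  have main : (fun h : R => h^-1 *: (ramp (h + 0) * (h + 0) - ramp 0 * 0)) @ 0^' --> (0 : R).
    have c : ramp h @[h --> 0^'] --> (0 : R).
      rewrite -[X in _ --> X](ramp_le0 (lexx 0)).
      exact: cvg_within_filter (@ramp_cts 0).
    apply: cvg_trans c; apply: near_eq_cvg; near=> h.
    have h0 : h != 0 by near: h; exact: nbhs_dnbhs_neq.
    by rewrite addr0 mulr0 subr0 /GRing.scale/= mulrCA mulVf// mulr1.
  apply: DeriveDef.
    by apply/cvg_ex; exists 0; under eq_fun do rewrite scaler1; exact: main.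
  by apply/cvg_lim => //; under eq_fun do rewrite scaler1; exact: main.
Unshelve. all: by end_near. Qed.

Lemma ramp_sqr_ge0 u : 0 <= ramp u * u.
Proof.
have [u0|u0] := leP u 0; first by rewrite ramp_le0// mul0r.
have ? := ltW u0; by rewrite ramp_ge// mulr_ge0.
Qed.

Lemma ramp_sqr_gt0 u : 0 < u -> 0 < ramp u * u.
Proof. by move=> u0; rewrite ramp_ge ?mulr_gt0//; exact: ltW. Qed.

(** A $C^1$ step from 0 on [u <= 0] to 1 on [1 <= u]. Squares of positive parts are smooth enough,
    since test functions are only required to be $C^1$, and the denominator is positive because [u]
    and [1 - u] are never both nonpositive. *)
Definition cutoff (u : R) : R :=
  ramp u * u / (ramp u * u + ramp (1 - u) * (1 - u)).
Definition dcutoff (u : R) : R :=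
  (2 * ramp u * (ramp (1 - u) * (1 - u)) + ramp u * u * (2 * ramp (1 - u)))
  / (ramp u * u + ramp (1 - u) * (1 - u)) ^+ 2.

Lemma cutoff_den u : 0 < ramp u * u + ramp (1 - u) * (1 - u).
Proof.
have [u0|u0] := leP u 0; last by rewrite ltr_pwDl ?ramp_sqr_gt0 ?ramp_sqr_ge0.
by rewrite ltr_wpDl ?ramp_sqr_ge0// ramp_sqr_gt0//; lra.
Qed.

Lemma is_derive_cutoff (u : R) : is_derive u 1 cutoff (dcutoff u).
Proof.
have D1 : is_derive u 1 (fun u : R => 1 - u) (- 1).
  by have := is_deriveB' (is_derive_cst (1 : R) u 1) (is_derive_id u (1 : R)); rewrite sub0r.
have D2 := is_derive_comp' D1 (is_derive_ramp_sqr (1 - u)).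
have D0 := is_deriveD' (is_derive_ramp_sqr u) D2.
have n0 : ramp u * u + ramp (1 - u) * (1 - u) != 0 by rewrite gt_eqF// cutoff_den.
have D3 := @is_deriveV _ (fun u => ramp u * u + ramp (1 - u) * (1 - u)) u _ 1 n0 D0.
have D := is_deriveM' (is_derive_ramp_sqr u) D3.
apply: is_derive_eq D _.
rewrite /dcutoff /GRing.scale/=.
by field.
Qed.

Lemma dcutoff_cts (u : R) : {for u, continuous dcutoff}.
Proof.
have cid : {for u, continuous (fun v : R => v)} by exact: cvg_id.
have c1 : {for u, continuous (fun v : R => 1 - v)}.
  by apply: continuousB => //; exact: cvg_cst.
have cr := @ramp_cts u.
have cr1 : {for u, continuous (fun v : R => ramp (1 - v))}.
  exact: (cvg_comp _ _ c1 (@ramp_cts (1 - u))).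
have c2 : {for u, continuous (fun _ : R => 2 : R)} by exact: cvg_cst.
have cs := continuousM cr cid; have cs1 := continuousM cr1 c1.
have cd := continuousD cs cs1.
apply: continuousM.
  exact: continuousD (continuousM (continuousM c2 cr) cs1) (continuousM cs (continuousM c2 cr1)).
apply: continuousV; first by rewrite expf_neq0// gt_eqF// cutoff_den.
have cd' := cd; exact: continuousM cd cd'.
Qed.

Lemma cutoff_le0 u : u <= 0 -> cutoff u = 0.
Proof. by move=> u0; rewrite /cutoff ramp_le0// !mul0r. Qed.

Lemma cutoff_ge1 u : 1 <= u -> cutoff u = 1.
Proof.
move=> u1; rewrite /cutoff (@ramp_le0 (1 - u)) ?subr_le0// mul0r addr0 divff//.
by rewrite gt_eqF// ramp_sqr_gt0//; lra.
Qed.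

Lemma dcutoff_le0 u : u <= 0 -> dcutoff u = 0.
Proof. by move=> u0; rewrite /dcutoff ramp_le0// !(mulr0, mul0r, addr0). Qed.

Lemma dcutoff_ge1 u : 1 <= u -> dcutoff u = 0.
Proof.
by move=> u1; rewrite /dcutoff (@ramp_le0 (1 - u)) ?subr_le0// !(mulr0, mul0r, addr0).
Qed.

Lemma cutoff_bound u : `|cutoff u| <= 1.
Proof.
have d := cutoff_den u.
rewrite ger0_norm; last by rewrite divr_ge0 ?ramp_sqr_ge0 ?(ltW d).
by rewrite ler_pdivrMr// mul1r lerDl ramp_sqr_ge0.
Qed.

Lemma dcutoff_bound : exists2 C : R, 0 < C & forall u, `|dcutoff u| <= C.
Proof.
have [|C C0 HC] := @compact_bound R R `[0, 1] dcutoff (@segment_compact R 0 1).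
  by move=> u _; exact: dcutoff_cts.
exists C => // u; have [u0|u0] := leP u 0; first by rewrite dcutoff_le0// normr0 ltW.
have [u1|u1] := leP 1 u; first by rewrite dcutoff_ge1// normr0 ltW.
by apply: HC; rewrite /= in_itv/= !ltW.
Qed.

(* Zero within 1/n of the end points of [a, b], one beyond 2/n from them. *)
Definition plateau (a b n x : R) : R :=
  cutoff (n * (x - a) - 1) * cutoff (n * (b - x) - 1).
Definition dplateau (a b n x : R) : R :=
  n * dcutoff (n * (x - a) - 1) * cutoff (n * (b - x) - 1)
  - cutoff (n * (x - a) - 1) * (n * dcutoff (n * (b - x) - 1)).

Lemma is_derive_plateau (a b n x : R) :
  is_derive x 1 (plateau a b n) (dplateau a b n x).
Proof.
have idD := is_derive_id x (1 : R).
have D1 : is_derive x 1 (fun x : R => n * (x - a) - 1) n.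
  have := is_deriveB' (is_deriveM' (is_derive_cst n x 1)
    (is_deriveB' idD (is_derive_cst a x 1))) (is_derive_cst (1 : R) x 1).
  by move=> D; apply: is_derive_eq D _; rewrite /=; ring.
have D2 : is_derive x 1 (fun x : R => n * (b - x) - 1) (- n).
  have := is_deriveB' (is_deriveM' (is_derive_cst n x 1)
    (is_deriveB' (is_derive_cst b x 1) idD)) (is_derive_cst (1 : R) x 1).
  by move=> D; apply: is_derive_eq D _; rewrite /=; ring.
have := is_deriveM' (is_derive_comp' D1 (is_derive_cutoff _))
  (is_derive_comp' D2 (is_derive_cutoff _)).
by move=> D; apply: is_derive_eq D _; rewrite /dplateau; ring.
Qed.

Lemma dplateau_cts (a b n x : R) : {for x, continuous (dplateau a b n)}.
Proof.
have cid : {for x, continuous (fun v : R => v)} by exact: cvg_id.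
have cc (c : R) : {for x, continuous (fun _ : R => c)} by exact: cvg_cst.
have c1 : {for x, continuous (fun x : R => n * (x - a) - 1)}.
  exact: continuousB (continuousM (cc n) (continuousB cid (cc a))) (cc 1).
have c2 : {for x, continuous (fun x : R => n * (b - x) - 1)}.
  exact: continuousB (continuousM (cc n) (continuousB (cc b) cid)) (cc 1).
have k u : {for u, continuous cutoff} := is_derive_continuous (is_derive_cutoff u).
have k1 : {for x, continuous (fun x => cutoff (n * (x - a) - 1))}.
  exact: (cvg_comp _ _ c1 (k _)).
have k2 : {for x, continuous (fun x => cutoff (n * (b - x) - 1))}.
  exact: (cvg_comp _ _ c2 (k _)).
have k3 : {for x, continuous (fun x => dcutoff (n * (x - a) - 1))}.
  exact: (cvg_comp _ _ c1 (@dcutoff_cts _)).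
have k4 : {for x, continuous (fun x => dcutoff (n * (b - x) - 1))}.
  exact: (cvg_comp _ _ c2 (@dcutoff_cts _)).
exact: continuousB (continuousM (continuousM (cc n) k3) k2) (continuousM k1 (continuousM (cc n) k4)).
Qed.

Lemma plateau_C1 (a b n : R) (p : R * R) :
  C1_at (fun x _ => plateau a b n x) p.
Proof.
apply: (@C1_atI _ _ (fun x _ => dplateau a b n x) (fun _ _ => 0)).
apply: nbhs_forall => q; split.
- exact: is_derive_plateau.
- exact: is_derive_cst.
- exact: cts2_fst (@dplateau_cts a b n q.1).
- exact: cts2_cst.
Qed.

Lemma plateau0 (a b n x : R) : n * (x - a) <= 1 \/ n * (b - x) <= 1 ->
  plateau a b n x = 0.
Proof.
rewrite /plateau => -[h|h]; first by rewrite cutoff_le0 ?mul0r// subr_le0.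
by rewrite (@cutoff_le0 (n * (b - x) - 1)) ?mulr0// subr_le0.
Qed.

Lemma dplateau0 (a b n x : R) : n * (x - a) <= 1 -> dplateau a b n x = 0.
Proof.
move=> h; have h' : n * (x - a) - 1 <= 0 by rewrite subr_le0.
by rewrite /dplateau (cutoff_le0 h') (dcutoff_le0 h') mulr0 !mul0r subr0.
Qed.

Lemma plateau1 (a b n x : R) : 2 <= n * (x - a) -> 2 <= n * (b - x) ->
  plateau a b n x = 1 /\ dplateau a b n x = 0.
Proof.
move=> h1 h2; rewrite /plateau /dplateau.
by rewrite !cutoff_ge1 ?dcutoff_ge1 ?mulr1 ?mulr0 ?mul0r ?subr0//; lra.
Qed.

Lemma plateau_bound (a b n x : R) : `|plateau a b n x| <= 1.
Proof. by rewrite normrM mulr_ile1// cutoff_bound. Qed.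

(** The derivative vanishes unless [1 < n * d < 2], so the factor [n] is paid for by the smallness
    of the distance [d]. *)
Lemma dcutoff_scaled_bound (C n d : R) : (forall u, `|dcutoff u| <= C) ->
  0 <= n -> 0 <= d -> `|n * dcutoff (n * d - 1)| * d <= 2 * C.
Proof.
move=> HC n0 d0.
have C0 : 0 <= C by apply: le_trans (HC 0); exact: normr_ge0.
have [h|h] := leP (n * d - 1) 0.
  by rewrite dcutoff_le0// mulr0 normr0 mul0r mulr_ge0.
have [h1|h1] := leP 1 (n * d - 1).
  by rewrite dcutoff_ge1// mulr0 normr0 mul0r mulr_ge0.
rewrite normrM (ger0_norm n0) mulrAC; apply: ler_pM => //.
  by rewrite mulr_ge0.
by lra.
Qed.

Lemma bounded_product (A k V M d K : R) : 0 <= A -> k <= 1 -> 0 <= V ->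
  V <= M * d -> A * d <= K -> 0 <= M -> A * k * V <= K * M.
Proof.
move=> A0 k1 V0 VM AK M0; apply: (@le_trans _ _ (A * V)).
  by apply: ler_wpM2r => //; rewrite -[leRHS]mulr1 ler_wpM2l.
apply: (@le_trans _ _ (A * (M * d))); first exact: ler_wpM2l.
by rewrite mulrCA [leRHS]mulrC ler_wpM2l.
Qed.

(** The slope of the plateau is of order [n] only within [2 / n] of an end point. A value [v] that
    decays linearly towards both ends compensates it, with a bound independent of [n]; each end
    contributes [2 * C]. *)
Lemma dplateau_bound : exists2 C : R, 0 < C & forall a b n x v M : R,
  0 <= n -> a <= x <= b -> `|v| <= M * (x - a) -> `|v| <= M * (b - x) ->
  0 <= M -> `|dplateau a b n x * v| <= C * M.
Proof.
have [C C0 HC] := dcutoff_bound; exists (2 * C + 2 * C); first lra.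
move=> a b n x v M n0 /andP[ax xb] v1 v2 M0.
have xa0 : 0 <= x - a by rewrite subr_ge0.
have bx0 : 0 <= b - x by rewrite subr_ge0.
rewrite /dplateau mulrBl; apply: le_trans (ler_normB _ _) _.
rewrite [leRHS]mulrDl; apply: lerD.
- rewrite normrM normrM; apply: (@bounded_product _ _ _ _ (x - a)) => //.
  + exact: cutoff_bound.
  + exact: dcutoff_scaled_bound.
- rewrite normrM normrM [X in X * _]mulrC; apply: (@bounded_product _ _ _ _ (b - x)) => //.
  + exact: cutoff_bound.
  + exact: dcutoff_scaled_bound.
Qed.

End Cutoff.

(** The mean point has to be interior: the sign of [rdy psi] is known in the open fluid only, not on
    the surface or the bed. *)
Lemma MVT_open {R : realType} (u du : R -> R) (a b : R) : a < b ->
  (forall x, x \in `[a, b] -> is_derive x 1 u (du x)) ->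
  exists2 c, c \in `]a, b[ & u b - u a = du c * (b - a).
Proof.
move=> ab H.
have H1 x : x \in `]a, b[ -> is_derive x 1 u (du x).
  by move=> xi; apply: H; apply: subset_itv_oo_cc xi.
have cu : {within `[a, b], continuous u}.
  apply: continuous_in_subspaceT => x; rewrite inE => xi.
  exact: is_derive_continuous (H x xi).
exact: MVT ab H1 cu.
Qed.

Lemma Rintegral_cvg_dominated {R : realType} d (T : measurableType d)
    (m : {measure set T -> \bar R}) (D : set T) (f_ : nat -> T -> R)
    (f g : T -> R) : measurable D ->
  (forall n, measurable_fun D (f_ n)) -> measurable_fun D f ->
  (forall p, D p -> f_ n p @[n --> \oo] --> f p) ->
  m.-integrable D (EFin \o g) -> (forall p n, D p -> `|f_ n p| <= g p) ->
  (forall n, \int[m]_(p in D) f_ n p = 0) -> \int[m]_(p in D) f p = 0.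
Proof.
move=> mD mf_ mf ff ig fg f0.
have [] := @dominated_convergence _ _ _ m D mD (fun n => EFin \o f_ n) (EFin \o f) (EFin \o g).
- by move=> n; apply/measurable_EFinP; exact: mf_.
- exact/measurable_EFinP.
- by apply: aeW => p Dp /=; apply: cvg_EFin; [exact: nearW|exact: ff].
- exact: ig.
- by apply: aeW => p n Dp /=; rewrite lee_fin; exact: fg.
move=> intf _ lim.
(* [Rintegral] also sends an infinite integral to 0, so finiteness must be established before [f0]
   says anything about the extended-real integral. *)
have E n : (\int[m]_(p in D) (EFin \o f_ n) p = 0)%E.
  have := f0 n; rewrite /Rintegral.
  have ifn : m.-integrable D (EFin \o f_ n).
    apply: le_integrable ig => //.
      by apply/measurable_EFinP; exact: mf_.
    move=> p Dp /=; rewrite lee_fin; apply: le_trans (fg p n Dp) (ler_norm _).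
  have fin := integrable_fin_num mD ifn.
  by move=> Z; rewrite -(fineK fin); congr EFin.
have L0 : (\int[m]_(p in D) (EFin \o f) p = 0)%E.
  have := cvg_unique _ lim; apply => //.
  rewrite (_ : (fun n => _) = cst 0%E); last by apply/funext => n; rewrite /= E.
  exact: cvg_cst.
by rewrite /Rintegral; move: L0; rewrite /comp => ->.
Qed.

(** * Streamlines of the steady flow and weak kernel elements *)

Section StreamKernel.
Context {R : realType}.
Notation mR := (measurableTypeR R).
Variables (L q : R) (e de : R -> R) (psi : R -> R -> R).
Hypothesis L0 : 0 < L.
Hypothesis e0 : forall x, 0 < e x.
Hypothesis De : forall x : R, is_derive x 1 e (de x).
Hypothesis cde : forall x, {for x, continuous de}.
Hypothesis eL : e L = e 0.
Hypothesis psiC : forall p, closed_fluid e p -> C1_at psi p.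
Hypothesis psixC : forall p, closed_fluid e p -> C1_at (rdx psi) p.
Hypothesis psiyC : forall p, closed_fluid e p -> C1_at (rdy psi) p.
Hypothesis psi_top : forall x, psi x (e x) = 0.
Hypothesis psi_bot : forall x, psi x 0 = q.
Hypothesis psi_dec : forall x y, open_fluid e (x, y) -> rdy psi x y < 0.
Hypothesis psi_per : forall y, psi L y = psi 0 y.

Let ce x : {for x, continuous e}.
Proof. exact: is_derive_continuous (De x). Qed.

Lemma closed_cell_fluid p : closed_cell L e p -> closed_fluid e p.
Proof. by case: p => x y [_ /andP[y0 ye]]. Qed.

Lemma cell_open_fluid p : cell L e p -> open_fluid e p.
Proof. by case=> _ []. Qed.

Lemma open_closed_fluid p : open_fluid e p -> closed_fluid e p.
Proof. by case: p => x y [/= y0 ye]; split; rewrite /= ltW. Qed.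

Lemma psi_strict x y1 y2 : 0 <= y1 -> y1 < y2 -> y2 <= e x ->
  psi x y2 < psi x y1.
Proof.
move=> y10 y12 y2e.
have D y : y \in `[y1, y2] -> is_derive y 1 (psi x) (rdy psi x y).
  rewrite in_itv/= => /andP[ya yb]; apply: C1_at_dy; apply: psiC.
  by split => /=; [exact: le_trans ya|exact: le_trans y2e].
have [c] := MVT_open y12 D.
rewrite in_itv/= => /andP[c1 c2] E.
rewrite -subr_lt0 E nmulr_rlt0 ?subr_gt0//.
by apply: psi_dec; split => /=; [exact: le_lt_trans c1|exact: lt_le_trans y2e].
Qed.

Lemma psi_open x y : open_fluid e (x, y) -> 0 < psi x y < q.
Proof.
move=> [/= y0 ye]; rewrite -(psi_top x) -(psi_bot x).
by rewrite (psi_strict (ltW y0) ye (lexx _)) (psi_strict (lexx _) y0 (ltW ye)).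
Qed.

Lemma q_gt0 : 0 < q.
Proof. by rewrite -(psi_top 0) -(psi_bot 0) psi_strict. Qed.

Lemma psi_range x y : closed_fluid e (x, y) -> 0 <= psi x y <= q.
Proof.
move=> [/= y0 ye].
have [->|y0'] := eqVneq y 0; first by rewrite psi_bot lexx andbT ltW// q_gt0.
have [->|ye'] := eqVneq y (e x); first by rewrite psi_top lexx/= ltW// q_gt0.
have /andP[? ?] : 0 < psi x y < q by apply: psi_open; split; rewrite /= lt_neqAle ?ye' ?ye//= eq_sym y0'.
by rewrite !ltW.
Qed.

Lemma rtransport_cts f p : C1_at psi p -> C1_at f p -> cts2 (rtransport psi f) p.
Proof.
move=> /C1_atP[_ _ px py] /C1_atP[_ _ fx fy].
exact: cts2B (cts2M py fx) (cts2M px fy).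
Qed.

Lemma rtransportM f g x y : C1_at f (x, y) -> C1_at g (x, y) ->
  rtransport psi (fun x y => f x y * g x y) x y =
  rtransport psi f x y * g x y + f x y * rtransport psi g x y.
Proof.
move=> fC gC; rewrite /rtransport.
have Ex : rdx (fun x y => f x y * g x y) x y = rdx f x y * g x y + f x y * rdx g x y.
  exact: is_derive_derive1E (is_deriveM' (C1_at_dx fC) (C1_at_dx gC)).
have Ey : rdy (fun x y => f x y * g x y) x y = rdy f x y * g x y + f x y * rdy g x y.
  exact: is_derive_derive1E (is_deriveM' (C1_at_dy fC) (C1_at_dy gC)).
by rewrite Ex Ey; ring.
Qed.

Lemma rtransportB f g x y : C1_at f (x, y) -> C1_at g (x, y) ->
  rtransport psi (fun x y => f x y - g x y) x y =
  rtransport psi f x y - rtransport psi g x y.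
Proof.
move=> fC gC; rewrite /rtransport.
have Ex : rdx (fun x y => f x y - g x y) x y = rdx f x y - rdx g x y.
  exact: is_derive_derive1E (is_deriveB' (C1_at_dx fC) (C1_at_dx gC)).
have Ey : rdy (fun x y => f x y - g x y) x y = rdy f x y - rdy g x y.
  exact: is_derive_derive1E (is_deriveB' (C1_at_dy fC) (C1_at_dy gC)).
by rewrite Ex Ey; ring.
Qed.

Lemma rtransport_stream (u : R -> R) x y : C1_at psi (x, y) ->
  derivable u (psi x y) 1 -> rtransport psi (fun x y => u (psi x y)) x y = 0.
Proof.
move=> pC du; rewrite /rtransport.
have Du := is_derive_derive1 du.
have Ex : rdx (fun x y => u (psi x y)) x y = derive1 u (psi x y) * rdx psi x y.
  exact: is_derive_derive1E (is_derive_comp' (C1_at_dx pC) Du).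
have Ey : rdy (fun x y => u (psi x y)) x y = derive1 u (psi x y) * rdy psi x y.
  exact: is_derive_derive1E (is_derive_comp' (C1_at_dy pC) Du).
by rewrite Ex Ey; ring.
Qed.

Lemma rtransport_eq f g p : nbhs p (fun z : R * R => f z.1 z.2 = g z.1 z.2) ->
  C1_at f p -> rtransport psi f p.1 p.2 = rtransport psi g p.1 p.2.
Proof.
case: p => x y fg fC; rewrite /rtransport /=.
have n1 : \forall s \near x, f s y = g s y.
  have c1 : (fun s : R => (s, y)) @ x --> (x, y).
    exact: (cvg_pairR cvg_id (cvg_cst y)).
  exact: (c1 _ fg).
have n2 : \forall s \near y, f x s = g x s.
  have c1 : (fun s : R => (x, s)) @ y --> (x, y).
    exact: (cvg_pairR (cvg_cst x) cvg_id).
  exact: (c1 _ fg).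
have E1 : rdx g x y = rdx f x y.
  exact: is_derive_derive1E (near_eq_is_derive n1 (C1_at_dx fC)).
have E2 : rdy g x y = rdy f x y.
  exact: is_derive_derive1E (near_eq_is_derive n2 (C1_at_dy fC)).
by rewrite E1 E2.
Qed.

(** [psi] equals [q] on the bed and 0 on the surface, and its vertical slope is at most [M] in
    absolute value, so a change of [psi] by [d] along a vertical takes a height of at least [d / M].
    This keeps the supports of the test functions below off the bed and the surface. *)
Lemma psi_depth d : 0 < d -> exists2 m : R, 0 < m & forall x y,
  closed_cell L e (x, y) -> d <= psi x y <= q - d -> m <= y /\ m <= e x - y.
Proof.
move=> d0.
have cpy : ctsC L e (rdy psi) by move=> p /closed_cell_fluid /psiC /C1_atP[].
have [M M0 HM] := ctsC_bound ce cpy.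
exists (d / M); first by rewrite divr_gt0.
move=> x y xy /andP[pd pq]; have [/= xi /andP[y0 ye]] := xy.
have D y1 y2 z : 0 <= y1 -> y2 <= e x -> z \in `[y1, y2] ->
    is_derive z 1 (psi x) (rdy psi x z).
  rewrite in_itv/= => y10 y2e /andP[za zb]; apply: C1_at_dy; apply: psiC.
  by split => /=; [exact: le_trans za|exact: le_trans y2e].
have bound y1 y2 : 0 <= y1 -> y1 < y2 -> y2 <= e x -> psi x y1 - psi x y2 <= M * (y2 - y1).
  move=> y10 y12 y2e; have [c ci E] := MVT_closed y12 (fun z => @D y1 y2 z y10 y2e).
  rewrite -opprB E -mulNr; apply: ler_wpM2r; first by rewrite subr_ge0 ltW.
  apply: le_trans (ler_norm _) _; rewrite normrN; apply: HM; split => //=.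
  move: ci; rewrite in_itv/= => /andP[c1 c2].
  by rewrite (le_trans y10 c1) (le_trans c2 y2e).
rewrite !ler_pdivrMr//; split.
- move: y0; rewrite le_eqVlt => /predU1P[y0|y0].
    by move: pq; rewrite -y0 psi_bot; lra.
  have := bound 0 y (lexx _) y0 ye; rewrite psi_bot subr0 [y * M]mulrC; lra.
- move: ye; rewrite le_eqVlt => /predU1P[ye|ye].
    by move: pd; rewrite ye psi_top; lra.
  have := bound y (e x) y0 ye (lexx _); rewrite psi_top subr0 [(_ - _) * M]mulrC; lra.
Qed.

(** The point is joined to a side along the curve of constant ratio [z = y / e x], which stays in
    the fluid, whereas a horizontal segment may cross the surface. The derivative [U] along these
    curves is bounded on the straightened cell. *)
Lemma vanishing_sides_bound k : (forall p, closed_fluid e p -> C1_at k p) ->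
  (forall y, 0 <= y <= e 0 -> k 0 y = 0 /\ k L y = 0) ->
  exists2 M : R, 0 < M & forall x y, closed_cell L e (x, y) ->
    `|k x y| <= M * (x - 0) /\ `|k x y| <= M * (L - x).
Proof.
move=> kC k0.
pose U x z := rdx k x (e x * z) + de x * z * rdy k x (e x * z).
have cU : ctsC L (fun _ => 1) U.
  have ckx : ctsC L e (rdx k) by move=> p /closed_cell_fluid /kC /C1_atP[].
  have cky : ctsC L e (rdy k) by move=> p /closed_cell_fluid /kC /C1_atP[].
  apply: ctsCD (ctsC_flat e0 De ckx) _; apply: ctsCM (ctsC_flat e0 De cky).
  by apply: ctsCM (ctsC_fst cde) _ => p _; exact: snd_cts.
have c1 (x : R) : {for x, continuous (fun _ : R => 1 : R)} by exact: cvg_cst.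
have [M M0 HM] := ctsC_bound c1 cU.
exists M => // x y [/= /andP[x0 xL] /andP[y0 ye]].
pose z := y / e x.
have z01 : 0 <= z <= 1.
  by rewrite divr_ge0 ?(ltW (e0 x))//= ler_pdivrMr// mul1r.
have Ez : e x * z = y by rewrite mulrC divfK// gt_eqF.
have D (s : R) : is_derive s 1 (fun s => k s (e s * z)) (U s z).
  have inF : closed_fluid e (s, e s * z).
    case/andP: z01 => za zb; have es := e0 s; split => /=.
      by rewrite mulr_ge0// ltW.
    by rewrite ger_pMr.
  have Dez : is_derive s 1 (fun x => e x * z) (de s * z).
    by have := is_deriveM' (De s) (is_derive_cst z s 1); rewrite mulr0 addr0.
  exact: (@is_derive_curve _ k (fun x => e x * z) s _ (kC _ inF) Dez).
have bound a b : 0 <= a -> a < b -> b <= L ->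
    `|k b (e b * z) - k a (e a * z)| <= M * (b - a).
  move=> a0 ab bL; have [c ci ->] := MVT_closed ab (fun s _ => D s).
  rewrite normrM (@ger0_norm _ (b - a)); last by rewrite subr_ge0 ltW.
  rewrite ler_wpM2r//; first by rewrite subr_ge0 ltW.
  apply: HM; move: ci; rewrite in_itv/= => /andP[ca cb]; split => //=.
  by rewrite (le_trans a0 ca) (le_trans cb bL).
have ke0 : k 0 (e 0 * z) = 0 /\ k L (e L * z) = 0.
  have es := e0 0; case/andP: z01 => za zb.
  have h : 0 <= e 0 * z <= e 0 by rewrite (mulr_ge0 (ltW es) za)/= ger_pMr.
  by rewrite eL; exact: k0.
split.
- move: x0; rewrite le_eqVlt => /predU1P[x0|x0].
    rewrite -Ez -x0 ke0.1 normr0 subr0 mulr0//.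
  by have := bound 0 x (lexx _) x0 xL; rewrite ke0.1 Ez subr0.
- move: xL; rewrite le_eqVlt => /predU1P[xL|xL].
    by rewrite -Ez xL ke0.2 normr0 subrr mulr0.
  by have := bound x L x0 xL (lexx _); rewrite ke0.2 Ez sub0r normrN.
Qed.

(** The field [(psi_y, - psi_x)] is divergence free by equality of mixed derivatives, so the
    integrand is the divergence of [phi] times this field, and [phi] vanishes on the whole
    boundary. *)
Lemma unit_kernel phi : test_function (cell L e) phi ->
  area_int (cell L e) (fun x y => 1 * rtransport psi phi x y) = 0.
Proof.
move=> [phiC [K [_ Kc phi0]]].
have phi_out x y : ~ cell L e (x, y) -> phi x y = 0.
  by move=> nc; apply: phi0 => /Kc.
pose F1 x y := rdy psi x y * phi x y.
pose F2 x y := - (rdx psi x y * phi x y).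
have F1C p : closed_cell L e p -> C1_at F1 p.
  by move=> /closed_cell_fluid pF; exact: C1_atM (psiyC pF) (phiC p I).
have F2C p : closed_cell L e p -> C1_at F2 p.
  by move=> /closed_cell_fluid pF; exact: C1_atN (C1_atM (psixC pF) (phiC p I)).
have nL y : ~ cell L e (L, y) by case=> _ [/=]; rewrite ltxx.
have n0 y : ~ cell L e (0, y) by case=> /=; rewrite ltxx.
have ne x : ~ cell L e (x, e x) by case=> _ [_ [_ /=]]; rewrite ltxx.
have nb x : ~ cell L e (x, 0) by case=> _ [_ [/=]]; rewrite ltxx.
have F1L y : 0 <= y <= e 0 -> F1 L y = F1 0 y.
  by move=> _; rewrite /F1 !phi_out// !mulr0.
have main := cell_divergence L0 e0 De cde F1C F2C eL F1L.
rewrite (@eq_line_int _ _ _ _ (fun _ => 0)) in main; last first.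
  by move=> x _; rewrite /F1 /F2 !phi_out// !(mulr0, oppr0, subr0).
have z : line_int 0 L (fun _ => 0) = 0 by rewrite /line_int /Rintegral integral0.
rewrite z in main.
rewrite -[RHS]main; apply: eq_area_int => x y xy.
have pF : closed_fluid e (x, y) by apply: open_closed_fluid; exact: cell_open_fluid.
have phixy := phiC (x, y) I.
have E1 : rdx F1 x y = rdx (rdy psi) x y * phi x y + rdy psi x y * rdx phi x y.
  exact: is_derive_derive1E (is_deriveM' (C1_at_dx (psiyC pF)) (C1_at_dx phixy)).
have E2 : rdy F2 x y = - (rdy (rdx psi) x y * phi x y + rdx psi x y * rdy phi x y).
  exact: is_derive_derive1E (is_deriveN' (is_deriveM' (C1_at_dy (psixC pF)) (C1_at_dy phixy))).
have E3 := mixed_partials (psiC pF) (psixC pF) (psiyC pF).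
by rewrite E1 E2 /= E3 /rtransport; ring.
Qed.

Variable xi : R -> R -> R.
Hypothesis ixi : leb2.-integrable (cell L e) (fun p : R * R => (xi p.1 p.2)%:E).
Hypothesis xi_kernel : forall phi, test_function (cell L e) phi ->
  area_int (cell L e) (fun x y => xi x y * rtransport psi phi x y) = 0.

(** Within the cell the support of [k] stays away from bed and surface by [psi_depth], but it may
    reach the sides, where [k] merely vanishes. A plateau in [x] repairs this; the extra term
    containing its derivative is bounded uniformly in [n] and is zero at each fixed point for large
    [n], so dominated convergence removes it. *)
Lemma kernel_vanishing_sides k d : 0 < d ->
  (forall p, closed_fluid e p -> C1_at k p) ->
  (forall y, 0 <= y <= e 0 -> k 0 y = 0 /\ k L y = 0) ->
  (forall x y, closed_cell L e (x, y) -> k x y != 0 -> d <= psi x y <= q - d) ->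
  area_int (cell L e) (fun x y => xi x y * rtransport psi k x y) = 0.
Proof.
move=> d0 kC k_sides k_supp.
have [M M0 HM] := vanishing_sides_bound kC k_sides.
have [m m0 Hm] := psi_depth d0.
have cpy : ctsC L e (rdy psi) by move=> p /closed_cell_fluid /psiC /C1_atP[].
have [Mp Mp0 HMp] := ctsC_bound ce cpy.
have cT : ctsC L e (rtransport psi k).
  by move=> p /closed_cell_fluid pF; exact: rtransport_cts (psiC pF) (kC _ pF).
have [MT MT0 HMT] := ctsC_bound ce cT.
(* k is O(x) near the sides, so k times the derivative of the plateau, which is
   of order n there, stays bounded. *)
have [C C0 HC] := @dplateau_bound R.
pose N (n : nat) : R := n.+1%:R.
have N0 n : 0 < N n by rewrite ltr0n.
pose w n (x y : R) := plateau 0 L (N n) x * k x y.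
(* The extension by zero is needed since [k] may be nonzero beyond the sides. It is $C^1$ because it
   vanishes off [K n], a compact subset of the open cell. *)
pose phi n x y := if `[< cell L e (x, y) >] then w n x y else 0.
have wC n p : closed_fluid e p -> C1_at (w n) p.
  move=> pF; exact: C1_atM (plateau_C1 _ _ _ _) (kC _ pF).
have phi_near n p : cell L e p -> nbhs p (fun z : R * R => w n z.1 z.2 = phi n z.1 z.2).
  move=> pc; have : nbhs p (cell L e) by apply: open_nbhs_nbhs; split => //; exact: cell_open.
  by apply: nbhsS => -[x y] xy; rewrite /phi; case: asboolP.
pose K n : set (R * R) := [set p | 0 <= N n * p.1 - 1] `&`
  ([set p | 0 <= N n * (L - p.1) - 1] `&`
   ([set p | 0 <= p.2 - m] `&` [set p | 0 <= e p.1 - p.2 - m])).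
have Kcell n : K n `<=` cell L e.
  move=> [x y] [/= h1 [h2 [h3 h4]]].
  have x0 : 0 < N n * x by lra.
  have xL : 0 < N n * (L - x) by lra.
  rewrite pmulr_rgt0// in x0; rewrite pmulr_rgt0// subr_gt0 in xL.
  by split => //; split => //; split => /=; lra.
have Kclosed n : closed (K n).
  apply: closedI.
    apply: (closed_ge0 (f := fun x _ => N n * x - 1)) => p.
    have h := cts2M (cts2_cst (N n) p) (fst_cts p).
    have h2 := cts2B h (cts2_cst 1 p); exact: h2.
  apply: closedI.
    apply: (closed_ge0 (f := fun x _ => N n * (L - x) - 1)) => p.
    have h := cts2M (cts2_cst (N n) p) (cts2B (cts2_cst L p) (fst_cts p)).
    have h2 := cts2B h (cts2_cst 1 p); exact: h2.
  apply: closedI.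
    apply: (closed_ge0 (f := fun _ y => y - m)) => p.
    exact: cts2B (snd_cts p) (cts2_cst m p).
  apply: (closed_ge0 (f := fun x y => e x - y - m)) => p.
  have h := cts2B (@cts2_fst _ e p (@ce p.1)) (snd_cts p).
  have h2 := cts2B h (cts2_cst m p); exact: h2.
have Kcompact n : compact (K n).
  have ccL : compact (closed_cell L e) by exact: closed_cell_compact.
  by apply: subclosed_compact (Kclosed n) ccL _ => z /Kcell; exact: cell_sub.
have phi0 n x y : ~ K n (x, y) -> phi n x y = 0.
  rewrite /phi; case: asboolP => // xy nK; apply/eqP/negPn/negP => nz.
  apply: nK; move: nz; rewrite /w mulf_eq0 negb_or => /andP[nz1 nz2].
  have xyc := cell_sub xy.
  have [h3 h4] := Hm x y xyc (k_supp x y xyc nz2).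
  have h1 : 1 < N n * (x - 0).
    by rewrite ltNge; apply/negP => h; move/eqP: nz1; apply; apply: plateau0; left.
  have h2 : 1 < N n * (L - x).
    by rewrite ltNge; apply/negP => h; move/eqP: nz1; apply; apply: plateau0; right.
  rewrite subr0 in h1.
  by split; [|split; [|split]]; rewrite /= subr_ge0 //; exact: ltW.
have phi_test n : test_function (cell L e) (phi n).
  split; last by exists (K n); split => //; exact: phi0.
  move=> p _; have [pc|npc] := pselect (cell L e p).
    apply: C1_at_eq (phi_near n p pc) _; apply: wC.
    by apply: open_closed_fluid; exact: cell_open_fluid.
  have nK : ~ K n p by move=> /Kcell.
  have : nbhs p (~` K n) by apply: open_nbhs_nbhs; split => //; exact/closed_openC.
  move=> nbp; apply: (@C1_at_eq _ (fun _ _ => 0)); last exact: C1_at_cst.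
  by move: nbp; apply: nbhsS => -[x y] nKxy; rewrite phi0.
have TE n x y : cell L e (x, y) -> rtransport psi (phi n) x y =
   rdy psi x y * (dplateau 0 L (N n) x * k x y) + plateau 0 L (N n) x * rtransport psi k x y.
  move=> xy; have xyF : closed_fluid e (x, y) by apply: open_closed_fluid; exact: cell_open_fluid.
  rewrite -(rtransport_eq (phi_near n _ xy) (wC n _ xyF)) /w.
  have aC : C1_at (fun x _ : R => plateau 0 L (N n) x) (x, y).
    exact: plateau_C1.
  rewrite (rtransportM aC (kC _ xyF)); congr (_ + _).
  rewrite {1}/rtransport.
  have -> : rdx (fun x0 _ => plateau 0 L (N n) x0) x y = dplateau 0 L (N n) x.
    exact: is_derive_derive1E (is_derive_plateau _ _ _ x).
  have -> : rdy (fun x0 _ => plateau 0 L (N n) x0) x y = 0.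
    exact: is_derive_derive1E (is_derive_cst _ y 1).
  by rewrite mulr0 subr0 mulrA.
have mcell := @measurable_cell R L e ce.
have mxi : measurable_fun (cell L e : set (mR * mR)) (fun p : R * R => xi p.1 p.2).
  by apply/measurable_EFinP; exact: (measurable_int leb2).
rewrite /area_int.
pose Q := Mp * (C * M) + MT.
apply: (@Rintegral_cvg_dominated R _ _ leb2 (cell L e)
  (fun n p => xi p.1 p.2 * rtransport psi (phi n) p.1 p.2) _
  (fun p => Q * `|xi p.1 p.2|)).
- exact: mcell.
- move=> n; apply: measurable_funM => //.
  apply: cts2_measurable; first exact: cell_open.
  move=> p pc; have pF : closed_fluid e p by apply: open_closed_fluid; exact: cell_open_fluid.
  by apply: rtransport_cts; [exact: psiC|exact: (phi_test n).1].
- by apply: measurable_funM => //; exact: ctsC_measurable.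
- move=> [x y] xy; have [x0 [xL _]] : cell L e (x, y) := xy.
  have ev (c : R) : 0 < c -> \forall n \near \oo, 2 <= N n * c.
    move=> c0; near=> n; rewrite -ler_pdivrMr//.
    apply: (@le_trans _ _ n%:R); last by rewrite ler_nat.
    by near: n; exact: nbhs_infty_ger.
  have xL0 : 0 < L - x by rewrite subr_gt0.
  have x00 : 0 < x - 0 by rewrite subr0.
  apply: cvg_near_cst; apply: filterS2 (ev _ x00) (ev _ xL0) => n h1 h2; apply/eqP.
  by rewrite TE//; have [-> ->] := plateau1 h1 h2; rewrite mul0r mulr0 add0r mul1r.
- have h := @integrableZl _ _ _ leb2 _ mcell Q _ (integrable_abse ixi).
  exact: h.
- move=> [x y] n xy; rewrite normrM mulrC ler_wpM2r//= TE//.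
  have xyc := cell_sub xy; have [b1 b2] := HM x y xyc.
  have [/= /andP[x0 xL] _] := xyc.
  apply: le_trans (ler_normD _ _) _; apply: lerD.
    rewrite normrM; apply: ler_pM => //; first exact: HMp.
    by apply: HC; [exact: ltW|rewrite x0 xL|exact: b1|exact: b2|exact: ltW].
  by rewrite normrM -[leRHS]mul1r ler_pM// ?plateau_bound//; exact: HMT.
- by move=> n; exact: (xi_kernel (phi_test n)).
Unshelve. all: by end_near. Qed.

(* The height of the streamline psi = p above x = 0. *)
Lemma stream_inverse : exists Y : R -> R, forall p, 0 < p < q ->
  [/\ 0 < Y p < e 0, psi 0 (Y p) = p &
      is_derive p 1 Y (rdy psi 0 (Y p))^-1].
Proof.
pose Y (p : R) : R := xget 0 [set y | 0 < y < e 0 /\ psi 0 y = p].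
have D y : 0 <= y <= e 0 -> is_derive y 1 (psi 0) (rdy psi 0 y).
  by move=> /andP[y0 ye]; apply: C1_at_dy; apply: psiC.
have Yp p : 0 < p < q -> 0 < Y p < e 0 /\ psi 0 (Y p) = p.
  move=> /andP[p0 pq].
  have [||y yi Ey] := @IVT R (psi 0) 0 (e 0) p (ltW (e0 0)).
  - apply: continuous_in_subspaceT => y; rewrite inE/= in_itv/= => yi.
    exact: is_derive_continuous (D y yi).
  - by rewrite psi_bot psi_top ge_min le_max (ltW p0) (ltW pq) orbT.
  apply: (@xgetPex _ 0 [set y | 0 < y < e 0 /\ psi 0 y = p]).
  exists y; split => //; move: yi; rewrite in_itv/= => /andP[y0 ye].
  rewrite !lt_neqAle y0 ye !andbT; apply/andP; split; apply/eqP => E.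
    by move: pq; rewrite -Ey -E psi_bot ltxx.
  by move: p0; rewrite -Ey E psi_top ltxx.
exists Y => p pi; have [Yi pY] := Yp p pi; split => //.
have YK y : 0 < y < e 0 -> Y (psi 0 y) = y.
  move=> /andP[y0 ye].
  have py : 0 < psi 0 y < q by apply: psi_open; split.
  have [/andP[Y0 Ye] E] := Yp _ py.
  case: (ltgtP (Y (psi 0 y)) y) => // h.
    by have := psi_strict (ltW Y0) h (ltW ye); rewrite E ltxx.
  by have := psi_strict (ltW y0) h (ltW Ye); rewrite E ltxx.
have nbY : nbhs (Y p) (fun y => 0 < y < e 0).
  case/andP: Yi => Y0 Ye.
  have := nbhsI (lt_nbhsr Y0) (lt_nbhsl Ye).
  by apply: nbhsS => y [-> ->].
rewrite -[X in is_derive X](pY); apply: is_derive_inverse.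
- by apply: nbhsS nbY => y yi; exact: YK.
- apply: nbhsS nbY => y /andP[y0 ye].
  by apply: is_derive_continuous (D y _); rewrite !ltW.
- by apply: D; case/andP: Yi => Y0 Ye; rewrite !ltW.
- by rewrite lt_eqF//; apply: psi_dec; case/andP: Yi.
Qed.

Lemma C1_fun_at (u du : R -> R) : (forall r : R, is_derive r 1 u (du r)) ->
  (forall r, {for r, continuous du}) -> forall f p, C1_at f p ->
  C1_at (fun x y => u (f x y)) p.
Proof.
move=> Du cdu f p fC.
apply: (@C1_atI _ _ (fun x y => du (f x y) * rdx f x y)
                  (fun x y => du (f x y) * rdy f x y)).
have := C1_at_near fC.
apply: nbhsS => -[x y] Cq.
have [_ _ fx fy] := C1_atP Cq.
split.
- exact: is_derive_comp' (C1_at_dx Cq) (Du _).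
- exact: is_derive_comp' (C1_at_dy Cq) (Du _).
- by apply: cts2M fx; apply: cts2_comp (C1_at_cts Cq); exact: cdu.
- by apply: cts2M fy; apply: cts2_comp (C1_at_cts Cq); exact: cdu.
Qed.

(** The weight is supported in [[d, q - d]] because the streamline height is differentiable only on
    []0, q[]: its derivative is the inverse of [rdy psi], which may vanish on the bed or the
    surface. Under such a weight the side values of [h] become a $C^1$ function of [psi] on the
    whole line. *)
Lemma kernel_C1_weight (B dB : R -> R) (d : R) h : 0 < d ->
  (forall r : R, is_derive r 1 B (dB r)) -> (forall r, {for r, continuous dB}) ->
  (forall r, B r != 0 -> d <= r <= q - d) ->
  (forall p, closed_fluid e p -> C1_at h p) ->
  (forall y, 0 <= y <= e 0 -> h L y = h 0 y) ->
  area_int (cell L e) (fun x y => xi x y * (B (psi x y) * rtransport psi h x y)) = 0.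
Proof.
move=> d0 DB cdB suppB hC hL.
have [Y HY] := stream_inverse.
have B0 r : ~~ (d <= r <= q - d) -> B r = 0.
  by move=> h1; apply/eqP/negPn/negP => /suppB h2; rewrite h2 in h1.
(* Regularity is checked in two cases. The set [far] is open and every function involved vanishes on
   it; any point outside [far] has a neighbourhood inside []0, q[], where the formulas with [Y] are
   valid. *)
pose far r := (r < d) || (q - d < r).
have farP r : far r = ~~ (d <= r <= q - d) by rewrite /far negb_and -!ltNge.
have near_far (r : R) : far r -> nbhs r (fun s => far s).
  move=> /orP[h1|h1].
    by have := lt_nbhsl h1; apply: nbhsS => s s1; rewrite /far s1.
  by have := lt_nbhsr h1; apply: nbhsS => s s1; rewrite /far s1 orbT.
have B_far r : far r -> B r = 0 by rewrite farP; exact: B0.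
have dB_far (r : R) : far r -> dB r = 0.
  move=> rf; rewrite -(is_derive_derive1E (DB r)).
  apply: is_derive_derive1E; apply: near_eq_is_derive (is_derive_cst (0 : R) r 1).
  by have := near_far r rf; apply: nbhsS => s sf; rewrite B_far.
pose D (r : R) := if 0 < r < q then B r * h 0 (Y r) else 0.
pose dD (r : R) := if 0 < r < q then dB r * h 0 (Y r) +
  B r * (rdy h 0 (Y r) * (rdy psi 0 (Y r))^-1) else 0.
have D_far r : far r -> D r = 0.
  by move=> rf; rewrite /D; case: ifP => // _; rewrite B_far// mul0r.
have dD_far r : far r -> dD r = 0.
  by move=> rf; rewrite /dD; case: ifP => // _; rewrite B_far// dB_far// !mul0r addr0.
have mid (r : R) : ~~ far r -> nbhs r (fun s => 0 < s < q).
  rewrite farP negbK => /andP[h1 h2].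
  have r0 : 0 < r by lra.
  have rq : r < q by lra.
  by have := nbhsI (lt_nbhsr r0) (lt_nbhsl rq); apply: nbhsS => s [-> ->].
have inF r : 0 < r < q -> closed_fluid e (0, Y r).
  by move=> /HY[/andP[Y0 Ye] _ _]; split; exact: ltW.
have DD (r : R) : is_derive r 1 D (dD r).
  have [rf|rf] := boolP (far r).
    rewrite dD_far//; apply: near_eq_is_derive (is_derive_cst (0 : R) r 1).
    by have := near_far r rf; apply: nbhsS => s sf; rewrite D_far.
  have ri := nbhs_singleton (mid r rf); have [_ _ DY] := HY r ri.
  have := is_deriveM' (DB r) (is_derive_comp' DY (C1_at_dy (hC _ (inF r ri)))).
  rewrite /dD ri; apply: near_eq_is_derive.
  by have := mid r rf; apply: nbhsS => s si; rewrite /D si.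
have cdD r : {for r, continuous dD}.
  have [rf|rf] := boolP (far r).
    rewrite /prop_for /continuous_at dD_far//.
    apply: cvg_near_cst; have := near_far r rf.
    by apply: nbhsS => s sf; rewrite dD_far.
  have ri := nbhs_singleton (mid r rf); have [Yi _ DY] := HY r ri.
  have cY : {for r, continuous Y} := is_derive_continuous DY.
  have cB : {for r, continuous B} := is_derive_continuous (DB r).
  have [_ _ _ chy] := C1_atP (hC _ (inF r ri)).
  have ch := C1_at_cts (hC _ (inF r ri)).
  have [_ _ _ cpy] := C1_atP (psiC (inF r ri)).
  have comp f : cts2 f (0, Y r) -> {for r, continuous (fun s => f 0 (Y s))}.
    by move=> /cts2_slice cf; exact: (cvg_comp _ _ cY cf).
  have n0 : rdy psi 0 (Y r) != 0 by rewrite lt_eqF//; apply: psi_dec; case/andP: Yi.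
  have cV : {for r, continuous (fun s => (rdy psi 0 (Y s))^-1)}.
    by apply: (cvgV n0); exact: comp cpy.
  have main := continuousD (continuousM (cdB r) (comp _ ch))
    (continuousM cB (continuousM (comp _ chy) cV)).
  have E : nbhs r (fun s => dB s * h 0 (Y s) + B s * (rdy h 0 (Y s) * (rdy psi 0 (Y s))^-1) = dD s).
    by have := mid r rf; apply: nbhsS => s si; rewrite /dD si.
  rewrite /prop_for /continuous_at -(nbhs_singleton E).
  exact: cvg_trans (near_eq_cvg E) main.
(* D (psi x y) is the value of B psi * h at the point of x = 0 lying on the
   streamline through (x, y). *)
pose k x y := B (psi x y) * h x y - D (psi x y).
have kC p : closed_fluid e p -> C1_at k p.
  move=> pF; apply: C1_atB; last exact: C1_fun_at DD cdD _ _ (psiC pF).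
  by apply: C1_atM (hC _ pF); exact: C1_fun_at DB cdB _ _ (psiC pF).
have k0 y : 0 <= y <= e 0 -> k 0 y = 0.
  move=> /andP[y0 ye]; rewrite /k.
  have [pf|pf] := boolP (far (psi 0 y)).
    by rewrite B_far// D_far// mul0r subrr.
  have pi := nbhs_singleton (mid _ pf); rewrite /D pi.
  have [/andP[Y0 Ye] E _] := HY _ pi.
  suff -> : Y (psi 0 y) = y by rewrite subrr.
  case: (ltgtP (Y (psi 0 y)) y) => // h1.
    by have := psi_strict (ltW Y0) h1 ye; rewrite E ltxx.
  by have := psi_strict y0 h1 (ltW Ye); rewrite E ltxx.
have main : area_int (cell L e) (fun x y => xi x y * rtransport psi k x y) = 0.
  apply: (@kernel_vanishing_sides k d d0 kC).
  - move=> y yi; split; first exact: k0.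
    by rewrite -(k0 y yi) /k psi_per hL.
  - move=> x y _; apply: contra_neqT; rewrite -farP /k => pf.
    by rewrite B_far// D_far// mul0r subrr.
rewrite -[RHS]main; apply: eq_area_int => x y xy; congr (_ * _).
have pF : closed_fluid e (x, y) by apply: open_closed_fluid; exact: cell_open_fluid.
have C1B := C1_fun_at DB cdB (psiC pF).
have C1D := C1_fun_at DD cdD (psiC pF).
have dBp : derivable B (psi x y) 1 by case: (DB (psi x y)).
have dDp : derivable D (psi x y) 1 by case: (DD (psi x y)).
rewrite /k (rtransportB (C1_atM C1B (hC _ pF)) C1D) (rtransportM C1B (hC _ pF)).
by rewrite (rtransport_stream (psiC pF) dBp) (rtransport_stream (psiC pF) dDp) mul0r add0r subr0.
Qed.

(** The integral starts at 0, so only points to the right of 0 are covered. The plateau that will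
    multiply the difference quotients vanishes near every point [r <= 0]. *)
Lemma antiderivative (G : R -> R) : (forall r, {for r, continuous G}) ->
  exists A : R -> R, forall r : R, 0 < r -> is_derive r 1 A (G r).
Proof.
move=> cG; exists (fun x => \int[@lebesgue_measure R]_(t in `[0, x]) G t) => r r0.
have ru : r < r + 1 by lra.
have iG : (@lebesgue_measure R).-integrable `[0, (r + 1)] (EFin \o G).
  by apply: ctsI_integrable_closed => x _; exact: cG.
have [dA EA] := continuous_FTC1_closed ru iG r0 (cG r).
by rewrite -EA; exact: is_derive_derive1.
Qed.

(** The weights that occur, such as [gamma'] and its inverse, are continuous but need not be $C^1$,
    hence this passage to the limit from [kernel_C1_weight] by dominated convergence. *)
Lemma kernel_cts_weight (G : R -> R) h :
  (forall r, {for r, continuous G}) ->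
  (forall p, closed_fluid e p -> C1_at h p) ->
  (forall y, 0 <= y <= e 0 -> h L y = h 0 y) ->
  area_int (cell L e) (fun x y => xi x y * (G (psi x y) * rtransport psi h x y)) = 0.
Proof.
move=> cG hC hL.
have [A DA] := antiderivative cG.
pose N (n : nat) : R := n.+1%:R.
have N0 n : 0 < N n by rewrite ltr0n.
have NV n : 0 < (N n)^-1 by rewrite invr_gt0.
(* A difference quotient of an antiderivative, cut off by a plateau, is a C1
   approximation of G supported inside ]0, q[. *)
pose Gn n r := N n * (A (r + (N n)^-1) - A r).
pose B n r := plateau 0 q (N n) r * Gn n r.
pose dB n r := dplateau 0 q (N n) r * Gn n r +
  plateau 0 q (N n) r * (N n * (G (r + (N n)^-1) - G r)).
have DGn n (r : R) : 0 < r -> is_derive r 1 (Gn n) (N n * (G (r + (N n)^-1) - G r)).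
  move=> r0; have Ds : is_derive r 1 (fun s : R => s + (N n)^-1) 1.
    have := is_deriveD' (is_derive_id r (1 : R)) (is_derive_cst (N n)^-1 r 1).
    by rewrite addr0.
  have D1 := is_derive_comp' Ds (DA (r + (N n)^-1) (addr_gt0 r0 (NV n))).
  have := is_deriveM' (is_derive_cst (N n) r 1) (is_deriveB' D1 (DA r r0)).
  by move=> D; apply: is_derive_eq D _; rewrite /=; ring.
(* Nothing is known about [A] at [r <= 0]. The plateau vanishes up to [(N n)^-1], hence around such
   [r], and makes the product locally zero. *)
have small n (r : R) : r <= 0 -> nbhs r (fun s => N n * (s - 0) <= 1).
  move=> r0; have r1 : r < (N n)^-1 by apply: le_lt_trans (NV n).
  have := lt_nbhsl r1; apply: nbhsS => s s1; rewrite subr0.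
  by rewrite -(@mulVf _ (N n)) ?gt_eqF// mulrC ler_wpM2r ?ltW.
have DB n (r : R) : is_derive r 1 (B n) (dB n r).
  have [r0|r0] := leP r 0; last exact: is_deriveM' (is_derive_plateau _ _ _ _) (DGn n r r0).
  have rs := nbhs_singleton (small n r r0).
  rewrite /dB dplateau0// plateau0; last by left.
  rewrite !mul0r addr0; apply: near_eq_is_derive (is_derive_cst (0 : R) r 1).
  by have := small n r r0; apply: nbhsS => s s1; rewrite /B plateau0 ?mul0r//; left.
have cdB n (r : R) : {for r, continuous (dB n)}.
  have [r0|r0] := leP r 0.
    have E s : N n * (s - 0) <= 1 -> dB n s = 0.
      by move=> s1; rewrite /dB dplateau0// plateau0 ?mul0r ?addr0//; left.
    rewrite /prop_for /continuous_at E; last exact: nbhs_singleton (small n r r0).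
    by apply: cvg_near_cst; have := small n r r0; apply: nbhsS => s /E ->.
  have cGn : {for r, continuous (Gn n)} := is_derive_continuous (DGn n r r0).
  have cpl : {for r, continuous (plateau 0 q (N n))}.
    exact: is_derive_continuous (is_derive_plateau _ _ _ _).
  have cs : {for r, continuous (fun s : R => s + (N n)^-1)}.
    by apply: continuousD; [exact: cvg_id|exact: cvg_cst].
  have cGs : {for r, continuous (fun s => G (s + (N n)^-1))}.
    exact: (cvg_comp _ _ cs (cG _)).
  have cN : {for r, continuous (fun _ : R => N n)} by exact: cvg_cst.
  exact: continuousD (continuousM (@dplateau_cts _ 0 q (N n) r) cGn)
    (continuousM cpl (continuousM cN (continuousB cGs (cG r)))).
have suppB n r : B n r != 0 -> (N n)^-1 <= r <= q - (N n)^-1.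
  rewrite /B mulf_eq0 negb_or => /andP[nz _].
  have h1 : 1 < N n * (r - 0).
    by rewrite ltNge; apply/negP => h1; move/eqP: nz; apply; apply: plateau0; left.
  have h2 : 1 < N n * (q - r).
    by rewrite ltNge; apply/negP => h2; move/eqP: nz; apply; apply: plateau0; right.
  rewrite subr0 -ltr_pdivrMl// mulr1 in h1; rewrite -ltr_pdivrMl// mulr1 in h2.
  by rewrite (ltW h1)/= lerBrDl -lerBrDr ltW.
(* The interval reaches [q + 1] because the mean point of a difference quotient taken at [r < q] may
   lie as far as [r + (N n)^-1], and [(N n)^-1 <= 1]. *)
have [MG MG0 HMG] : exists2 M : R, 0 < M & forall r, 0 <= r <= q + 1 -> `|G r| <= M.
  have [M M0 HM] := @compact_bound R R `[0, q + 1] G (@segment_compact R _ _) (fun r _ => cG r).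
  by exists M => // r ri; apply: HM; rewrite /= in_itv.
have Gn_mean n r : 0 < r -> exists2 c, r <= c <= r + (N n)^-1 & Gn n r = G c.
  move=> r0; have lt : r < r + (N n)^-1 by rewrite ltrDl.
  have Dc c : c \in `[r, r + (N n)^-1] -> is_derive c 1 A (G c).
    by rewrite in_itv/= => /andP[c1 _]; apply: DA; exact: lt_le_trans c1.
  have [c ci Ec] := MVT_closed lt Dc.
  exists c; first by move: ci; rewrite in_itv.
  rewrite /Gn Ec [r + _ - r]addrC addKr mulrCA mulfV ?mulr1//.
  by rewrite gt_eqF.
have Bn_bound n r : 0 < r < q -> `|B n r| <= MG.
  move=> /andP[r0 rq]; rewrite /B normrM -[leRHS]mul1r.
  apply: ler_pM => //; first exact: plateau_bound.
  have [c /andP[c1 c2] ->] := Gn_mean n r r0; apply: HMG.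
  have : (N n)^-1 <= 1 by rewrite invf_le1// ler1n.
  by move: ((N n)^-1) c2 => t c2 t1; apply/andP; split; lra.
have cvN : (N n)^-1 @[n --> \oo] --> (0 : R).
  exact: cvg_harmonic.
have ev (c : R) : 0 < c -> \forall n \near \oo, 2 <= N n * c.
  move=> c0; near=> n; rewrite -ler_pdivrMr//.
  apply: (@le_trans _ _ n%:R); last by rewrite ler_nat.
  by near: n; exact: nbhs_infty_ger.
have Bn_cvg r : 0 < r < q -> B n r @[n --> \oo] --> G r.
  move=> /andP[r0 rq]; apply/cvgrPdist_le => eps eps0.
  have := cG r; move=> /cvgrPdist_le/(_ eps eps0) /nbhs_ballP[t /= t0 Ht].
  have r00 : 0 < r - 0 by rewrite subr0.
  have qr0 : 0 < q - r by rewrite subr_gt0.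
  have cvt : \forall n \near \oo, (N n)^-1 < t.
    exact: (cvgr_lt _ cvN).
  near=> n.
  have h1 : 2 <= N n * (r - 0) by near: n; exact: ev.
  have h2 : 2 <= N n * (q - r) by near: n; exact: ev.
  have h3 : (N n)^-1 < t by near: n.
  rewrite /B (plateau1 h1 h2).1 mul1r.
  have [c /andP[c1 c2] ->] := Gn_mean n r r0.
  apply: Ht; rewrite /ball/= ltr_norml.
  by move: ((N n)^-1) c2 h3 => u c2 h3; apply/andP; split; lra.
have mcell := @measurable_cell R L e ce.
have mxi : measurable_fun (cell L e : set (mR * mR)) (fun p : R * R => xi p.1 p.2).
  by apply/measurable_EFinP; exact: (measurable_int leb2).
have cpsi : ctsC L e psi by move=> p /closed_cell_fluid /psiC; exact: C1_at_cts.
have cT : ctsC L e (rtransport psi h).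
  by move=> p /closed_cell_fluid pF; exact: rtransport_cts (psiC pF) (hC _ pF).
have [MT MT0 HMT] := ctsC_bound ce cT.
have cw (u : R -> R) : (forall r, {for r, continuous u}) ->
    ctsC L e (fun x y => u (psi x y) * rtransport psi h x y).
  move=> cu p pc; apply: cts2M (cT p pc); apply: cts2_comp (cpsi p pc); exact: cu.
rewrite /area_int.
apply: (@Rintegral_cvg_dominated R _ _ leb2 (cell L e)
  (fun n p => xi p.1 p.2 * (B n (psi p.1 p.2) * rtransport psi h p.1 p.2)) _
  (fun p => (MG * MT) * `|xi p.1 p.2|)).
- exact: mcell.
- move=> n; apply: measurable_funM => //.
  have cB : forall r : R, {for r, continuous (B n)} := fun r => is_derive_continuous (DB n r).
  exact: (ctsC_measurable ce (cw (B n) cB)).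
- by apply: measurable_funM => //; exact: (ctsC_measurable ce (cw G cG)).
- move=> [x y] xy; have pi := psi_open (cell_open_fluid xy).
  apply: cvgM; first exact: cvg_cst.
  by apply: cvgM; [exact: Bn_cvg|exact: cvg_cst].
- have hh := @integrableZl _ _ _ leb2 _ mcell (MG * MT) _ (integrable_abse ixi).
  exact: hh.
- move=> [x y] n xy; rewrite normrM mulrC ler_wpM2r//= normrM.
  apply: ler_pM => //; first by apply: Bn_bound; exact: psi_open (cell_open_fluid xy).
  by apply: HMT; exact: cell_sub.
- move=> n; exact: (kernel_C1_weight (NV n) (DB n) (cdB n) (suppB n) hC hL).
Unshelve. all: by end_near. Qed.

End StreamKernel.

(** * The steady wave *)

Section Periodicity.
Context {R : realType}.

Lemma derive1_periodic (u : R -> R) (L x : R) :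
  (forall s, u (s + L) = u s) -> derive1 u (x + L) = derive1 u x.
Proof.
move=> uL; rewrite /derive1.
have -> // : (fun h : R => h^-1 *: (u (h + (x + L)) - u (x + L))) =
  (fun h => h^-1 *: (u (h + x) - u x)).
by apply/funext => h; rewrite addrA !uL.
Qed.

Lemma rdx_periodic (f : R -> R -> R) (L x y : R) :
  (forall x y, f (x + L) y = f x y) -> rdx f (x + L) y = rdx f x y.
Proof. by move=> fL; rewrite /rdx; apply: derive1_periodic => s; exact: fL. Qed.

Lemma rdy_periodic (f : R -> R -> R) (L x y : R) :
  (forall x y, f (x + L) y = f x y) -> rdy f (x + L) y = rdy f x y.
Proof.
by move=> fL; rewrite /rdy; congr (derive1 _ _); apply/funext => s; exact: fL.
Qed.

(** Carries the equations posed in the open cell to the surface and the bed, where they are combined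
    with the boundary conditions. *)
Lemma cts2_closure_eq (D : set (R * R)) (f g : R -> R -> R) (p : R * R) :
  (forall A, nbhs p A -> exists q, D q /\ A q) -> cts2 f p -> cts2 g p ->
  (forall q, D q -> f q.1 q.2 = g q.1 q.2) -> f p.1 p.2 = g p.1 p.2.
Proof.
move=> cD cf cg fg; apply/eqP; rewrite -subr_eq0; apply/negPn/negP => n0.
have c0 := cts2B cf cg.
have e0 : 0 < `|f p.1 p.2 - g p.1 p.2| by rewrite normr_gt0.
move/cvgrPdist_lt/(_ _ e0) : c0 => H.
have [q [Dq /=]] := cD _ H.
by rewrite (fg q Dq) subrr subr0 ltxx.
Qed.

Lemma constant_of_derive0 (I : set R) (F : R -> R) : is_interval I ->
  (forall t : R, I t -> is_derive t 1 F 0) -> forall s t, I s -> I t -> F s = F t.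
Proof.
move=> hI dF.
suff main s t : s < t -> I s -> I t -> F s = F t.
  move=> s t Is It; case: (ltgtP s t) => [st|ts|->//]; first exact: main.
  by apply/esym; exact: main.
move=> st Is It.
have D c : c \in `[s, t] -> is_derive c 1 F ((fun=> 0) c).
  by rewrite in_itv/= => /andP[sc ct]; apply: dF; apply: (hI s t Is It); rewrite sc ct.
have [c _] := MVT_closed st D.
by rewrite mul0r => /eqP; rewrite subr_eq0 => /eqP ->.
Qed.

(* Precomposition with clamp extends gamma' from [0, |p0|] to a continuous
   function on the line. *)
Definition clamp (q s : R) : R := Num.max 0 (Num.min s q).

Lemma clamp_cts (q s : R) : {for s, continuous (clamp q)}.
Proof.
have cc (c : R) : {for s, continuous (fun _ : R => c)} by exact: cvg_cst.
have cid : {for s, continuous (fun v : R => v)} by exact: cvg_id.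
exact: (continuous_max (cc 0) (continuous_min cid (cc q))).
Qed.

Lemma clamp_in (q s : R) : 0 <= q -> 0 <= clamp q s <= q.
Proof.
by move=> q0; rewrite /clamp le_max lexx/= ge_max q0/= ge_min lexx orbT.
Qed.

Lemma clamp_id (q s : R) : 0 <= s <= q -> clamp q s = s.
Proof. by move=> /andP[s0 sq]; rewrite /clamp min_l// max_r. Qed.

End Periodicity.

Section Steady.
Context {R : realType}.
Variables (g alpha p0 beta B : R) (gamma etae : R -> R) (psie Pe : R -> R -> R).
Hypothesis hs : steady_wave g alpha p0 beta B gamma etae psie.
Hypothesis hp : steady_pressure g etae psie Pe.

Notation L := (period alpha).
Notation e := etae.
Notation de := (derive1 etae).

Lemma period_gt0 : 0 < L.
Proof. by rewrite /period divr_gt0 ?(sw_alpha hs)// mulr_gt0// pi_gt0. Qed.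

Lemma is_derive_etae (x : R) : is_derive x 1 e (de x).
Proof. by apply: is_derive_derive1; exact: (sw_eta_reg hs).1. Qed.

Lemma etae_cts (x : R) : {for x, continuous e}.
Proof. exact: is_derive_continuous (is_derive_etae x). Qed.

Lemma is_derive_detae (x : R) : is_derive x 1 de (derive1 de x).
Proof. by apply: is_derive_derive1; exact: (sw_eta_reg hs).2.1. Qed.

Lemma detae_cts (x : R) : {for x, continuous de}.
Proof. exact: is_derive_continuous (is_derive_detae x). Qed.

Lemma d2etae_cts (x : R) : {for x, continuous (derive1 de)}.
Proof. exact: (sw_eta_reg hs).2.2. Qed.

Lemma detae_periodic (x : R) : de (x + L) = de x.
Proof. by apply: derive1_periodic => s; exact: (sw_eta_per hs). Qed.

Lemma at_end (T : Type) (f : R -> T) : (forall x, f (x + L) = f x) -> f L = f 0.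
Proof. by move=> fL; rewrite -[in LHS](add0r L) fL. Qed.

Lemma etae_end : e L = e 0.
Proof. by apply: at_end => x; exact: (sw_eta_per hs). Qed.

Lemma abs_p0 : `|p0| = - p0.
Proof. by rewrite ltr0_norm// (sw_p0 hs). Qed.

Lemma psieC p : closed_fluid e p -> C1_at psie p.
Proof. by case: (sw_psi_reg hs) => h _ _; exact: h. Qed.

Lemma psiexC p : closed_fluid e p -> C1_at (rdx psie) p.
Proof. by case: (sw_psi_reg hs) => _ h _; exact: h. Qed.

Lemma psieyC p : closed_fluid e p -> C1_at (rdy psie) p.
Proof. by case: (sw_psi_reg hs) => _ _ h; exact: h. Qed.

Lemma surface_fluid x : closed_fluid e (x, e x).
Proof. by split => //=; rewrite ltW// (sw_eta_pos hs). Qed.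

Lemma bed_fluid x : closed_fluid e (x, 0).
Proof. by split => //=; rewrite ltW// (sw_eta_pos hs). Qed.

Lemma psie_in x y : closed_fluid e (x, y) -> 0 <= psie x y <= `|p0|.
Proof.
rewrite abs_p0.
exact: (psi_range (sw_eta_pos hs) psieC (sw_surface hs) (sw_bed hs) (sw_no_stagnation hs)).
Qed.

Lemma closure_surface x : 0 < x < L ->
  forall A, nbhs (x, e x) A -> exists q, cell L e q /\ A q.
Proof.
move=> /andP[x0 xL] A /nbhs_box[d d0 Hd].
have ex := sw_eta_pos hs x.
have m0 : 0 < Num.min d (e x) by rewrite lt_min d0 ex.
have md : Num.min d (e x) <= d by rewrite ge_min lexx.
have me : Num.min d (e x) <= e x by rewrite ge_min lexx orbT.
move: (Num.min d (e x)) m0 md me => m m0 md me.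
exists (x, e x - m / 2); split.
  by split => //; split => //; split => /=; lra.
apply: Hd; first by rewrite subrr normr0.
by rewrite ltr_norml; apply/andP; split; lra.
Qed.

Lemma closure_bed x : 0 < x < L ->
  forall A, nbhs (x, 0) A -> exists q, cell L e q /\ A q.
Proof.
move=> /andP[x0 xL] A /nbhs_box[d d0 Hd].
have ex := sw_eta_pos hs x.
have m0 : 0 < Num.min d (e x) by rewrite lt_min d0 ex.
have md : Num.min d (e x) <= d by rewrite ge_min lexx.
have me : Num.min d (e x) <= e x by rewrite ge_min lexx orbT.
move: (Num.min d (e x)) m0 md me => m m0 md me.
exists (x, m / 2); split.
  by split => //; split => //; split => /=; lra.
apply: Hd; first by rewrite subrr normr0.
by rewrite subr0 ltr_norml; apply/andP; split; lra.
Qed.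

Lemma psie_mixed p : closed_fluid e p ->
  rdx (rdy psie) p.1 p.2 = rdy (rdx psie) p.1 p.2.
Proof. by move=> pF; exact: mixed_partials (psieC pF) (psiexC pF) (psieyC pF). Qed.

Lemma psiex_surface x : rdx psie x (e x) = - (de x * rdy psie x (e x)).
Proof.
have D := is_derive_curve (psieC (surface_fluid x)) (is_derive_etae x).
have E : (fun x => psie x (e x)) = cst 0 by apply/funext => s; rewrite (sw_surface hs).
rewrite E in D; have := is_derive_derive1E D.
rewrite (is_derive_derive1E (is_derive_cst (0 : R) x 1)).
by move=> /eqP; rewrite eq_sym addr_eq0 => /eqP.
Qed.

Lemma psiex_bed x : rdx psie x 0 = 0.
Proof.
have E : (fun s => psie s 0) = cst (- p0) by apply/funext => s; rewrite (sw_bed hs).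
by rewrite /rdx E; exact: is_derive_derive1E (is_derive_cst _ x 1).
Qed.

Lemma vorticity_surface x : 0 < x < L ->
  rdx (rdx psie) x (e x) + rdy (rdy psie) x (e x) = - gamma 0.
Proof.
move=> xi; have pF := surface_fluid x.
have [_ _ cxx _] := C1_atP (psiexC pF); have [_ _ _ cyy] := C1_atP (psieyC pF).
have cg : cts2 (fun x y => - gamma (psie x y)) (x, e x).
  apply: cts2N; apply: cts2_comp (C1_at_cts (psieC pF)).
  rewrite /= (sw_surface hs).
  have h0 : 0 \in `[0, `|p0|] by rewrite in_itv/= lexx/=.
  exact: is_derive_continuous (is_derive_derive1 ((sw_gamma hs).1 0 h0)).
have := cts2_closure_eq (closure_surface xi) (cts2D cxx cyy) cg.
rewrite /= (sw_surface hs); apply => -[a b] ab /=.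
by rewrite -(sw_vorticity hs) ?opprK//; case: ab => _ [].
Qed.

Lemma half_gradsq_dy p : closed_fluid e p -> rdy (half_gradsq_steady psie) p.1 p.2 =
  rdx psie p.1 p.2 * rdy (rdx psie) p.1 p.2 + rdy psie p.1 p.2 * rdy (rdy psie) p.1 p.2.
Proof.
case: p => x y pF.
have Dx := C1_at_dy (psiexC pF); have Dy := C1_at_dy (psieyC pF).
have D := is_deriveM' (is_derive_cst (2^-1 : R) y 1)
  (is_deriveD' (is_deriveM' Dx Dx) (is_deriveM' Dy Dy)).
have -> : rdy (half_gradsq_steady psie) (x, y).1 (x, y).2 = derive1 (fun s =>
   cst (2^-1) s * (rdx psie x s * rdx psie x s + rdy psie x s * rdy psie x s)) y by [].
rewrite (is_derive_derive1E D) /=.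
move: (rdx psie x y) (rdy (rdx psie) x y) (rdy psie x y) (rdy (rdy psie) x y).
by move=> a b c d; field.
Qed.

(** The vertical momentum equation gives [P_ey + g], and the surface vorticity eliminates [psi_exx].
    The identity expresses the coefficient of the squared [eta] in the energy through [P_ey], the
    coefficient in the dynamic condition. *)
Lemma pressure_gradient_surface x : 0 < x < L ->
  rdy Pe x (e x) + (rdy (half_gradsq_steady psie) x (e x) + g) =
  - (gamma 0 * rdy psie x (e x)).
Proof.
move=> xi; have pF := surface_fluid x.
have PC : C1_at Pe (x, e x) by exact: (sp_reg hp).
have [_ _ _ cPy] := C1_atP PC.
have [_ _ cxx cxy] := C1_atP (psiexC pF); have [_ _ _ cyy] := C1_atP (psieyC pF).
have cx := C1_at_cts (psiexC pF); have cy := C1_at_cts (psieyC pF).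
have cl := cts2D (cts2N (cts2M cy cxx)) (cts2M cx cxy).
have cr := cts2B (cts2N cPy) (cts2_cst g (x, e x)).
have E1 : - (rdy psie x (e x) * rdx (rdx psie) x (e x)) + rdx psie x (e x) * rdy (rdx psie) x (e x)
    = - rdy Pe x (e x) - g.
  apply: (cts2_closure_eq (closure_surface xi) cl cr) => -[a b] cq.
  exact: (sp_y hp (cell_open_fluid cq)).
have E2 := vorticity_surface xi.
have E3 := half_gradsq_dy pF; rewrite /= in E3; rewrite E3.
move: E1 E2; move: (rdy Pe x (e x)) (rdx (rdx psie) x (e x)) (rdy (rdx psie) x (e x))
  (rdy (rdy psie) x (e x)) (rdx psie x (e x)) (rdy psie x (e x)) (gamma 0).
move=> Py xx xy yy px py G E1 E2.
have -> : G = - (xx + yy) by rewrite E2 opprK.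
have -> : Py = - g - (- (py * xx) + px * xy) by rewrite E1; ring.
by ring.
Qed.

(** Constancy of [Pe] on the surface gives [P_ex = - eta_ex * P_ey]. With
    [psi_ex = - eta_ex * psi_ey] the horizontal momentum equation then becomes a statement on the
    tangential derivative of [psi_ey], as needed for the surface terms of the momentum. *)
Lemma surface_speed x : 0 < x < L ->
  rdy psie x (e x) * (rdx (rdy psie) x (e x) + de x * rdy (rdy psie) x (e x)) =
  de x * rdy Pe x (e x).
Proof.
move=> xi; have pF := surface_fluid x.
have PC : C1_at Pe (x, e x) by exact: (sp_reg hp).
have [_ _ cPx _] := C1_atP PC.
have [_ _ _ cxy] := C1_atP (psiexC pF); have [_ _ _ cyy] := C1_atP (psieyC pF).
have cx := C1_at_cts (psiexC pF); have cy := C1_at_cts (psieyC pF).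
have E1 : rdy psie x (e x) * rdy (rdx psie) x (e x) - rdx psie x (e x) * rdy (rdy psie) x (e x)
    = - rdx Pe x (e x).
  apply: (cts2_closure_eq (closure_surface xi) (cts2B (cts2M cy cxy) (cts2M cx cyy)) (cts2N cPx)).
  by move=> -[a b] cq; exact: (sp_x hp (cell_open_fluid cq)).
have D := is_derive_curve PC (is_derive_etae x).
have E : (fun x => Pe x (e x)) = cst (Pe 0 (e 0)) by apply/funext => s; exact: (sp_surface hp).
rewrite E in D; have E2 := is_derive_derive1E D.
rewrite (is_derive_derive1E (is_derive_cst _ x 1)) in E2.
have E3 := psie_mixed pF; rewrite /= in E3; rewrite E3.
rewrite (psiex_surface x) in E1.
move: E1 E2; move: (rdy Pe x (e x)) (rdx Pe x (e x)) (rdy (rdx psie) x (e x))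
  (rdy (rdy psie) x (e x)) (rdy psie x (e x)) (de x).
move=> Py Px xy yy py d E1 E2.
have -> : d * Py = - Px by apply/eqP; rewrite -addr_eq0 addrC -E2.
by rewrite -E1; ring.
Qed.

(** The Hoelder bound is a modulus of continuity: [d] solves [K' * d^beta = eps]. Passing to
    [K' = |K| + 1] keeps the divisor positive, as [K] may be zero or negative. *)
Lemma dgamma_cts (s : R) : {for s, continuous (fun s => derive1 gamma (clamp `|p0| s))}.
Proof.
have [_ [K HK]] := sw_gamma hs.
have [b0 b1] := andP (sw_beta hs).
have inC r : clamp `|p0| r \in `[0, `|p0|] by rewrite in_itv/=; exact: clamp_in.
apply/cvgrPdist_lt => eps eps0.
pose K' := `|K| + 1.
have K0 : 0 < K' by rewrite ltr_wpDl.
pose d := (eps / K') `^ (beta^-1).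
have d0 : 0 < d by rewrite powR_gt0// divr_gt0.
have := @clamp_cts R `|p0| s; move=> /cvgrPdist_lt/(_ d d0).
apply: filterS => r rd.
apply: le_lt_trans (HK _ _ (inC s) (inC r)) _.
apply: (@le_lt_trans _ _ (`|K| * `|clamp `|p0| s - clamp `|p0| r| `^ beta)).
  by rewrite ler_wpM2r ?powR_ge0// ler_norm.
have h : `|clamp `|p0| s - clamp `|p0| r| `^ beta <= eps / K'.
  have -> : eps / K' = d `^ beta.
    by rewrite /d -powRrM mulVf ?gt_eqF// powRr1// divr_ge0// ltW.
  by rewrite ge0_ler_powR ?nnegrE ?normr_ge0 ?ltW.
apply: (@le_lt_trans _ _ (`|K| * (eps / K'))); first by rewrite ler_wpM2l.
rewrite mulrA ltr_pdivrMr// mulrC ltr_pM2l// /K'.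
by rewrite ltrDl.
Qed.

End Steady.

(** * Real solutions *)

Section RealSolution.
Context {R : realType}.

Definition rdtau (e : R -> R) (f : R -> R -> R) (x y : R) : R :=
  rdx f x y + derive1 e x * rdy f x y.

Definition rdn (e : R -> R) (f : R -> R -> R) (x y : R) : R :=
  rdy f x y - derive1 e x * rdx f x y.

Definition dt (f : R -> R -> R -> R) (t x y : R) : R :=
  derive1 (fun s => f s x y) t.

Record real_solution (L : R) (gamma : R -> R) (e : R -> R)
    (psie Pe : R -> R -> R) (I : set R) (eta : R -> R -> R)
    (psi omega P : R -> R -> R -> R) : Prop := RealSolution {
  rs_eta : C1_on eta (I `*` [set: R]);
  rs_psi : C1_xy psi (I `*` closed_fluid e);
  rs_psix : C1_txy (fun t x y => rdx (psi t) x y) (I `*` closed_fluid e);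
  rs_psiy : C1_txy (fun t x y => rdy (psi t) x y) (I `*` closed_fluid e);
  rs_omega : C1_txy omega (I `*` closed_fluid e);
  rs_P : C1_xy P (I `*` closed_fluid e);
  rs_eta_per : forall t x, I t -> eta t (x + L) = eta t x;
  rs_psi_per : forall t x y, I t -> psi t (x + L) y = psi t x y;
  rs_omega_per : forall t x y, I t -> omega t (x + L) y = omega t x y;
  rs_P_per : forall t x y, I t -> P t (x + L) y = P t x y;
  rs_laplace : forall t x y, I t -> open_fluid e (x, y) ->
    omega t x y = - (rdx (rdx (psi t)) x y + rdy (rdy (psi t)) x y);
  rs_vorticity : forall t x y, I t -> cell L e (x, y) ->
    dt omega t x y + rtransport psie (omega t) x y
    = derive1 gamma (psie x y) * rtransport psie (psi t) x y;
  rs_euler : forall t x y, I t -> cell L e (x, y) ->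
    dt (fun s x y => rdy (psi s) x y) t x y
    + rtransport psie (rdy (psi t)) x y
    + rdy (rdx psie) x y * rdy (psi t) x y
    - rdy (rdy psie) x y * rdx (psi t) x y
    = - rdx (P t) x y;
  rs_kinematic : forall t x, I t -> 0 < x < L ->
    derive1 (fun s => eta s x) t
    + rdtau e (fun a b => rdy psie a b * eta t a) x (e x)
    + rdtau e (psi t) x (e x) = 0;
  rs_dynamic : forall t x, I t -> 0 < x < L ->
    P t x (e x) + rdy Pe x (e x) * eta t x = 0;
  rs_tangential : forall t x, I t -> 0 < x < L ->
    derive1 (fun s => rdn e (psi s) x (e x)) t
    + rdtau e (fun a b => rdy psie a b * rdn e (psi t) a b) x (e x)
    + gamma 0 * rdtau e (psi t) x (e x)
    + rdtau e (P t) x (e x) = 0;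
  rs_bed : forall t x, I t -> rdx (psi t) x 0 = 0
}.

Variables (g alpha p0 beta B : R) (gamma e : R -> R) (psie Pe : R -> R -> R).
Hypothesis hs : steady_wave g alpha p0 beta B gamma e psie.
Hypothesis hp : steady_pressure g e psie Pe.
Variable I : set R.
Hypothesis oI : open I.
Variables (eta : R -> R -> R) (psi omega P : R -> R -> R -> R).
Notation L := (period alpha).
Hypothesis sol : real_solution L gamma e psie Pe I eta psi omega P.

Notation de := (derive1 e).
Let e0 := sw_eta_pos hs.
Let L0 : 0 < L := period_gt0 hs.
Let cel : forall x : R, {for x, continuous e} := etae_cts hs.
Let fluidC (p : R * R) (pc : closed_cell L e p) : closed_fluid e p := closed_cell_fluid pc.

Lemma etaC t x : I t -> C1_at eta (t, x).
Proof. by move=> It; apply: (rs_eta sol); split. Qed.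

Lemma Dt_eta (t x : R) : I t -> is_derive t 1 (fun s => eta s x) (derive1 (fun s => eta s x) t).
Proof. by move=> It; exact: C1_at_dx (etaC x It). Qed.

Lemma Dx_eta t (x : R) : I t -> is_derive x 1 (eta t) (derive1 (eta t) x).
Proof. by move=> It; exact: C1_at_dy (etaC x It). Qed.

Lemma etaC_space t p : I t -> C1_at (fun a _ => eta t a) p.
Proof.
move=> It; apply: (@C1_atI _ _ (fun a _ => rdy eta t a) (fun _ _ => 0)).
apply: nbhs_forall => -[a b]; split.
- exact: Dx_eta.
- exact: is_derive_cst.
- have [_ _ _ c] := C1_atP (etaC a It).
  exact: (@cts2_fst _ (rdy eta t) (a, b) (cts2_slice c)).
- exact: cts2_cst.
Qed.

Lemma C1_xy_slice (f : R -> R -> R -> R) t p : C1_xy f (I `*` closed_fluid e) ->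
  I t -> closed_fluid e p -> C1_at (f t) p.
Proof.
move=> fC It pF; have := nbhs_cts (@slice_cvg _ t p) (fC (t, p) (conj It pF)).
apply: nbhsS => q [[dx dy] [_ cx cy]]; split.
- exact: dx.
- exact: dy.
- exact: (@cts3_slice _ (fun t => rdx (f t)) t q cx).
- exact: (@cts3_slice _ (fun t => rdy (f t)) t q cy).
Qed.

Lemma psiC t p : I t -> closed_fluid e p -> C1_at (psi t) p.
Proof. exact: C1_xy_slice (rs_psi sol). Qed.

Lemma PC t p : I t -> closed_fluid e p -> C1_at (P t) p.
Proof. exact: C1_xy_slice (rs_P sol). Qed.

Lemma psixC t p : I t -> closed_fluid e p -> C1_at (rdx (psi t)) p.
Proof. by move=> It pF; exact: C1t_at_slice (rs_psix sol (conj It pF : (I `*` closed_fluid e) (t, p))). Qed.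

Lemma psiyC t p : I t -> closed_fluid e p -> C1_at (rdy (psi t)) p.
Proof. by move=> It pF; exact: C1t_at_slice (rs_psiy sol (conj It pF : (I `*` closed_fluid e) (t, p))). Qed.

Lemma omegaC t p : I t -> closed_fluid e p -> C1_at (omega t) p.
Proof. by move=> It pF; exact: C1t_at_slice (rs_omega sol (conj It pF : (I `*` closed_fluid e) (t, p))). Qed.

Lemma C1_txy_tC1 (f : R -> R -> R -> R) : C1_txy f (I `*` closed_fluid e) ->
  tC1 I (closed_cell L e) (fun t p => f t p.1 p.2) (fun t p => dt f t p.1 p.2).
Proof.
move=> fC t [x y] It /fluidC pF.
have fCt := fC (t, (x, y)) (conj It pF); have [D c] := C1t_at_dt fCt.
by split; [exact: D|exact: C1t_at_cts fCt|exact: c].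
Qed.

Definition psixt := dt (fun t x y => rdx (psi t) x y).
Definition psiyt := dt (fun t x y => rdy (psi t) x y).
Definition omegat := dt omega.

Lemma tC1_psix : tC1 I (closed_cell L e) (fun t p => rdx (psi t) p.1 p.2)
  (fun t p => psixt t p.1 p.2).
Proof. exact: C1_txy_tC1 (rs_psix sol). Qed.

Lemma tC1_psiy : tC1 I (closed_cell L e) (fun t p => rdy (psi t) p.1 p.2)
  (fun t p => psiyt t p.1 p.2).
Proof. exact: C1_txy_tC1 (rs_psiy sol). Qed.

Lemma tC1_omega : tC1 I (closed_cell L e) (fun t p => omega t p.1 p.2)
  (fun t p => omegat t p.1 p.2).
Proof. exact: C1_txy_tC1 (rs_omega sol). Qed.

Notation segL := [set x : R | 0 <= x <= L].

Lemma tC1_eta : tC1 I segL eta (fun t x => derive1 (fun s => eta s x) t).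
Proof.
move=> t x It xi; have [_ _ ct _] := C1_atP (etaC x It).
by split; [exact: Dt_eta|exact: C1_at_cts (etaC x It)|exact: ct].
Qed.

Lemma tC1_surface (f ft : R -> R * R -> R) : tC1 I (closed_cell L e) f ft ->
  tC1 I segL (fun t x => f t (x, e x)) (fun t x => ft t (x, e x)).
Proof.
apply: tC1_comp => x xi.
  by split => //=; rewrite lexx andbT ltW.
exact: (cvg_pairR cvg_id (@cel x)).
Qed.

Lemma tC1_bed (f ft : R -> R * R -> R) : tC1 I (closed_cell L e) f ft ->
  tC1 I segL (fun t x => f t (x, 0)) (fun t x => ft t (x, 0)).
Proof.
apply: tC1_comp => x xi.
  by split => //=; rewrite lexx/= ltW.
exact: (cvg_pairR cvg_id (cvg_cst (0 : R))).
Qed.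

Definition surfN t x := rdn e (psi t) x (e x).
Definition surfNt t x := psiyt t x (e x) - de x * psixt t x (e x).
Definition surfV x := rdy psie x (e x).
Definition etat t x := derive1 (fun s => eta s x) t.
(** Density of the momentum. The kinematic condition says that [eta_t] is minus its [x]-derivative,
    which also makes it the natural variable in the surface energy balance. *)
Definition surf_phi t x := psi t x (e x) + surfV x * eta t x.

Lemma tC1_surfN : tC1 I segL surfN surfNt.
Proof.
have c x : segL x -> {for x, continuous (fun x => - de x)}.
  by move=> _; apply: continuousN; exact: (detae_cts hs).
have := tC1D (tC1_surface tC1_psiy) (tC1Z c (tC1_surface tC1_psix)).
congr tC1; apply/funext => t; apply/funext => x;
  by rewrite /surfN /surfNt /rdn mulNr.
Qed.

Lemma derive1_surfN t x : I t -> segL x -> derive1 (surfN ^~ x) t = surfNt t x.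
Proof. by move=> It xi; have [D _ _] := tC1_surfN It xi; exact: is_derive_derive1E D. Qed.

Lemma surfV_cts x : {for x, continuous surfV}.
Proof.
exact: (cts2_curve (C1_at_cts (psieyC hs (surface_fluid hs x))) (@cel x)).
Qed.

Lemma is_derive_surface (f : R -> R -> R) (x : R) : C1_at f (x, e x) ->
  is_derive x 1 (fun x => f x (e x)) (rdtau e f x (e x)).
Proof. by move=> fC; exact: is_derive_curve fC (is_derive_etae hs x). Qed.

Lemma rdtau_cts (f : R -> R -> R) x : C1_at f (x, e x) ->
  {for x, continuous (fun x => rdtau e f x (e x))}.
Proof.
move=> /C1_atP[_ _ fx fy]; apply: continuousD.
  exact: (cts2_curve fx (@cel x)).
by apply: continuousM; [exact: (detae_cts hs)|exact: (cts2_curve fy (@cel x))].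
Qed.

(** The normal direction is extended into the fluid independently of [y]; differentiating in [x]
    brings in the second derivative of [e], which is continuous by [sw_eta_reg]. *)
Lemma rdnC t p : I t -> closed_fluid e p -> C1_at (rdn e (psi t)) p.
Proof.
move=> It pF; apply: C1_atB; first exact: psiyC.
apply: C1_atM (psixC It pF).
apply: (@C1_atI _ _ (fun x _ => derive1 de x) (fun _ _ => 0)).
apply: nbhs_forall => q; split.
- exact: (is_derive_detae hs).
- exact: is_derive_cst.
- exact: cts2_fst (@d2etae_cts _ _ _ _ _ _ _ _ _ hs q.1).
- exact: cts2_cst.
Qed.

Lemma surfVeta_C1 t x : I t -> C1_at (fun a b => rdy psie a b * eta t a) (x, e x).
Proof.
by move=> It; exact: C1_atM (psieyC hs (surface_fluid hs x)) (etaC_space _ It).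
Qed.

Lemma surfVN_C1 t x : I t -> C1_at (fun a b => rdy psie a b * rdn e (psi t) a b) (x, e x).
Proof.
move=> It; have pF := surface_fluid hs x.
exact: C1_atM (psieyC hs pF) (rdnC It pF).
Qed.

Definition surf_dphi t x :=
  rdtau e (psi t) x (e x) + rdtau e (fun a b => rdy psie a b * eta t a) x (e x).

Lemma is_derive_surf_phi t (x : R) : I t -> is_derive x 1 (surf_phi t) (surf_dphi t x).
Proof.
move=> It; have pF := surface_fluid hs x.
exact: is_deriveD' (is_derive_surface (psiC It pF)) (is_derive_surface (surfVeta_C1 x It)).
Qed.

Lemma surf_dphi_cts t x : I t -> {for x, continuous (surf_dphi t)}.
Proof.
move=> It; have pF := surface_fluid hs x.
exact: continuousD (rdtau_cts (psiC It pF)) (rdtau_cts (surfVeta_C1 x It)).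
Qed.

Lemma kinematic_surf_phi t x : I t -> 0 < x < L -> etat t x = - surf_dphi t x.
Proof.
move=> It xi; have := rs_kinematic sol It xi.
rewrite /etat /surf_dphi; move: (derive1 _ t) (rdtau _ _ _ _) (rdtau _ _ _ _) => a b c E.
by apply/eqP; rewrite -addr_eq0 addrCA addrC -[X in _ == X]E; apply/eqP; ring.
Qed.

Lemma psiey_per x y : rdy psie (x + L) y = rdy psie x y.
Proof. by apply: rdy_periodic => a b; exact: (sw_psi_per hs). Qed.

Lemma psiy_per t x y : I t -> rdy (psi t) (x + L) y = rdy (psi t) x y.
Proof. by move=> It; apply: rdy_periodic => a b; exact: (rs_psi_per sol). Qed.

Lemma psix_per t x y : I t -> rdx (psi t) (x + L) y = rdx (psi t) x y.
Proof. by move=> It; apply: rdx_periodic => a b; exact: (rs_psi_per sol). Qed.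

Lemma surfV_per x : surfV (x + L) = surfV x.
Proof.
by rewrite /surfV (sw_eta_per hs) psiey_per.
Qed.

Lemma psi_surface_per t x : I t -> psi t (x + L) (e (x + L)) = psi t x (e x).
Proof. by move=> It; rewrite (sw_eta_per hs) (rs_psi_per sol). Qed.

Lemma surf_phi_per t x : I t -> surf_phi t (x + L) = surf_phi t x.
Proof.
by move=> It; rewrite /surf_phi psi_surface_per// surfV_per (rs_eta_per sol).
Qed.

Lemma surfN_per t x : I t -> surfN t (x + L) = surfN t x.
Proof.
move=> It; rewrite /surfN /rdn (sw_eta_per hs) (detae_periodic hs).
by rewrite (psiy_per _ _ It) (psix_per _ _ It).
Qed.

Lemma surf_phi_end t : I t -> surf_phi t L = surf_phi t 0.
Proof. by move=> It; apply: at_end => x; exact: surf_phi_per. Qed.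

Lemma mass_rate t : I t -> is_derive t 1 (fun t => line_int 0 L (eta t)) 0.
Proof.
move=> It; have D := line_int_tC1 oI tC1_eta It.
apply: is_derive_eq D _.
rewrite (@eq_line_int _ _ _ _ (fun x => - surf_dphi t x)); last first.
  by move=> x xi; exact: kinematic_surf_phi.
transitivity (- surf_phi t L - - surf_phi t 0).
  apply: (@line_int_FTC _ 0 L (fun x => - surf_phi t x) (fun x => - surf_dphi t x) L0).
    by move=> x _; exact: is_deriveN' (is_derive_surf_phi x It).
  by move=> x _; apply: continuousN; exact: surf_dphi_cts.
by rewrite (surf_phi_end It) subrr.
Qed.

Definition surfP t x := P t x (e x).
Definition Omega := gamma 0.
Definition surf_coef x := rdy (half_gradsq_steady psie) x (e x) + g.

Lemma surfP_per t x : I t -> surfP t (x + L) = surfP t x.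
Proof. by move=> It; rewrite /surfP (sw_eta_per hs) (rs_P_per sol). Qed.

Lemma surf_coef_cts (x : R) : {for x, continuous surf_coef}.
Proof.
have pF := surface_fluid hs x.
have [_ _ _ cxy] := C1_atP (psiexC hs pF); have [_ _ _ cyy] := C1_atP (psieyC hs pF).
have cx := C1_at_cts (psiexC hs pF); have cy := C1_at_cts (psieyC hs pF).
have h := cts2_curve (cts2D (cts2M cx cxy) (cts2M cy cyy)) (@cel x).
have E : surf_coef = (fun x => rdx psie x (e x) * rdy (rdx psie) x (e x) +
    rdy psie x (e x) * rdy (rdy psie) x (e x) + g).
  by apply/funext => s; rewrite /surf_coef (half_gradsq_dy hs (surface_fluid hs s)).
by rewrite E; apply: continuousD; [exact: h|exact: cvg_cst].
Qed.

Lemma bed_constant t x : I t -> psi t x 0 = psi t 0 0.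
Proof.
move=> It.
have D (s : R) : setT s -> is_derive s 1 (fun s => psi t s 0) 0.
  by move=> _; have := C1_at_dx (psiC It (bed_fluid hs s)); rewrite (rs_bed sol s It).
have hT : is_interval (setT : set R) by [].
exact: (constant_of_derive0 hT D).
Qed.

(** On the bed [psi_ex] and [psi_x] vanish, and the limit of the horizontal Euler equation reads
    [psi_yt = - d/dx (psi_ey * psi_y + P)], the derivative of a periodic function. *)
Lemma bed_circulation t : I t -> line_int 0 L (fun x => psiyt t x 0) = 0.
Proof.
move=> It.
have F x : closed_fluid e (x, 0) := bed_fluid hs x.
pose W x y := rdy psie x y * rdy (psi t) x y + P t x y.
have WC x : C1_at W (x, 0).
  exact: C1_atD (C1_atM (psieyC hs (F x)) (psiyC It (F x))) (PC It (F x)).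
rewrite (@eq_line_int _ _ _ _ (fun x => - rdx W x 0)); last first.
  move=> x xi.
  have xc : closed_cell L e (x, 0).
    by case/andP: xi => x0 xL; split; rewrite /= ?lexx/= ltW// ltW.
  have [_ _ cut] := tC1_psiy It xc.
  have cpt : cts2 (psiyt t) (x, 0).
    have [_] := tC1_slice tC1_psiy It xc.
    by congr (prop_for _ _).
  have [_ _ cPx _] := C1_atP (PC It (F x)).
  have [_ _ cyx cyy] := C1_atP (psiyC It (F x)).
  have [_ _ _ exy] := C1_atP (psiexC hs (F x)); have [_ _ _ eyy] := C1_atP (psieyC hs (F x)).
  have ex := C1_at_cts (psiexC hs (F x)); have ey := C1_at_cts (psieyC hs (F x)).
  have cx := C1_at_cts (psixC It (F x)); have cy := C1_at_cts (psiyC It (F x)).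
  have cT := cts2B (cts2M ey cyx) (cts2M ex cyy).
  have E1 : psiyt t x 0 + (rdy psie x 0 * rdx (rdy (psi t)) x 0 - rdx psie x 0 * rdy (rdy (psi t)) x 0)
     + rdy (rdx psie) x 0 * rdy (psi t) x 0 - rdy (rdy psie) x 0 * rdx (psi t) x 0
     = - rdx (P t) x 0.
    apply: (cts2_closure_eq (closure_bed hs xi)
      (cts2B (cts2D (cts2D cpt cT) (cts2M exy cy)) (cts2M eyy cx)) (cts2N cPx)).
    by move=> -[a b] ab; exact: (rs_euler sol It ab).
  rewrite (psiex_bed hs) (rs_bed sol x It) in E1.
  have E2 : rdx W x 0 = rdx (rdy psie) x 0 * rdy (psi t) x 0 + rdy psie x 0 * rdx (rdy (psi t)) x 0 + rdx (P t) x 0.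
    exact: is_derive_derive1E (is_deriveD' (is_deriveM' (C1_at_dx (psieyC hs (F x)))
      (C1_at_dx (psiyC It (F x)))) (C1_at_dx (PC It (F x)))).
  have E3 := psie_mixed hs (F x); rewrite /= in E3; rewrite E2 E3.
  move: E1; move: (psiyt t x 0) (rdy psie x 0) (rdx (rdy (psi t)) x 0) (rdy (rdy (psi t)) x 0)
    (rdy (rdx psie) x 0) (rdy (psi t) x 0) (rdy (rdy psie) x 0) (rdx (P t) x 0).
  move=> a b c d i j k l E; rewrite -[l]opprK -E; ring.
transitivity (- W L 0 - - W 0 0).
  apply: (@line_int_FTC _ 0 L (fun x => - W x 0) (fun x => - rdx W x 0) L0).
    by move=> x _; exact: is_deriveN' (C1_at_dx (WC x)).
  move=> x _; apply: continuousN; have [_ _ c _] := C1_atP (WC x).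
  have cc : {for x, continuous (fun _ : R => 0 : R)} by exact: cvg_cst.
  exact: (cts2_curve (c := fun _ => 0) c cc).
have -> : W L 0 = W 0 0.
  apply: (@at_end _ alpha _ (fun x => W x 0)) => x; rewrite /W.
  by rewrite psiey_per (psiy_per _ _ It) (rs_P_per sol).
by rewrite subrr.
Qed.

Lemma unit_integrable :
  leb2.-integrable (cell L e) (fun p : R * R => ((fun _ _ => 1 : R) p.1 p.2)%:E).
Proof. by apply: (ctsC_integrable L0 cel) => q _; exact: cts2_cst. Qed.

Lemma area_int_rate (f ft : R -> R * R -> R) t : tC1 I (closed_cell L e) f ft ->
  I t -> is_derive t 1 (fun t => area_int (cell L e) (fun x y => f t (x, y)))
    (area_int (cell L e) (fun x y => ft t (x, y))).
Proof.
move=> Hf It; have := area_int_tC1 oI cel Hf It unit_integrable.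
under eq_fun => s do under eq_fun => x do under eq_fun => y do rewrite mulr1.
by under [X in area_int _ X]eq_fun => x do under eq_fun => y do rewrite mulr1.
Qed.

(* Green's formula for psi t and psi s, differentiated in s at s = t. *)
Lemma kinetic_pairing t : I t ->
  area_int (cell L e) (fun x y => rdx (psi t) x y * psixt t x y + rdy (psi t) x y * psiyt t x y) =
  area_int (cell L e) (fun x y => psi t x y * omegat t x y)
  + line_int 0 L (fun x => psi t x (e x) * surfNt t x).
Proof.
move=> It.
have tpsi q : closed_cell L e q -> {for q, continuous (fun q : R * R => psi t q.1 q.2)}.
  by move=> /fluidC qF; exact: C1_at_cts (psiC It qF).
have tpsix q : closed_cell L e q -> {for q, continuous (fun q : R * R => rdx (psi t) q.1 q.2)}.
  by move=> /fluidC qF; exact: C1_at_cts (psixC It qF).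
have tpsiy q : closed_cell L e q -> {for q, continuous (fun q : R * R => rdy (psi t) q.1 q.2)}.
  by move=> /fluidC qF; exact: C1_at_cts (psiyC It qF).
have T1 := tC1D (tC1Z tpsix tC1_psix) (tC1Z tpsiy tC1_psiy).
have T2 := tC1Z tpsi tC1_omega.
have D1 := area_int_rate T1 It.
have D2 := area_int_rate T2 It.
have cs (x : R) : segL x -> {for x, continuous (fun x => psi t x (e x))}.
  by move=> _; exact: (cts2_curve (C1_at_cts (psiC It (surface_fluid hs x))) (@cel x)).
have D3 := line_int_tC1 oI (tC1Z cs tC1_surfN) It.
have D4 := line_int_tC1 oI (tC1_bed tC1_psiy) It.
(* The factor [psi t] is frozen and only the gradient and the vorticity at time [s] vary. So no time
   derivative of [psi], and no space derivative of [psixt] or [psiyt], is ever taken. *)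
have green s : I s ->
   area_int (cell L e) (fun x y => rdx (psi t) x y * rdx (psi s) x y + rdy (psi t) x y * rdy (psi s) x y)
   = area_int (cell L e) (fun x y => psi t x y * omega s x y)
   + line_int 0 L (fun x => psi t x (e x) * surfN s x)
   - psi t 0 0 * line_int 0 L (fun x => rdy (psi s) x 0).
  move=> Is.
  pose F1 x y := psi t x y * rdx (psi s) x y.
  pose F2 x y := psi t x y * rdy (psi s) x y.
  have F1C q : closed_cell L e q -> C1_at F1 q.
    by move=> /fluidC qF; exact: C1_atM (psiC It qF) (psixC Is qF).
  have F2C q : closed_cell L e q -> C1_at F2 q.
    by move=> /fluidC qF; exact: C1_atM (psiC It qF) (psiyC Is qF).
  have F1L y : 0 <= y <= e 0 -> F1 L y = F1 0 y.
    move=> _; apply: (@at_end _ alpha _ (fun x => F1 x y)) => x.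
    by rewrite /F1 (rs_psi_per sol)// (psix_per _ _ Is).
  have G := cell_divergence L0 e0 (is_derive_etae hs) (@detae_cts _ _ _ _ _ _ _ _ _ hs) F1C F2C (etae_end hs) F1L.
  have cN : ctsI 0 L (fun x => psi t x (e x) * surfN s x).
    move=> x xi; apply: continuousM; first exact: cs.
    exact: (tC1_slice tC1_surfN Is xi).1.
  have cb : ctsI 0 L (fun x => rdy (psi s) x 0).
    by move=> x xi; exact: (tC1_slice (tC1_bed tC1_psiy) Is xi).1.
  have cb' : ctsI 0 L (fun x => psi t 0 0 * rdy (psi s) x 0).
    by move=> x xi; apply: continuousM; [exact: cvg_cst|exact: cb].
  have {}G : area_int (cell L e) (fun x y => rdx F1 x y + rdy F2 x y) =
     line_int 0 L (fun x => psi t x (e x) * surfN s x) - psi t 0 0 * line_int 0 L (fun x => rdy (psi s) x 0).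
    rewrite G -(line_intZ _ cb) -(line_intB cN cb').
    apply: eq_line_int => x _; rewrite /F1 /F2 (bed_constant x It) /surfN /rdn.
    move: (psi t x (e x)) (rdy (psi s) x (e x)) (rdx (psi s) x (e x)) (rdy (psi s) x 0).
    by move=> a b c d; ring.
  have cS : ctsC L e (fun x y => rdx F1 x y + rdy F2 x y).
    by move=> q qc; have [_ _ c1 _] := C1_atP (F1C q qc); have [_ _ _ c2] := C1_atP (F2C q qc); exact: cts2D.
  have cO : ctsC L e (fun x y => psi t x y * omega s x y).
    by move=> q /fluidC qF; exact: cts2M (C1_at_cts (psiC It qF)) (C1_at_cts (omegaC Is qF)).
  rewrite -addrA -G addrC -(area_intD L0 cel cS cO).
  apply: eq_area_int => x y xy.
  have oF := cell_open_fluid xy; have qF := open_closed_fluid oF.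
  have E1 : rdx F1 x y = rdx (psi t) x y * rdx (psi s) x y + psi t x y * rdx (rdx (psi s)) x y.
    exact: is_derive_derive1E (is_deriveM' (C1_at_dx (psiC It qF)) (C1_at_dx (psixC Is qF))).
  have E2 : rdy F2 x y = rdy (psi t) x y * rdy (psi s) x y + psi t x y * rdy (rdy (psi s)) x y.
    exact: is_derive_derive1E (is_deriveM' (C1_at_dy (psiC It qF)) (C1_at_dy (psiyC Is qF))).
  rewrite E1 E2 (rs_laplace sol Is oF).
  move: (rdx (psi t) x y) (rdx (psi s) x y) (rdy (psi t) x y) (rdy (psi s) x y) (psi t x y)
    (rdx (rdx (psi s)) x y) (rdy (rdy (psi s)) x y).
  by move=> a b c d i j k; ring.
have D5 := is_deriveB' (is_deriveD' D2 D3) (is_deriveM' (is_derive_cst (psi t 0 0) t 1) D4).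
have nI : nbhs t I by exact: open_nbhs_nbhs.
have E := is_derive_derive1E (near_eq_is_derive (nbhsS green nI) D1).
have E' := is_derive_derive1E D5.
have main := etrans (esym E) E'.
rewrite main (bed_circulation It) !mulr0 mul0r addr0 subr0.
by [].
Qed.

Definition surf_energy t : R :=
  line_int 0 L (fun x => 2^-1 * surf_coef x * (eta t x * eta t x))
  + line_int 0 L (fun x => surfV x * (surfN t x * eta t x)).

Definition kinetic t : R := area_int (cell L e) (fun x y => 2^-1 *
  (rdx (psi t) x y * rdx (psi t) x y + rdy (psi t) x y * rdy (psi t) x y)).

Lemma surface_exchange t : I t ->
  line_int 0 L (fun x => psi t x (e x) * surfNt t x) +
  (line_int 0 L (fun x => 2^-1 * surf_coef x * (etat t x * eta t x + eta t x * etat t x))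
  + line_int 0 L (fun x => surfV x * (surfNt t x * eta t x + surfN t x * etat t x))) = 0.
Proof.
move=> It.
pose s x := psi t x (e x); pose ds x := rdtau e (psi t) x (e x).
pose w x := surfV x * surfN t x.
pose dw x := rdtau e (fun a b => rdy psie a b * rdn e (psi t) a b) x (e x).
pose dp x := rdtau e (P t) x (e x).
have F x : closed_fluid e (x, e x) := surface_fluid hs x.
have Ds (x : R) : is_derive x 1 s (ds x) by exact: is_derive_surface (psiC It (F x)).
have Dw (x : R) : is_derive x 1 w (dw x) by exact: is_derive_surface (surfVN_C1 x It).
have Dp (x : R) : is_derive x 1 (surfP t) (dp x) by exact: is_derive_surface (PC It (F x)).
have cds (x : R) : {for x, continuous ds} by exact: rdtau_cts (psiC It (F x)).
have cdw (x : R) : {for x, continuous dw} by exact: rdtau_cts (surfVN_C1 x It).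
have cdp (x : R) : {for x, continuous dp} by exact: rdtau_cts (PC It (F x)).
have cs (x : R) : {for x, continuous s} := is_derive_continuous (Ds x).
have cw (x : R) : {for x, continuous w} := is_derive_continuous (Dw x).
have cp (x : R) : {for x, continuous (surfP t)} := is_derive_continuous (Dp x).
have cphi (x : R) : {for x, continuous (surf_phi t)} := is_derive_continuous (is_derive_surf_phi x It).
have cdphi (x : R) : {for x, continuous (surf_dphi t)} := surf_dphi_cts It.
have ceta x : segL x -> {for x, continuous (eta t)} := fun xi => (tC1_slice tC1_eta It xi).1.
have cetat x : segL x -> {for x, continuous (etat t)} := fun xi => (tC1_slice tC1_eta It xi).2.
have cN x : segL x -> {for x, continuous (surfN t)} := fun xi => (tC1_slice tC1_surfN It xi).1.
have cNt x : segL x -> {for x, continuous (surfNt t)} := fun xi => (tC1_slice tC1_surfN It xi).2.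
have c1 : ctsI 0 L (fun x => psi t x (e x) * surfNt t x).
  by move=> x xi; exact: continuousM (@cs x) (cNt x xi).
have c2 : ctsI 0 L (fun x => 2^-1 * surf_coef x * (etat t x * eta t x + eta t x * etat t x)).
  move=> x xi; have c2 : {for x, continuous (fun _ : R => 2^-1 : R)} by exact: cvg_cst.
  exact: continuousM (continuousM c2 (@surf_coef_cts x)) (continuousD
    (continuousM (cetat x xi) (ceta x xi)) (continuousM (ceta x xi) (cetat x xi))).
have c3 : ctsI 0 L (fun x => surfV x * (surfNt t x * eta t x + surfN t x * etat t x)).
  move=> x xi; exact: continuousM (@surfV_cts x) (continuousD
    (continuousM (cNt x xi) (ceta x xi)) (continuousM (cN x xi) (cetat x xi))).
have c23 : ctsI 0 L (fun x => 2^-1 * surf_coef x * (etat t x * eta t x + eta t x * etat t x)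
   + surfV x * (surfNt t x * eta t x + surfN t x * etat t x)).
  by move=> x xi; exact: continuousD (c2 x xi) (c3 x xi).
rewrite -(line_intD c2 c3) -(line_intD c1 c23).
(* Write [phi] for [surf_phi], [w = V * N] and [p] for the surface pressure. The conditions give
   [eta_t = - phi'], [N_t = - (w' + Omega * s' + p')] and [p = - P_ey * eta], and the energy
   coefficient is [- Omega * V - P_ey]. The integrand becomes [- phi * (w' + p') - phi' * (w + p) +
   Omega * ((phi - s) * phi' - phi * s')], which is the derivative of [Q]. *)
pose Q x := Omega * (2^-1 * (surf_phi t x * surf_phi t x) - surf_phi t x * s x) - (surf_phi t x * w x + surf_phi t x * surfP t x).
pose dQ x := Omega * (2^-1 * (surf_dphi t x * surf_phi t x + surf_phi t x * surf_dphi t x) - (surf_dphi t x * s x + surf_phi t x * ds x))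
  - (surf_dphi t x * w x + surf_phi t x * dw x + (surf_dphi t x * surfP t x + surf_phi t x * dp x)).
rewrite (@eq_line_int _ _ _ _ dQ); last first.
  move=> x xi.
  have E1 : etat t x = - surf_dphi t x by exact: kinematic_surf_phi.
  have E2 : surfNt t x = - (dw x + Omega * ds x + dp x).
    have xi' : segL x by case/andP: xi => x0 xL; rewrite /= !ltW.
    have := rs_tangential sol It xi; rewrite -(derive1_surfN It xi').
    rewrite -/(dw x) -/(ds x) -/(dp x) -/Omega.
    have -> : derive1 (fun s => rdn e (psi s) x (e x)) t = derive1 (surfN^~ x) t by [].
    move: (derive1 (surfN^~ x) t) (dw x) (ds x) (dp x) => a b c d E.
    by apply/eqP; rewrite -addr_eq0 -[X in _ == X]E; apply/eqP; ring.
  have E3 : surfP t x = - (rdy Pe x (e x) * eta t x).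
    by apply/eqP; rewrite -addr_eq0 (rs_dynamic sol It xi).
  have E4 : surf_coef x = - (Omega * surfV x) - rdy Pe x (e x).
    by rewrite -(pressure_gradient_surface hs hp xi) addrC addrA addNr add0r.
  rewrite /dQ E1 E2 E3 E4 -/(s x) /w /surf_phi -/(s x).
  move: (s x) (ds x) (dw x) (dp x) (surfV x) (surfN t x) (eta t x) (surf_dphi t x) (rdy Pe x (e x)) Omega.
  by move=> a b c d i j k l m n; field.
transitivity (Q L - Q 0).
  apply: (line_int_FTC L0).
    move=> x _; have Dphi := is_derive_surf_phi x It.
    have := is_deriveB' (is_deriveM' (is_derive_cst Omega x 1) (is_deriveB'
      (is_deriveM' (is_derive_cst (2^-1 : R) x 1) (is_deriveM' Dphi Dphi)) (is_deriveM' Dphi (Ds x))))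
      (is_deriveD' (is_deriveM' Dphi (Dw x)) (is_deriveM' Dphi (Dp x))).
    move=> D; apply: is_derive_eq D _; rewrite /dQ /=.
    move: (surf_phi t x) (surf_dphi t x) (s x) (ds x) (w x) (dw x) (surfP t x) (dp x) Omega.
    by move=> a b c d i j k l m; ring.
  move=> x _.
  have cc (c : R) : {for x, continuous (fun _ : R => c)} by exact: cvg_cst.
  have A1 := continuousM (cdphi x) (cphi x).
  have A2 := continuousM (cphi x) (cdphi x).
  have A3 := continuousD (continuousM (cdphi x) (cs x)) (continuousM (cphi x) (cds x)).
  have A4 := continuousD (continuousM (cdphi x) (cw x)) (continuousM (cphi x) (cdw x)).
  have A5 := continuousD (continuousM (cdphi x) (cp x)) (continuousM (cphi x) (cdp x)).
  exact: continuousB (continuousM (cc Omega) (continuousB (continuousM (cc 2^-1) (continuousD A1 A2)) A3)) (continuousD A4 A5).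
have -> : Q L = Q 0; last by rewrite subrr.
apply: at_end => x.
by rewrite /Q /w /s surf_phi_per// psi_surface_per// surfV_per surfN_per// surfP_per.
Qed.

(** All surface contributions cancel by [surface_exchange]. What remains is the rate of the
    enstrophy when [gamma'] has no zero, and it vanishes when [omega] does. *)
Lemma energy_rate t : I t -> is_derive t 1 (fun t => kinetic t + surf_energy t)
  (area_int (cell L e) (fun x y => psi t x y * omegat t x y)).
Proof.
move=> It.
have chalf (U : topologicalType) (K : set U) : forall q : U, K q -> {for q, continuous (fun _ : U => 2^-1 : R)}.
  by move=> q _; exact: cvg_cst.
have D1 := area_int_rate (tC1Z (@chalf _ _) (tC1D (tC1M tC1_psix tC1_psix) (tC1M tC1_psiy tC1_psiy))) It.
have ccoef x : segL x -> {for x, continuous (fun x => 2^-1 * surf_coef x)}.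
  by move=> _; apply: continuousM; [exact: cvg_cst|exact: surf_coef_cts].
have cV x : segL x -> {for x, continuous surfV} by move=> _; exact: surfV_cts.
have D2 := line_int_tC1 oI (tC1Z ccoef (tC1M tC1_eta tC1_eta)) It.
have D3 := line_int_tC1 oI (tC1Z cV (tC1M tC1_surfN tC1_eta)) It.
have D := is_deriveD' D1 (is_deriveD' D2 D3).
apply: is_derive_eq D _.
have -> : area_int (cell L e) (fun x y => 2^-1 *
    (psixt t (x, y).1 (x, y).2 * rdx (psi t) (x, y).1 (x, y).2 +
     rdx (psi t) (x, y).1 (x, y).2 * psixt t (x, y).1 (x, y).2 +
     (psiyt t (x, y).1 (x, y).2 * rdy (psi t) (x, y).1 (x, y).2 +
      rdy (psi t) (x, y).1 (x, y).2 * psiyt t (x, y).1 (x, y).2))) =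
   area_int (cell L e) (fun x y => rdx (psi t) x y * psixt t x y + rdy (psi t) x y * psiyt t x y).
  apply: eq_area_int => x y _ /=.
  move: (rdx (psi t) x y) (psixt t x y) (rdy (psi t) x y) (psiyt t x y) => a b c d.
  by field.
rewrite (kinetic_pairing It) -addrA (surface_exchange It) addr0.
by [].
Qed.

Lemma stream_kernel_zero (xi : R -> R -> R) (G : R -> R) h :
  leb2.-integrable (cell L e) (fun p : R * R => (xi p.1 p.2)%:E) ->
  (forall phi, test_function (cell L e) phi ->
    area_int (cell L e) (fun x y => xi x y * rtransport psie phi x y) = 0) ->
  (forall r, {for r, continuous G}) ->
  (forall q, closed_fluid e q -> C1_at h q) ->
  (forall x y, h (x + L) y = h x y) ->
  area_int (cell L e) (fun x y => xi x y * (G (psie x y) * rtransport psie h x y)) = 0.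
Proof.
move=> ixi xik cG hC hL.
have psiL y : psie L y = psie 0 y.
  by apply: (@at_end _ alpha _ (fun x => psie x y)) => x; exact: (sw_psi_per hs).
have hL' y : 0 <= y <= e 0 -> h L y = h 0 y.
  by move=> _; apply: (@at_end _ alpha _ (fun x => h x y)).
have h1 := kernel_cts_weight e0 (is_derive_etae hs) (@detae_cts _ _ _ _ _ _ _ _ _ hs) (etae_end hs) (psieC hs).
have h2 := h1 _ (sw_surface hs) (sw_bed hs) (sw_no_stagnation hs) psiL.
exact: (h2 _ ixi xik _ _ cG hC hL').
Qed.

Lemma stream_mean_zero (G : R -> R) h : (forall r, {for r, continuous G}) ->
  (forall q, closed_fluid e q -> C1_at h q) ->
  (forall x y, h (x + L) y = h x y) ->
  area_int (cell L e) (fun x y => G (psie x y) * rtransport psie h x y) = 0.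
Proof.
move=> cG hC hL.
have uk := unit_kernel L0 e0 (is_derive_etae hs) (@detae_cts _ _ _ _ _ _ _ _ _ hs) (etae_end hs) (psieC hs) (psiexC hs) (psieyC hs).
have := stream_kernel_zero unit_integrable uk cG hC hL.
by under eq_fun => x do under eq_fun => y do rewrite mul1r.
Qed.

Definition dgam (s : R) : R := derive1 gamma (clamp `|p0| s).

Lemma dgam_psie x y : closed_fluid e (x, y) -> dgam (psie x y) = derive1 gamma (psie x y).
Proof. by move=> /(psie_in hs) h; rewrite /dgam clamp_id. Qed.

Lemma stream_weight_cts (G : R -> R) q : (forall r, {for r, continuous G}) ->
  closed_fluid e q -> cts2 (fun x y => G (psie x y)) q.
Proof. by move=> cG qF; apply: cts2_comp (C1_at_cts (psieC hs qF)); exact: cG. Qed.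

(** * The enstrophy term for a monotone vorticity function *)

Section Monotone.
Hypothesis gamma_n0 : forall s, s \in `[0, `|p0|] -> derive1 gamma s != 0.

Definition inv_dgam (s : R) : R := (dgam s)^-1.

Lemma dgam_n0 s : dgam s != 0.
Proof. by apply: gamma_n0; rewrite in_itv/=; exact: clamp_in. Qed.

Lemma inv_dgam_cts s : {for s, continuous inv_dgam}.
Proof. by apply: (cvgV (@dgam_n0 s)); exact: (@dgamma_cts _ _ _ _ _ _ _ _ _ hs s). Qed.

Definition enstrophy t : R := area_int (cell L e) (fun x y =>
  2^-1 * inv_dgam (psie x y) * (omega t x y * omega t x y)).

(** With [T] the transport operator, inserting [omega_t = gamma' * T psi - T omega] turns
    [psi * omega_t - omega * omega_t / gamma'] into [gamma' / 2 * T (psi^2) + 1 / (2 gamma') * T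
    (omega^2) - T (psi * omega)]: three transport terms weighted by functions of [psie], each of
    mean zero. *)
Lemma enstrophy_rate t : I t -> is_derive t 1 enstrophy
  (area_int (cell L e) (fun x y => psi t x y * omegat t x y)).
Proof.
move=> It.
have cw q : closed_cell L e q -> {for q, continuous (fun q : R * R => 2^-1 * inv_dgam (psie q.1 q.2))}.
  move=> /fluidC qF.
  exact: (cts2M (cts2_cst 2^-1 q) (stream_weight_cts inv_dgam_cts qF)).
have D := area_int_rate (tC1Z cw (tC1M tC1_omega tC1_omega)) It.
apply: is_derive_eq D _.
have cg := @dgamma_cts _ _ _ _ _ _ _ _ _ hs.
have c1 (r : R) : {for r, continuous (fun _ : R => 1 : R)} by exact: cvg_cst.
have pC := psiC It; have oC := omegaC It.
have pp x y : psi t (x + L) y = psi t x y by exact: (rs_psi_per sol).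
have op x y : omega t (x + L) y = omega t x y by exact: (rs_omega_per sol).
pose T := rtransport psie.
have Z1 := stream_mean_zero cg (fun q qF => C1_atM (pC q qF) (pC q qF)).
have Z2 := stream_mean_zero c1 (fun q qF => C1_atM (pC q qF) (oC q qF)).
have Z3 := stream_mean_zero inv_dgam_cts (fun q qF => C1_atM (oC q qF) (oC q qF)).
have {}Z1 := Z1 (fun x y => congr2 *%R (pp x y) (pp x y)).
have {}Z2 := Z2 (fun x y => congr2 *%R (pp x y) (op x y)).
have {}Z3 := Z3 (fun x y => congr2 *%R (op x y) (op x y)).
have cT h : (forall q, closed_fluid e q -> C1_at h q) -> forall q, closed_cell L e q ->
    cts2 (rtransport psie h) q.
  by move=> hC q /fluidC qF; exact: rtransport_cts (psieC hs qF) (hC q qF).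
have cZ (G : R -> R) h : (forall r, {for r, continuous G}) ->
    (forall q, closed_fluid e q -> C1_at h q) ->
    ctsC L e (fun x y => G (psie x y) * rtransport psie h x y).
  by move=> cG hC q qc; exact: cts2M (stream_weight_cts cG (fluidC qc)) (cT h hC q qc).
have k1 := cZ _ _ cg (fun q qF => C1_atM (pC q qF) (pC q qF)).
have k2 := cZ _ _ c1 (fun q qF => C1_atM (pC q qF) (oC q qF)).
have k3 := cZ _ _ inv_dgam_cts (fun q qF => C1_atM (oC q qF) (oC q qF)).
have kl : ctsC L e (fun x y => psi t x y * omegat t x y).
  move=> q qc; have [_ c2] := tC1_slice tC1_omega It qc.
  exact: cts2M (C1_at_cts (pC q (fluidC qc))) c2.
have kh : ctsC L e (fun x y => 2^-1 * (derive1 gamma (clamp `|p0| (psie x y)) * rtransport psie (fun x y => psi t x y * psi t x y) x y)).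
  by move=> q qc; exact: cts2M (cts2_cst 2^-1 q) (k1 q qc).
have kh3 : ctsC L e (fun x y => 2^-1 * (inv_dgam (psie x y) * rtransport psie (fun x y => omega t x y * omega t x y) x y)).
  by move=> q qc; exact: cts2M (cts2_cst 2^-1 q) (k3 q qc).
have ks : ctsC L e (fun x y => 2^-1 * (derive1 gamma (clamp `|p0| (psie x y)) * rtransport psie (fun x y => psi t x y * psi t x y) x y)
   + 2^-1 * (inv_dgam (psie x y) * rtransport psie (fun x y => omega t x y * omega t x y) x y)).
  by move=> q qc; exact: cts2D (kh q qc) (kh3 q qc).
have ks' : ctsC L e (fun x y => 2^-1 * (derive1 gamma (clamp `|p0| (psie x y)) * rtransport psie (fun x y => psi t x y * psi t x y) x y)
   + 2^-1 * (inv_dgam (psie x y) * rtransport psie (fun x y => omega t x y * omega t x y) x y)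
   - 1 * rtransport psie (fun x y => psi t x y * omega t x y) x y).
  by move=> q qc; exact: cts2B (ks q qc) (k2 q qc).
have Z : area_int (cell L e) (fun x y => 2^-1 * (derive1 gamma (clamp `|p0| (psie x y)) * rtransport psie (fun x y => psi t x y * psi t x y) x y)
   + 2^-1 * (inv_dgam (psie x y) * rtransport psie (fun x y => omega t x y * omega t x y) x y)
   - 1 * rtransport psie (fun x y => psi t x y * omega t x y) x y) = 0.
  rewrite (area_intB L0 cel ks k2) (area_intD L0 cel kh kh3) (area_intZ L0 cel _ k1) (area_intZ L0 cel _ k3).
  by rewrite Z1 Z2 Z3 !mulr0 addr0 subr0.
rewrite -[RHS]subr0 -Z -(area_intB L0 cel kl ks').
apply: eq_area_int => x y xy /=.
have oF := cell_open_fluid xy; have qF := open_closed_fluid oF.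
have E := rs_vorticity sol It xy.
rewrite -(dgam_psie qF) in E.
rewrite (rtransportM psie (pC _ qF) (pC _ qF)) (rtransportM psie (pC _ qF) (oC _ qF))
  (rtransportM psie (oC _ qF) (oC _ qF)).
rewrite -/(dgam (psie x y)) /omegat /inv_dgam.
have n0 := @dgam_n0 (psie x y).
have {}E : dt omega t x y = dgam (psie x y) * rtransport psie (psi t) x y - rtransport psie (omega t) x y.
  by rewrite -E addrK.
rewrite E.
move: n0; move: (dgam (psie x y)) (rtransport psie (psi t) x y) (rtransport psie (omega t) x y) (psi t x y) (omega t x y).
by move=> a b c d i n0; field.
Qed.

End Monotone.

(** The surface integral of [psi] is replaced by the cell integral of [psi_y], which has a time
    derivative by assumption while [psi] has none. The bed value separating the two is added back in
    [surface_stream_integral]. *)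
Lemma momentum_rate t : I t -> is_derive t 1
  (fun s => area_int (cell L e) (rdy (psi s)) + line_int 0 L (fun x => surfV x * eta s x)) 0.
Proof.
move=> It.
have cV x : segL x -> {for x, continuous surfV} by move=> _; exact: surfV_cts.
have D1 := area_int_rate tC1_psiy It.
have D2 := line_int_tC1 oI (tC1Z cV tC1_eta) It.
apply: is_derive_eq (is_deriveD' D1 D2) _.
(* Conservation form of the horizontal Euler equation: [F1] linearizes the flux [u^2 + P] and [F2]
   the flux [u v], where [u = psi_y] and [v = - psi_x], so [psi_yt] is minus the divergence of
   [(F1, F2)]. *)
pose F1 x y := 2 * (rdy psie x y * rdy (psi t) x y) + P t x y.
pose F2 x y := - (rdy psie x y * rdx (psi t) x y + rdx psie x y * rdy (psi t) x y).
have F1C q : closed_cell L e q -> C1_at F1 q.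
  move=> /fluidC qF; apply: C1_atD (PC It qF); apply: C1_atM (C1_at_cst 2 q) _.
  exact: C1_atM (psieyC hs qF) (psiyC It qF).
have F2C q : closed_cell L e q -> C1_at F2 q.
  move=> /fluidC qF; apply: C1_atN; apply: C1_atD.
    exact: C1_atM (psieyC hs qF) (psixC It qF).
  exact: C1_atM (psiexC hs qF) (psiyC It qF).
have F1L y : 0 <= y <= e 0 -> F1 L y = F1 0 y.
  move=> _; apply: (@at_end _ alpha _ (fun x => F1 x y)) => x.
  by rewrite /F1 psiey_per (psiy_per _ _ It) (rs_P_per sol).
have G := cell_divergence L0 e0 (is_derive_etae hs) (@detae_cts _ _ _ _ _ _ _ _ _ hs) F1C F2C (etae_end hs) F1L.
have cF : ctsC L e (fun x y => rdx F1 x y + rdy F2 x y).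
  by move=> q qc; have [_ _ c1 _] := C1_atP (F1C q qc); have [_ _ _ c2] := C1_atP (F2C q qc); exact: cts2D.
have -> : area_int (cell L e) (fun x y => psiyt t (x, y).1 (x, y).2) =
   - line_int 0 L (fun x => F2 x (e x) - de x * F1 x (e x) - F2 x 0).
  rewrite -G -mulN1r -(area_intZ L0 cel (-1) cF).
  apply: eq_area_int => x y xy /=.
  have oF := cell_open_fluid xy; have qF := open_closed_fluid oF.
  have E1 : rdx F1 x y = 0 * (rdy psie x y * rdy (psi t) x y) + 2 * (rdx (rdy psie) x y * rdy (psi t) x y
       + rdy psie x y * rdx (rdy (psi t)) x y) + rdx (P t) x y.
    exact: is_derive_derive1E (is_deriveD' (is_deriveM' (is_derive_cst (2 : R) x 1)
      (is_deriveM' (C1_at_dx (psieyC hs qF)) (C1_at_dx (psiyC It qF)))) (C1_at_dx (PC It qF))).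
  have E2 : rdy F2 x y = - (rdy (rdy psie) x y * rdx (psi t) x y + rdy psie x y * rdy (rdx (psi t)) x y
     + (rdy (rdx psie) x y * rdy (psi t) x y + rdx psie x y * rdy (rdy (psi t)) x y)).
    exact: is_derive_derive1E (is_deriveN' (is_deriveD'
      (is_deriveM' (C1_at_dy (psieyC hs qF)) (C1_at_dy (psixC It qF)))
      (is_deriveM' (C1_at_dy (psiexC hs qF)) (C1_at_dy (psiyC It qF))))).
  have E3 := psie_mixed hs qF; have E4 := mixed_partials (psiC It qF) (psixC It qF) (psiyC It qF).
  rewrite /= in E3 E4.
  have E5 := rs_euler sol It xy; rewrite /rtransport in E5.
  rewrite E1 E2 E3 -E4 /psiyt.
  move: E5; move: (dt (fun s x y => rdy (psi s) x y) t x y) (rdy psie x y) (rdx psie x y)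
    (rdy (rdx psie) x y) (rdy (rdy psie) x y) (rdx (psi t) x y) (rdy (psi t) x y)
    (rdx (rdy (psi t)) x y) (rdy (rdy (psi t)) x y) (rdx (P t) x y).
  move=> a b c d i j k l m n E5.
  have -> : n = - (a + (b * l - c * m) + d * k - i * j) by rewrite E5 opprK.
  by ring.
have DV (x : R) : is_derive x 1 surfV (rdtau e (rdy psie) x (e x)).
  exact: is_derive_surface (psieyC hs (surface_fluid hs x)).
pose w x := rdy psie x (e x) * eta t x.
pose dw x := rdtau e (fun a b => rdy psie a b * eta t a) x (e x).
have Dw (x : R) : is_derive x 1 w (dw x) by exact: is_derive_surface (surfVeta_C1 x It).
pose dV x := rdtau e (rdy psie) x (e x).
have cF2 (x : R) : {for x, continuous (fun x => F2 x (e x) - de x * F1 x (e x) - F2 x 0)}.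
  have s := surface_fluid hs x; have b := bed_fluid hs x.
  have c0 : {for x, continuous (fun _ : R => 0 : R)} by exact: cvg_cst.
  have cc (f : R -> R -> R) : cts2 f (x, e x) -> {for x, continuous (fun x => f x (e x))}.
    by move=> cf; exact: (cts2_curve cf (@cel x)).
  have cb (f : R -> R -> R) : cts2 f (x, 0) -> {for x, continuous (fun x => f x 0)}.
    by move=> cf; exact: (cts2_curve (c := fun _ => 0) cf c0).
  have cF1 q : closed_fluid e q -> cts2 F1 q.
    move=> qF; apply: cts2D (C1_at_cts (PC It qF)); apply: cts2M (cts2_cst 2 q) _.
    exact: cts2M (C1_at_cts (psieyC hs qF)) (C1_at_cts (psiyC It qF)).
  have cF2 q : closed_fluid e q -> cts2 F2 q.
    move=> qF; apply: cts2N; apply: cts2D.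
      exact: cts2M (C1_at_cts (psieyC hs qF)) (C1_at_cts (psixC It qF)).
    exact: cts2M (C1_at_cts (psiexC hs qF)) (C1_at_cts (psiyC It qF)).
  exact: continuousB (continuousB (cc _ (cF2 _ s)) (continuousM (@detae_cts _ _ _ _ _ _ _ _ _ hs x) (cc _ (cF1 _ s)))) (cb _ (cF2 _ b)).
have c1 : ctsI 0 L (fun x => F2 x (e x) - de x * F1 x (e x) - F2 x 0) by move=> x _; exact: cF2.
have c2 : ctsI 0 L (fun x => surfV x * etat t x).
  by move=> x xi; exact: continuousM (cV x xi) (tC1_slice tC1_eta It xi).2.
rewrite addrC -(line_intB c2 c1).
(* The bed flux vanishes, and the kinematic and dynamic conditions with [surface_speed] collapse the
   rest to minus the [x]-derivative of the periodic function [psi_ey^2 * eta]. *)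
rewrite (@eq_line_int _ _ _ _ (fun x => - (dV x * w x + surfV x * dw x))); last first.
  move=> x xi.
  have E1 := kinematic_surf_phi It xi; have E2 := surface_speed hs hp xi.
  have E3 := rs_dynamic sol It xi; have E4 := psiex_surface hs x.
  have E5 := psie_mixed hs (surface_fluid hs x); rewrite /= in E5.
  rewrite /F1 /F2 E1 E4 (psiex_bed hs) (rs_bed sol x It) /surf_dphi -/(dw x) /dV /w /surfV /rdtau.
  have -> : P t x (e x) = - (rdy Pe x (e x) * eta t x) by apply/eqP; rewrite -addr_eq0 E3.
  move: E2; move: (rdy psie x (e x)) (rdx (rdy psie) x (e x)) (rdy (rdy psie) x (e x)) (de x) (rdy Pe x (e x))
    (rdx (psi t) x (e x)) (rdy (psi t) x (e x)) (dw x) (eta t x) (rdy psie x 0) (rdy (psi t) x 0).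
  move=> a b c d i j k l m n o E2.
  rewrite !(mulr0, mul0r, addr0, subr0, oppr0).
  transitivity (- (a * l) - (d * i) * m); first by ring.
  by rewrite -E2; ring.
transitivity (- (surfV L * w L) - - (surfV 0 * w 0)).
  apply: (@line_int_FTC _ 0 L (fun x => - (surfV x * w x)) _ L0).
    by move=> x _; exact: is_deriveN' (is_deriveM' (DV x) (Dw x)).
  move=> x _; apply: continuousN; apply: continuousD.
    apply: continuousM; last exact: is_derive_continuous (Dw x).
    exact: rdtau_cts (psieyC hs (surface_fluid hs x)).
  by apply: continuousM; [exact: surfV_cts|exact: rdtau_cts (surfVeta_C1 x It)].
have -> : surfV L * w L = surfV 0 * w 0; last by rewrite subrr.
apply: (@at_end _ alpha _ (fun x => surfV x * w x)) => x.
by rewrite surfV_per /w (sw_eta_per hs) psiey_per (rs_eta_per sol).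
Qed.

Lemma casimir_rate (xi : R -> R -> R) t :
  leb2.-integrable (cell L e) (fun p : R * R => (xi p.1 p.2)%:E) ->
  (forall phi, test_function (cell L e) phi ->
    area_int (cell L e) (fun x y => xi x y * rtransport psie phi x y) = 0) ->
  I t -> is_derive t 1 (fun s => area_int (cell L e) (fun x y => omega s x y * xi x y)) 0.
Proof.
move=> ixi xik It; have D := area_int_tC1 oI cel tC1_omega It ixi.
apply: is_derive_eq D _.
have cg := @dgamma_cts _ _ _ _ _ _ _ _ _ hs.
have c1 (r : R) : {for r, continuous (fun _ : R => 1 : R)} by exact: cvg_cst.
have Z1 := stream_kernel_zero ixi xik cg (fun q => psiC (p := q) It) (fun x y => rs_psi_per sol x y It).
have Z2 := stream_kernel_zero ixi xik c1 (fun q => omegaC (p := q) It) (fun x y => rs_omega_per sol x y It).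
have cZ (G : R -> R) h : (forall r, {for r, continuous G}) ->
    (forall q, closed_fluid e q -> C1_at h q) ->
    leb2.-integrable (cell L e) (fun p : R * R => (xi p.1 p.2 * (G (psie p.1 p.2) * rtransport psie h p.1 p.2))%:E).
  move=> cG hC.
  have cw : ctsC L e (fun x y => G (psie x y) * rtransport psie h x y).
    move=> q qc; apply: cts2M (stream_weight_cts cG (fluidC qc)) _.
    exact: rtransport_cts (psieC hs (fluidC qc)) (hC q (fluidC qc)).
  have [M M0 HM] := ctsC_bound cel cw.
  have bd (p : R * R) : cell L e p -> `|G (psie p.1 p.2) * rtransport psie h p.1 p.2| <= M.
    by case: p => x y pc; exact: HM (cell_sub pc).
  have := integrable_bounded_mul (@measurable_cell R L e cel) (ctsC_measurable cel cw) ixi bd.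
  by congr (_.-integrable _ _); apply/funext => p0'; rewrite /= mulrC.
have i1 := cZ _ _ cg (fun q => psiC (p := q) It).
have i2 := cZ _ _ c1 (fun q => omegaC (p := q) It).
transitivity (area_int (cell L e) (fun x y => xi x y * (derive1 gamma (clamp `|p0| (psie x y)) * rtransport psie (psi t) x y))
  - area_int (cell L e) (fun x y => xi x y * (1 * rtransport psie (omega t) x y))); last by rewrite Z1 Z2 subrr.
transitivity (area_int (cell L e) (fun x y => xi x y * (derive1 gamma (clamp `|p0| (psie x y)) * rtransport psie (psi t) x y)
  - xi x y * (1 * rtransport psie (omega t) x y))); last exact: (RintegralB (@measurable_cell R L e cel) i1 i2).
apply: eq_area_int => x y xy /=.
have qF := open_closed_fluid (cell_open_fluid xy).
have E := rs_vorticity sol It xy.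
rewrite -(dgam_psie qF) /dgam in E.
have {}E : dt omega t x y = derive1 gamma (clamp `|p0| (psie x y)) * rtransport psie (psi t) x y - rtransport psie (omega t) x y.
  by rewrite -E addrK.
by rewrite /omegat E mul1r -mulrBr mulrC.
Qed.

End RealSolution.

(** * Complex solutions *)

Section RealInvariants.
Context {R : realType}.
Variables (g alpha p0 beta B : R) (gamma e : R -> R) (psie Pe : R -> R -> R).
Hypothesis hs : steady_wave g alpha p0 beta B gamma e psie.
Hypothesis hp : steady_pressure g e psie Pe.
Variable I : set R.
Hypothesis oI : open I.
Hypothesis hI : is_interval I.
Variables (eta : R -> R -> R) (psi omega P : R -> R -> R -> R).
Notation L := (period alpha).
Hypothesis sol : real_solution L gamma e psie Pe I eta psi omega P.
Let e0 := sw_eta_pos hs.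
Let L0 : 0 < L := period_gt0 hs.
Let cel : forall x : R, {for x, continuous e} := etae_cts hs.
Notation segL := [set x : R | 0 <= x <= L].

Lemma real_mass_invariant : time_invariant I (fun t => line_int 0 L (eta t)).
Proof. exact: (constant_of_derive0 hI (mass_rate hs oI sol)). Qed.

Lemma real_energy_invariant :
  (forall s, s \in `[0, `|p0|] -> derive1 gamma s != 0) ->
  time_invariant I (fun t => kinetic alpha e psi t + surf_energy g alpha e psie eta psi t
    - enstrophy alpha p0 gamma e psie omega t).
Proof.
move=> n0; apply: (constant_of_derive0 hI) => t It.
have := is_deriveB' (energy_rate hs hp oI sol It) (enstrophy_rate hs oI sol n0 It).
by rewrite subrr.
Qed.

Lemma real_irrotational_energy_invariant :
  (forall t x y, I t -> cell L e (x, y) -> omega t x y = 0) ->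
  time_invariant I (fun t => kinetic alpha e psi t + surf_energy g alpha e psie eta psi t).
Proof.
move=> w0; apply: (constant_of_derive0 hI) => t It.
apply: is_derive_eq (energy_rate hs hp oI sol It) _.
(* Zero is written as a multiple of the zero function so that linearity of the integral evaluates
   it. *)
rewrite (@eq_area_int _ _ _ _ (fun _ _ => 0 * 0)); last first.
  move=> x y xy; rewrite mul0r.
  have nI : nbhs t I by exact: open_nbhs_nbhs.
  have D0 : is_derive t 1 (fun s => omega s x y) 0.
    apply: (near_eq_is_derive (nbhsS _ nI) (is_derive_cst (0 : R) t 1)).
    by move=> s Is; rewrite (w0 _ _ _ Is xy).
  by rewrite /omegat /dt (is_derive_derive1E D0) mulr0.
rewrite (@area_intZ _ _ _ L0 cel 0 (fun _ _ => 0)) ?mul0r//.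
by move=> q _; exact: cts2_cst.
Qed.

(** The fundamental theorem on each vertical. The freedom of adding a function of time to [psi]
    shows only in the last term, which [bed_normalized] freezes. *)
Lemma surface_stream_integral t : I t ->
  line_int 0 L (fun x => psi t x (e x) + surfV e psie x * eta t x) =
  area_int (cell L e) (rdy (psi t)) + line_int 0 L (fun x => surfV e psie x * eta t x)
  + line_int 0 L (fun x => psi t x 0).
Proof.
move=> It.
have cs : ctsI 0 L (fun x => psi t x (e x)).
  by move=> x _; exact: (cts2_curve (C1_at_cts (psiC sol It (surface_fluid hs x))) (@cel x)).
have c0 (x : R) : {for x, continuous (fun _ : R => 0 : R)} by exact: cvg_cst.
have cb : ctsI 0 L (fun x => psi t x 0).
  by move=> x _; exact: (cts2_curve (c := fun _ => 0) (C1_at_cts (psiC sol It (bed_fluid hs x))) (@c0 x)).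
have cV : ctsI 0 L (fun x => surfV e psie x * eta t x).
  move=> x xi; apply: continuousM; first exact: (@surfV_cts _ _ _ _ _ _ _ _ _ hs x).
  exact: (tC1_slice (tC1_eta sol) It xi).1.
have cy : ctsC L e (rdy (psi t)).
  by move=> q qc; exact: C1_at_cts (psiyC sol It (closed_cell_fluid qc)).
rewrite (area_int_lines L0 cel cy).
rewrite (@eq_line_int _ _ _ (fun x => line_int 0 (e x) (rdy (psi t) x)) (fun x => psi t x (e x) - psi t x 0)).
  by rewrite (line_intD cs cV) (line_intB cs cb); ring.
move=> x _; apply: (line_int_FTC (e0 x)).
  by move=> y /andP yi; exact: C1_at_dy (psiC sol It (yi : closed_fluid e (x, y))).
by move=> y /andP yi; exact: cts2_slice (C1_at_cts (psiyC sol It (yi : closed_fluid e (x, y)))).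
Qed.

Lemma real_momentum_invariant :
  (forall s t x, I s -> I t -> psi s x 0 = psi t x 0) ->
  time_invariant I (fun t => line_int 0 L (fun x => psi t x (e x) + surfV e psie x * eta t x)).
Proof.
move=> bn s t Is It; rewrite (surface_stream_integral Is) (surface_stream_integral It).
congr (_ + _); first exact: (constant_of_derive0 hI (momentum_rate hs hp oI sol)).
by apply: eq_line_int => x _; exact: bn.
Qed.

Lemma real_casimir_invariant (xi : R -> R -> R) :
  leb2.-integrable (cell L e) (fun p : R * R => (xi p.1 p.2)%:E) ->
  (forall phi, test_function (cell L e) phi ->
    area_int (cell L e) (fun x y => xi x y * rtransport psie phi x y) = 0) ->
  time_invariant I (fun s => area_int (cell L e) (fun x y => omega s x y * xi x y)).
Proof.
move=> ixi xik; apply: (constant_of_derive0 hI) => t It.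
exact: (casimir_rate hs oI sol ixi xik It).
Qed.

Lemma casimir_integrable (xi : R -> R -> R) t : I t ->
  leb2.-integrable (cell L e) (fun p : R * R => (xi p.1 p.2)%:E) ->
  leb2.-integrable (cell L e) (fun p : R * R => (omega t p.1 p.2 * xi p.1 p.2)%:E).
Proof.
move=> It ixi.
have cw : ctsC L e (omega t).
  by move=> q qc; exact: C1_at_cts (omegaC sol It (closed_cell_fluid qc)).
have [M M0 HM] := ctsC_bound cel cw.
have bd (p : R * R) : cell L e p -> `|omega t p.1 p.2| <= M.
  by case: p => x y pc; exact: HM (cell_sub pc).
exact: (integrable_bounded_mul (@measurable_cell R L e cel) (ctsC_measurable cel cw) ixi bd).
Qed.

End RealInvariants.

(** * Splitting a complex solution into two real ones *)

Section Parts.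
Context {R : realType}.
Implicit Types (z : R[i]) (b : bool).

(** The Boolean lets the real and the imaginary part share one argument. *)
Definition part b z : R := if b then complex.Re z else complex.Im z.

Lemma partD b z w : part b (z + w) = part b z + part b w.
Proof. by case: b z w => -[? ?] [? ?]. Qed.

Lemma partN b z : part b (- z) = - part b z.
Proof. by case: b z => -[? ?]. Qed.

Lemma partZ b (r : R) z : part b ((r%:C)%C * z) = r * part b z.
Proof. by case: b z => -[? ?] /=; rewrite mul0r ?subr0 ?addr0. Qed.

Lemma part0 b : part b 0 = 0.
Proof. by case: b. Qed.

Definition cpart b (f : R -> R -> R[i]) x y := part b (f x y).

Lemma part_dn b e f x y : part b (dn e f x y) = rdn e (cpart b f) x y.
Proof. by rewrite /dn partD partN partZ; case: b. Qed.

Lemma cpart_dn b e f : cpart b (dn e f) = rdn e (cpart b f).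
Proof. by apply/funext => x; apply/funext => y; exact: part_dn. Qed.

Lemma cpartZ b (u : R -> R -> R) f :
  cpart b (fun x y => ((u x y)%:C)%C * f x y) = (fun x y => u x y * cpart b f x y).
Proof. by apply/funext => x; apply/funext => y; exact: partZ. Qed.

(** Here and in the next lemmas the derivatives occurring in an equation are replaced by arbitrary
    complex numbers, while the coefficients stay real. The parts of [cdx] and [cdy] are by
    definition the derivatives of the parts, so the results match the fields of [real_solution] by
    conversion once [b] is known. *)
Lemma part_laplace b w z1 z2 : w = - (z1 + z2) -> part b w = - (part b z1 + part b z2).
Proof. by move=> ->; rewrite partN partD. Qed.

Lemma part_vorticity b (a c d : R) z1 z2 z3 z4 z5 :
  z1 + (a%:C%C * z2 - c%:C%C * z3) = d%:C%C * (a%:C%C * z4 - c%:C%C * z5) ->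
  part b z1 + (a * part b z2 - c * part b z3) = d * (a * part b z4 - c * part b z5).
Proof. by move=> /(congr1 (part b)); rewrite !(partD, partN, partZ). Qed.

Lemma part_euler b (a c d h : R) z1 z2 z3 z4 z5 z6 :
  z1 + (a%:C%C * z2 - c%:C%C * z3) + d%:C%C * z4 - h%:C%C * z5 = - z6 ->
  part b z1 + (a * part b z2 - c * part b z3) + d * part b z4 - h * part b z5 = - part b z6.
Proof. by move=> /(congr1 (part b)); rewrite !(partD, partN, partZ). Qed.

Lemma part_kinematic b (d : R) z1 z2 z3 z4 z5 :
  z1 + (z2 + d%:C%C * z3) + (z4 + d%:C%C * z5) = 0 ->
  part b z1 + (part b z2 + d * part b z3) + (part b z4 + d * part b z5) = 0.
Proof. by move=> /(congr1 (part b)); rewrite !(partD, partN, partZ, part0). Qed.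

Lemma part_dynamic b (d : R) z1 z2 : z1 + d%:C%C * z2 = 0 -> part b z1 + d * part b z2 = 0.
Proof. by move=> /(congr1 (part b)); rewrite !(partD, partN, partZ, part0). Qed.

Lemma part_tangential b (d a : R) z1 z2 z3 z4 z5 z6 z7 :
  z1 + (z2 + d%:C%C * z3) + a%:C%C * (z4 + d%:C%C * z5) + (z6 + d%:C%C * z7) = 0 ->
  part b z1 + (part b z2 + d * part b z3) + a * (part b z4 + d * part b z5) + (part b z6 + d * part b z7) = 0.
Proof. by move=> /(congr1 (part b)); rewrite !(partD, partN, partZ, part0). Qed.

Lemma part_solution (L : R) gamma e psie Pe I eta psi omega P b :
  linearized_solution L gamma e psie Pe I eta psi omega P ->
  real_solution L gamma e psie Pe I (cpart b eta) (fun t => cpart b (psi t))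
    (fun t => cpart b (omega t)) (fun t => cpart b (P t)).
Proof.
move=> s; split.
- case: b; [exact (proj1 (ls_eta_reg s))|exact (proj2 (ls_eta_reg s))].
- case: b; [exact (proj1 (ls_psi_reg s))|exact (proj2 (ls_psi_reg s))].
- case: b; [exact (proj1 (ls_psix_reg s))|exact (proj2 (ls_psix_reg s))].
- case: b; [exact (proj1 (ls_psiy_reg s))|exact (proj2 (ls_psiy_reg s))].
- case: b; [exact (proj1 (ls_omega_reg s))|exact (proj2 (ls_omega_reg s))].
- case: b; [exact (proj1 (ls_P_reg s))|exact (proj2 (ls_P_reg s))].
- by move=> t x It; rewrite /cpart (ls_eta_per s).
- by move=> t x y It; rewrite /cpart (ls_psi_per s).
- by move=> t x y It; rewrite /cpart (ls_omega_per s).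
- by move=> t x y It; rewrite /cpart (ls_P_per s).
- move=> t x y It xy; move: (part_laplace b (ls_omega s It xy)).
  case: b; exact id.
- move=> t x y It xy; move: (part_vorticity b (ls_vorticity s It xy)).
  case: b; exact id.
- move=> t x y It xy; move: (part_euler b (ls_euler_x s It xy)).
  case: b; exact id.
- move=> t x It xi; move: (part_kinematic b (ls_kinematic s It xi)).
  (* The part of a product is not convertible to the coefficient times the part, so under a
     derivative the real coefficient is taken out by an equality of functions. *)
  rewrite -(cpartZ b (rdy psie) (fun a c => eta t a)).
  case: b; exact id.
- move=> t x It xi; move: (part_dynamic b (ls_dynamic s It xi)).
  case: b; exact id.
- move=> t x It xi; move: (part_tangential b (ls_tangential s It xi)).
  rewrite -(cpart_dn b e (psi t)) -(cpartZ b (rdy psie) (dn e (psi t))).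
  have -> : (fun s => rdn e (cpart b (psi s)) x (e x)) = (fun s => part b (dn e (psi s) x (e x))).
    by apply/funext => r; rewrite part_dn.
  case: b; exact id.
- move=> t x It; move: (congr1 (part b) (ls_bed s x It)).
  case: b; exact id.
Qed.
End Parts.

Section Complex.
Context {R : realType}.
Variables (g alpha p0 beta B : R) (gamma e : R -> R) (psie Pe : R -> R -> R).
Hypothesis hs : steady_wave g alpha p0 beta B gamma e psie.
Variable I : set R.
Variables (eta : R -> R -> R[i]) (psi omega P : R -> R -> R -> R[i]).
Notation L := (period alpha).
Hypothesis sol : linearized_solution L gamma e psie Pe I eta psi omega P.
Let L0 : 0 < L := period_gt0 hs.
Let cel : forall x : R, {for x, continuous e} := etae_cts hs.
Let rsol b := part_solution b sol.

Definition psi_part b t := cpart b (psi t).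
Definition omega_part b t := cpart b (omega t).

Lemma kinetic_parts t : I t ->
  area_int (cell L e) (fun x y => 2^-1 * gradsq (psi t) x y) =
  kinetic alpha e (psi_part true) t + kinetic alpha e (psi_part false) t.
Proof.
move=> It.
have ck b : ctsC L e (fun x y => 2^-1 * (rdx (psi_part b t) x y * rdx (psi_part b t) x y +
    rdy (psi_part b t) x y * rdy (psi_part b t) x y)).
  move=> q qc; have qF := closed_cell_fluid qc.
  have cx := C1_at_cts (psixC (rsol b) It qF); have cy := C1_at_cts (psiyC (rsol b) It qF).
  exact: cts2M (cts2_cst 2^-1 q) (cts2D (cts2M cx cx) (cts2M cy cy)).
rewrite /kinetic -(area_intD L0 cel (ck true) (ck false)).
apply: eq_area_int => x y _; rewrite /gradsq /abs2.
change (2^-1 * (rdx (psi_part true t) x y ^+ 2 + rdx (psi_part false t) x y ^+ 2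
   + (rdy (psi_part true t) x y ^+ 2 + rdy (psi_part false t) x y ^+ 2)) = 2^-1 *
   (rdx (psi_part true t) x y * rdx (psi_part true t) x y + rdy (psi_part true t) x y * rdy (psi_part true t) x y) +
   2^-1 * (rdx (psi_part false t) x y * rdx (psi_part false t) x y + rdy (psi_part false t) x y * rdy (psi_part false t) x y)).
move: (rdx _ x y) (rdx _ x y) (rdy _ x y) (rdy _ x y) => a b c d; ring.
Qed.

Lemma enstrophy_parts t : I t ->
  (forall s, s \in `[0, `|p0|] -> derive1 gamma s != 0) ->
  area_int (cell L e) (fun x y => 2^-1 * (derive1 gamma (psie x y))^-1 * abs2 (omega t x y)) =
  enstrophy alpha p0 gamma e psie (omega_part true) t + enstrophy alpha p0 gamma e psie (omega_part false) t.
Proof.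
move=> It n0.
have ck b : ctsC L e (fun x y => 2^-1 * inv_dgam p0 gamma (psie x y) * (omega_part b t x y * omega_part b t x y)).
  move=> q qc; have qF := closed_cell_fluid qc.
  have co := C1_at_cts (omegaC (rsol b) It qF).
  apply: cts2M (cts2M co co); apply: cts2M (cts2_cst 2^-1 q) _.
  exact: (stream_weight_cts hs (fun r => inv_dgam_cts hs n0 (s := r)) qF).
rewrite /enstrophy -(area_intD L0 cel (ck true) (ck false)).
apply: eq_area_int => x y xy; have qF := open_closed_fluid (cell_open_fluid xy).
rewrite /inv_dgam (dgam_psie hs qF) /abs2 /omega_part /cpart /part.
move: (_^-1) (_^-1) (complex.Re _) (complex.Im _) => a b c d; ring.
Qed.

(** The real part of a number times the conjugate of another is their inner product in the plane, so
    the surface terms do not mix real and imaginary parts. *)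
Lemma surface_parts t : I t ->
  surface_energy g L e psie (eta t) (psi t) =
  surf_energy g alpha e psie (cpart true eta) (psi_part true) t +
  surf_energy g alpha e psie (cpart false eta) (psi_part false) t.
Proof.
move=> It.
have c1 b : ctsI 0 L (fun x => 2^-1 * surf_coef g e psie x * (cpart b eta t x * cpart b eta t x)).
  move=> x xi; have ch : {for x, continuous (fun _ : R => 2^-1 : R)} by exact: cvg_cst.
  have cn := (tC1_slice (tC1_eta (rsol b)) It xi).1.
  exact: continuousM (continuousM ch (@surf_coef_cts _ _ _ _ _ _ _ _ _ hs x)) (continuousM cn cn).
have c2 b : ctsI 0 L (fun x => surfV e psie x * (surfN e (psi_part b) t x * cpart b eta t x)).
  move=> x xi; apply: continuousM; first exact: (@surfV_cts _ _ _ _ _ _ _ _ _ hs x).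
  by apply: continuousM; [exact: (tC1_slice (tC1_surfN hs (rsol b)) It xi).1
    |exact: (tC1_slice (tC1_eta (rsol b)) It xi).1].
rewrite /surf_energy addrACA -(line_intD (c1 true) (c1 false)) -(line_intD (c2 true) (c2 false)).
congr (_ + _).
  apply: eq_line_int => x _; rewrite /abs2 /surf_coef /cpart /part.
  move: (_ + g) (complex.Re _) (complex.Im _) => a b c; ring.
apply: eq_line_int => x _.
have Er : complex.Re (dn e (psi t) x (e x)) = surfN e (psi_part true) t x := part_dn true e (psi t) x (e x).
have Ei : complex.Im (dn e (psi t) x (e x)) = surfN e (psi_part false) t x := part_dn false e (psi t) x (e x).
move: Er Ei; rewrite /cpart /part /surfV; move: (dn e (psi t) x (e x)) (eta t x) => -[a b] [c d] /= <- <-.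
ring.
Qed.

Lemma momentum_parts t : momentum L e psie (eta t) (psi t) =
  (line_int 0 L (fun x => psi_part true t x (e x) + surfV e psie x * cpart true eta t x) +i*
   line_int 0 L (fun x => psi_part false t x (e x) + surfV e psie x * cpart false eta t x))%C.
Proof.
have E b x : part b (psi t x (e x) + (rdy psie x (e x))%:C%C * eta t x) =
    psi_part b t x (e x) + surfV e psie x * cpart b eta t x by rewrite partD partZ.
rewrite /momentum /csurf_int /surf_int; congr (_ +i* _)%C.
  by apply: eq_line_int => x _; exact: (E true).
by apply: eq_line_int => x _; exact: (E false).
Qed.

(** The cell has finite area, and [|a| <= 1 + a^2]. *)
Lemma square_integrable_integrable (f : R -> R -> R) : square_integrable (cell L e) f ->
  leb2.-integrable (cell L e) (fun p : R * R => (f p.1 p.2)%:E).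
Proof.
move=> [mf if2].
have mD := @measurable_cell R L e cel.
have i1 := unit_integrable hs.
have i2 := integrableD mD i1 if2.
apply: (le_integrable mD _ _ i2); first exact/measurable_EFinP.
move=> p _; change (`|(f p.1 p.2)%:E| <= `|(1 + f p.1 p.2 ^+ 2)%:E|)%E.
rewrite lee_fin (@ger0_norm _ (1 + _)); last by rewrite addr_ge0// sqr_ge0.
rewrite -(real_normK (num_real (f p.1 p.2))).
by move: `|f p.1 p.2| (normr_ge0 (f p.1 p.2)) => a a0; nra.
Qed.

(** The transported test function is real, so the complex kernel condition consists of one real
    condition for each part of [xi]. *)
Lemma kernel_part (xi : R -> R -> R[i]) b : transport_kernel L e psie xi ->
  leb2.-integrable (cell L e) (fun p : R * R => (cpart b xi p.1 p.2)%:E) /\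
  forall phi, test_function (cell L e) phi ->
    area_int (cell L e) (fun x y => cpart b xi x y * rtransport psie phi x y) = 0.
Proof.
move=> [sr si ker]; split.
  by case: b; [exact: square_integrable_integrable sr|exact: square_integrable_integrable si].
move=> phi /ker /(congr1 (part b)); rewrite part0.
have E x y : cpart b xi x y * rtransport psie phi x y =
    part b (xi x y * (rtransport psie phi x y)%:C%C) by rewrite mulrC -partZ mulrC.
move=> <-; rewrite (_ : part b (carea_int _ _) = area_int (cell L e)
    (fun x y => part b (xi x y * (rtransport psie phi x y)%:C%C))); last by case: b {E}.
by apply: eq_area_int => x y _; exact: E.
Qed.

(** The pairing is bilinear, without conjugation, so all four combinations of the parts of [omega]
    and [xi] occur; each is a Casimir of a real solution with a real kernel element. *)
Lemma casimir_parts (xi : R -> R -> R[i]) t : I t -> transport_kernel L e psie xi ->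
  let M b c := area_int (cell L e) (fun x y => omega_part b t x y * cpart c xi x y) in
  casimir L e xi (omega t) = ((M true true - M false false) +i* (M true false + M false true))%C.
Proof.
move=> It kxi M.
have mD := @measurable_cell R L e cel.
have ii b c := casimir_integrable hs (rsol b) It (kernel_part c kxi).1.
rewrite /casimir /carea_int; congr (_ +i* _)%C.
  rewrite /M {2 3}/area_int -(RintegralB mD (ii true true) (ii false false)).
  apply: eq_Rintegral => -[x y] _ /=; rewrite /omega_part /cpart /part.
  by move: (omega t x y) (xi x y) => -[a b] [c d].
rewrite /M {2 3}/area_int -(RintegralD mD (ii true false) (ii false true)).
apply: eq_Rintegral => -[x y] _ /=; rewrite /omega_part /cpart /part.
by move: (omega t x y) (xi x y) => -[a b] [c d].
Qed.

End Complex.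

Theorem proposition3p5 (R : realType) (g alpha p0 beta B : R)
    (gamma etae : R -> R) (psie Pe : R -> R -> R)
    (hsteady : steady_wave g alpha p0 beta B gamma etae psie)
    (hpressure : steady_pressure g etae psie Pe)
    (I : set R) (hIopen : open I) (hI : is_interval I)
    (eta : R -> R -> complex R) (psi omega P : R -> R -> R -> complex R)
    (hsol : linearized_solution (period alpha) gamma etae psie Pe I
              eta psi omega P) :
  (((forall s, s \in `[0, `|p0|] -> derive1 gamma s < 0) \/
    (forall s, s \in `[0, `|p0|] -> 0 < derive1 gamma s)) ->
   time_invariant I (fun t =>
     energy_monotone g (period alpha) gamma etae psie
       (eta t) (psi t) (omega t))) /\
  ((forall s, s \in `[0, `|p0|] -> gamma s = 0) ->
   irrotational (period alpha) etae I omega ->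
   time_invariant I (fun t =>
     energy_irrotational g (period alpha) etae psie (eta t) (psi t))) /\
  (bed_normalized I psi ->
   time_invariant I (fun t =>
     momentum (period alpha) etae psie (eta t) (psi t))) /\
  time_invariant I (fun t => mass (period alpha) etae (eta t)) /\
  (forall xi : R -> R -> complex R,
   transport_kernel (period alpha) etae psie xi ->
   time_invariant I (fun t =>
     casimir (period alpha) etae xi (omega t))).
Proof.
have rsol b := part_solution b hsol.
split; [|split; [|split; [|split]]].
- move=> mono s t Is It.
  have n0 r : r \in `[0, `|p0|] -> derive1 gamma r != 0.
    by move=> ri; case: mono => h; [exact: ltr0_neq0 (h r ri)|exact: lt0r_neq0 (h r ri)].
  have E b := real_energy_invariant hsteady hpressure hIopen hI (rsol b) n0 Is It.
  rewrite /energy_monotone (kinetic_parts hsteady hsol Is) (enstrophy_parts hsteady hsol Is n0).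
  rewrite (kinetic_parts hsteady hsol It) (enstrophy_parts hsteady hsol It n0).
  rewrite (surface_parts hsteady hsol Is) (surface_parts hsteady hsol It).
  move: (E true) (E false); rewrite /psi_part /omega_part.
  move: (kinetic _ _ _ s) (kinetic _ _ _ s) (kinetic _ _ _ t) (kinetic _ _ _ t).
  move=> k1 k2 k3 k4 /eqP; rewrite subr_eq => /eqP E1 /eqP; rewrite subr_eq => /eqP E2.
  lra.
- move=> _ irr s t Is It.
  have E b : time_invariant I (fun t => kinetic alpha etae (psi_part psi b) t +
      surf_energy g alpha etae psie (cpart b eta) (psi_part psi b) t).
    apply: (real_irrotational_energy_invariant hsteady hpressure hIopen hI (rsol b)).
    by move=> r x y Ir xy; rewrite /cpart (irr _ _ _ Ir xy) part0.
  rewrite /energy_irrotational (kinetic_parts hsteady hsol Is) (kinetic_parts hsteady hsol It).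
  rewrite (surface_parts hsteady hsol Is) (surface_parts hsteady hsol It).
  move: (E true s t Is It) (E false s t Is It).
  move: (kinetic _ _ _ s) (kinetic _ _ _ s) (kinetic _ _ _ t) (kinetic _ _ _ t).
  by move=> k1 k2 k3 k4 E1 E2; lra.
- move=> bn s t Is It; rewrite (momentum_parts _ _ _ _ _ s) (momentum_parts _ _ _ _ _ t).
  have bnp b r u x : I r -> I u -> cpart b (psi r) x 0 = cpart b (psi u) x 0.
    by move=> Ir Iu; rewrite /cpart (bn _ _ x Ir Iu).
  have E b := real_momentum_invariant hsteady hpressure hIopen hI (rsol b) (bnp b) Is It.
  by congr (_ +i* _)%C; [exact: (E true)|exact: (E false)].
- move=> s t Is It.
  have E b := real_mass_invariant hsteady hIopen hI (rsol b) Is It.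
  by rewrite /mass /csurf_int; congr (_ +i* _)%C; [exact: (E true)|exact: (E false)].
- move=> xi kxi s t Is It.
  rewrite (casimir_parts hsteady hsol Is kxi) (casimir_parts hsteady hsol It kxi); cbv beta zeta.
  have E b c : area_int (cell (period alpha) etae) (fun x y => omega_part omega b s x y * cpart c xi x y)
      = area_int (cell (period alpha) etae) (fun x y => omega_part omega b t x y * cpart c xi x y).
    have [ixi xik] := kernel_part hsteady c kxi.
    exact: (real_casimir_invariant hsteady hIopen hI (rsol b) ixi xik Is It).
  by rewrite (E true true) (E false false) (E true false) (E false true).
Qed.
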